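(* Let $(M,L_1,L_2)$ be a path geometry and $\mathbb{S}D^*\subset\mathbb{S}D$ the set of rays in $D=L_1\oplus L_2$ not contained in $L_1\cup L_2$. Then there is a canonically associated conformal class of metrics of signature $(2,2)$ on $\mathbb{S}D^*$ (the Fefferman metric), defined as follows. Associated with each contact 1-form $\eta^3$ on $M$ (with $\ker\eta^3=D$) is the $\mathbb{R}^*$-reduction $B\to M$ of the coframe bundle of $M$ whose local sections are the coframes $(\eta^1,\eta^2,\eta^3)$ with $$d\eta^3=\eta^1\wedge\eta^2,\qquad \eta^1|_{L_2}=\eta^2|_{L_1}=0,$$ a unique $\mathbb{R}^*$-connection form $\alpha$ on $B$ satisfying $$d\omega^1=-\alpha\wedge\omega^1+a_1\,\omega^2\wedge\omega^3,\quad d\omega^2=\alpha\wedge\omega^2+a_2\,\omega^3\wedge\omega^1,\quad d\omega^3=\omega^1\wedge\omega^2$$ for some functions $a_1,a_2$ on $B$, where $\omega^1,\omega^2,\omega^3$ are the tautological 1-forms on the coframe bundle restricted to $B$, and the 1-form $$\sigma:=-\tfrac23\alpha+\tfrac16K\omega^3,$$ where the function $K$ on $B$ is defined by $d\alpha=b_1\omega^2\wedge\omega^3+b_2\omega^3\wedge\omega^1+K\omega^1\wedge\omega^2$. Then $$\mathrm{g}:=\omega^1\cdot\omega^2+\omega^3\cdot\sigma$$ is a pseudo-Riemannian metric on $B$ of signature $(2,2)$. There is also associated with $\eta^3$ a decomposition $\mathbb{S}D^*=\mathbb{S}D^+\cup\mathbb{S}D^-$ and $\mathbb{R}^*$-isomorphisms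 $h:B\to\mathbb{S}D^+$, $J\circ h:B\to\mathbb{S}D^-$, where $h(u)=[X]$ with $u^1(X)=u^2(X)=1$, $u^3(X)=0$, and $J(X_1+X_2)=X_1-X_2$ for $X_i\in L_i$, such that the conformal class of the induced metric on $\mathbb{S}D^*$ (the metric $\mathrm{g}$ transported to $\mathbb{S}D^+$ by $h$ and to $\mathbb{S}D^-$ by $J\circ h$) is independent of the choice of $\eta^3$; in fact, multiplying $\eta^3$ by a smooth non-vanishing function rescales the induced metric on $\mathbb{S}D^*$ by the same factor.
   Context: A (2-dimensional) path geometry is a smooth 3-manifold $M$ with an ordered pair of smooth line fields $L_1,L_2\subset TM$ spanning a contact distribution $D=L_1\oplus L_2$. $\mathbb{S}D$ is the spherization of $D$: the quotient of $D$ minus the zero section by positive dilations; $[X]$ is the ray of $X$. $D^*=D\setminus(L_1\cup L_2)$. The coframe bundle $F^*\to M$ has as fiber at $x$ the linear isomorphisms $u=(u^1,u^2,u^3)^t:T_xM\to\mathbb{R}^3$; its tautological $\mathbb{R}^3$-valued 1-form $\omega$ at $u$ is $u\circ d\pi_u$, $\pi:F^*\to M$ the projection. The group $\mathbb{R}^*$ acts on $B$ by $(u^1,u^2,u^3)\mapsto(u^1/s,su^2,u^3)$ and on $\mathbb{S}D^*$ by $[X_1+X_2]\mapsto[sX_1+X_2/s]$, $X_i\in L_i$. The symbol $\cdot$ is the symmetric product of 1-forms. The decomposition of $\mathbb{S}D^*$ associated with $\eta^3$ is given by the sign of $d\eta^3(JX,X)$: $\mathbb{S}D^{+}$ (resp.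 $\mathbb{S}D^-$) is the set of rays $[X]$, $X\in D^*$, with $d\eta^3(JX,X)>0$ (resp. $<0$). Since a global contact form need not exist, $\eta^3$ may be defined only on an open subset of $M$; the conformal classes so defined over open subsets agree on intersections. *)

(* Defs.v *)
From HB Require Import structures.
From mathcomp Require Import all_boot all_order all_algebra.
From mathcomp Require Import all_classical all_reals all_analysis.
Set Implicit Arguments.
Unset Strict Implicit.
Unset Printing Implicit Defensive.
Import Order.TTheory GRing.Theory Num.Theory.
Import numFieldNormedType.Exports.
Local Open Scope classical_set_scope.
Local Open Scope ring_scope.

(* Only used with V, W finite dimensional and U open. *)
Fixpoint Ck (R : realType) (V W : normedModType R) (k : nat)
    (U : set V) (f : V -> W) : Prop :=
  match k with
  | 0 => forall x, U x -> {for x, continuous f}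
  | k'.+1 => (forall x, U x -> differentiable f x) /\
             (forall v : V, Ck k' U (fun x => 'D_v f x))
  end.

Definition smooth_on (R : realType) (V W : normedModType R)
    (U : set V) (f : V -> W) : Prop := forall k, Ck k U f.

(* A patch is the inverse of a chart: [par] restricted to [dom]. *)
Record patch (T : Type) (E : Type) := Patch { dom : set E; par : E -> T }.

Record premanifold (T : Type) (E : Type) :=
  Premanifold { pts : set T; atlas : set (patch T E) }.

Section Manifolds.
Context {R : realType} {T : Type} {E : normedModType R}.
Implicit Types (P Q : patch T E) (N : premanifold T E) (p : T).

Definition rng P : set T := par P @` dom P.

Definition coord P p : E := xget 0 [set y | dom P y /\ par P y = p].

Definition mopen N (O : set T) : Prop :=
  O `<=` pts N /\ forall P, atlas N P -> open (dom P `&` par P @^-1` O).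

(* A smooth manifold modelled on E: Hausdorff and second countable. *)
Definition is_manifold N : Prop :=
  [/\ (forall P, atlas N P ->
         [/\ open (dom P), {in dom P &, injective (par P)} &
             rng P `<=` pts N]),
      (forall p, pts N p -> exists2 P, atlas N P & rng P p),
      (forall P Q, atlas N P -> atlas N Q ->
         let W := dom P `&` par P @^-1` rng Q in
         open W /\ smooth_on W (coord Q \o par P)),
      (forall p q, pts N p -> pts N q -> p <> q ->
         exists O O' : set T, [/\ mopen N O, mopen N O', O p, O' q &
                                  O `&` O' = set0]) &
      (exists b : nat -> set T, (forall n, mopen N (b n)) /\
         forall O p, mopen N O -> O p -> exists n, b n p /\ b n `<=` O)].

(* A patch around p, chosen once and for all; the tangent space of N at p is
   E, a vector being identified with its components in the chart [patch_at]. *)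
Definition patch_at N p : patch T E :=
  match pselect (exists P, atlas N P /\ rng P p) with
  | left h => projT1 (cid h)
  | right _ => Patch set0 (fun=> p)
  end.

(* The tangent vector at [par P y] with components v in the chart of P. *)
Definition dpatch N P (y v : E) : E :=
  'D_v (coord (patch_at N (par P y)) \o par P) y.

(* The components in the chart of P of the tangent vector w at p. *)
Definition tcoord N P p (w : E) : E :=
  'D_w (coord P \o par (patch_at N p)) (coord (patch_at N p) p).

Definition smooth_fun N (O : set T) (f : T -> R) : Prop :=
  forall P, atlas N P ->
    smooth_on (dom P `&` par P @^-1` O) ((f \o par P) : E -> R^o).

Definition smooth_field N (O : set T) (X : T -> E) : Prop :=
  forall P, atlas N P ->
    smooth_on (dom P `&` par P @^-1` O) (fun y => tcoord N P (par P y) (X (par P y))).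

Definition is_form1 N (O : set T) (a : T -> E -> R) : Prop :=
  (forall p, O p -> scalar (a p)) /\
  (forall P, atlas N P -> forall v,
     smooth_on (dom P `&` par P @^-1` O)
       ((fun y => a (par P y) (dpatch N P y v)) : E -> R^o)).

(* The exterior derivative, computed in the chart [patch_at N p]; convention
   (da)(X,Y) = X(a(Y)) - Y(a(X)) - a([X,Y]). *)
Definition dform N (a : T -> E -> R) (p : T) (v w : E) : R :=
  let P := patch_at N p in
  let y := coord P p in
  'D_v ((fun z => a (par P z) (dpatch N P z w)) : E -> R^o) y
  - 'D_w ((fun z => a (par P z) (dpatch N P z v)) : E -> R^o) y.

Definition wedge (a b : T -> E -> R) (p : T) (v w : E) : R :=
  a p v * b p w - a p w * b p v.

(* Half the symmetrized tensor product: the square of a is a (x) a. *)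
Definition symprod (a b : T -> E -> R) (p : T) (v w : E) : R :=
  (a p v * b p w + b p v * a p w) / 2.

Definition is_metric22 N (O : set T) (g : T -> E -> E -> R) : Prop :=
  [/\ (forall p, O p ->
         (forall v, scalar (g p v)) /\ (forall v w, g p v w = g p w v)),
      (forall P, atlas N P -> forall v w,
         smooth_on (dom P `&` par P @^-1` O)
           ((fun y => g (par P y) (dpatch N P y v) (dpatch N P y w)) : E -> R^o)) &
      (forall p, O p -> exists L : {linear 'rV[R]_4 -> E}, bijective L /\
         forall x y : 'rV[R]_4, g p (L x) (L y) =
           x 0 (inord 0) * y 0 (inord 0) + x 0 (inord 1) * y 0 (inord 1)
           - x 0 (inord 2) * y 0 (inord 2) - x 0 (inord 3) * y 0 (inord 3))].

(* [conformal N O g O' g']: the metrics g on O and g' on O' are conformal on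
   the overlap, with a factor of either sign. *)
Definition conformal N (O : set T) (g : T -> E -> E -> R)
    (O' : set T) (g' : T -> E -> E -> R) : Prop :=
  exists f : T -> R, smooth_fun N (O `&` O') f /\
    forall p, (O `&` O') p ->
      f p != 0 /\ forall v w, g' p v w = f p * g p v w.

(* A conformal class of metrics of signature (2,2) on the open subset S:
   a maximal family of pairwise conformal local metrics covering S. *)
Definition conformal_class N (S : set T)
    (C : set T -> (T -> E -> E -> R) -> Prop) : Prop :=
  [/\ (forall O g, C O g -> [/\ mopen N O, O `<=` S & is_metric22 N O g]),
      (forall p, S p -> exists O g, C O g /\ O p),
      (forall O g O' g', C O g -> C O' g' -> conformal N O g O' g') &
      (forall O g, mopen N O -> O `<=` S -> is_metric22 N O g ->
         (forall O' g', C O' g' -> conformal N O' g' O g) -> C O g)].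

End Manifolds.

Section Maps.
Context {R : realType} {T T' : Type} {E E' : normedModType R}.

Definition smooth_map (N : premanifold T E) (O : set T)
    (N' : premanifold T' E') (f : T -> T') : Prop :=
  (forall p, O p -> pts N' (f p)) /\
  (forall P Q, atlas N P -> atlas N' Q ->
     let W := [set y | [/\ dom P y, O (par P y) & rng Q (f (par P y))]] in
     open W /\ smooth_on W (coord Q \o f \o par P)).

Definition mdiff (N : premanifold T E) (N' : premanifold T' E')
    (f : T -> T') (p : T) (v : E) : E' :=
  'D_v (coord (patch_at N' (f p)) \o f \o par (patch_at N p))
    (coord (patch_at N p) p).

Definition pull1 (N : premanifold T E) (N' : premanifold T' E')
    (f : T -> T') (a : T' -> E' -> R) (p : T) (v : E) : R :=
  a (f p) (mdiff N N' f p v).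

Definition pull2 (N : premanifold T E) (N' : premanifold T' E')
    (f : T -> T') (g : T' -> E' -> E' -> R)
    (p : T) (v w : E) : R :=
  g (f p) (mdiff N N' f p v) (mdiff N N' f p w).

End Maps.

Definition diffeo (R : realType) (T T' : Type) (E E' : normedModType R)
    (N : premanifold T E) (O : set T) (N' : premanifold T' E') (O' : set T')
    (f : T -> T') : Prop :=
  [/\ mopen N O, mopen N' O', f @` O = O', smooth_map N O N' f &
      exists g : T' -> T, smooth_map N' O' N g /\
        forall p, O p -> g (f p) = p].

Section PathGeometry.
Context {R : realType} {T : Type}.
Local Notation V := 'rV[R]_3.
Variables (M : premanifold T V) (L1 L2 : T -> set V).

Definition line_field (L : T -> set V) : Prop :=
  forall x, pts M x -> exists (W : set T) (X : T -> V),
    [/\ mopen M W, W x, smooth_field M W X &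
        forall z, W z -> X z != 0 /\ L z = [set c *: X z | c in setT]].

Definition D (x : T) : set V :=
  [set v | exists X1 X2, [/\ L1 x X1, L2 x X2 & v = X1 + X2]].

(* eta is a contact 1-form on the open set U with kernel D; the second
   condition is eta /\ d eta <> 0. *)
Definition contact_form (U : set T) (eta : T -> V -> R) : Prop :=
  [/\ mopen M U, is_form1 M U eta,
      (forall x, U x -> exists v1 v2 v3,
         eta x v1 * dform M eta x v2 v3 + eta x v2 * dform M eta x v3 v1
         + eta x v3 * dform M eta x v1 v2 != 0) &
      (forall x, U x -> forall v, eta x v = 0 <-> D x v)].

Definition path_geometry : Prop :=
  [/\ is_manifold M, line_field L1, line_field L2,
      (forall x, pts M x -> L1 x `&` L2 x = [set 0]) &
      (forall x, pts M x -> exists U eta, U x /\ contact_form U eta)].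

(* A point of SD is (x, r), r being a ray in D x. *)

Definition ray (X : V) : set V := [set Y | exists2 t : R, 0 < t & Y = t *: X].

Definition frame_on (W : set T) (Y1 Y2 : T -> V) : Prop :=
  [/\ smooth_field M W Y1, smooth_field M W Y2 &
      forall x, W x ->
        (forall a b : R, a *: Y1 x + b *: Y2 x = 0 -> a = 0 /\ b = 0) /\
        D x = [set v | exists a b : R, v = a *: Y1 x + b *: Y2 x]].

(* The charts of SD: over the restriction of a chart of M to an open subset
   carrying a frame (Y1, Y2) of D, the rays [t Y1 + Y2] have coordinate t. *)
Definition SD : premanifold (T * set V)%type (V * R^o)%type :=
  Premanifold
    [set p : T * set V |
       pts M p.1 /\ exists X, [/\ D p.1 X, X != 0 & p.2 = ray X]]
    [set Q : patch (T * set V)%type (V * R^o)%type |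
       exists (P : patch T V) (W : set V) (Y1 Y2 : T -> V),
       [/\ atlas M P, open W, W `<=` dom P, frame_on (par P @` W) Y1 Y2 &
           Q = Patch [set z : V * R^o | W z.1]
                 (fun z => (par P z.1,
                            ray (z.2 *: Y1 (par P z.1) + Y2 (par P z.1))))]].

Definition SDstar : set (T * set V) :=
  [set p | pts SD p /\ ~ (p.2 `<=` L1 p.1 `|` L2 p.1)].

(* The map induced on rays by X1 + X2 |-> a X1 + b X2. *)
Definition SDact (a b : R) (p : T * set V) : T * set V :=
  (p.1, [set Y | exists X1 X2, [/\ L1 p.1 X1, L2 p.1 X2, p.2 (X1 + X2) &
                                  Y = a *: X1 + b *: X2]]).

Definition SDscale (s : R) := SDact s s^-1.
Definition SDJ := SDact 1 (-1).

Definition SDstar_over (U : set T) : set (T * set V) :=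
  [set p | SDstar p /\ U p.1].

(* [e = 1] gives SD^+, [e = -1] gives SD^-: the sign of d eta(JX, X). *)
Definition SDsign (e : R) (U : set T) (eta : T -> V -> R) : set (T * set V) :=
  [set p | SDstar_over U p /\ exists X1 X2,
     [/\ L1 p.1 X1, L2 p.1 X2, p.2 (X1 + X2) &
         0 < e * dform M eta p.1 (X1 - X2) (X1 + X2)]].

Definition SDplus := SDsign 1.
Definition SDminus := SDsign (-1).

(* Tangent vectors are rows; a coframe u at x is the matrix of
   v |-> v *m u, so that u^i is given by column i. *)

Definition i1 : 'I_3 := inord 0.
Definition i2 : 'I_3 := inord 1.
Definition i3 : 'I_3 := inord 2.

Definition cmp (i : 'I_3) (e : T -> 'M[R]_3) (x : T) (v : V) : R :=
  (v *m e x) 0 i.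

Definition coframe_on (W : set T) (e : T -> 'M[R]_3) : Prop :=
  (forall x, W x -> e x \in unitmx) /\
  (forall i, is_form1 M W (cmp i e)).

(* Charts of a G-structure with point set Z, for the group rho(S): over the
   restriction of a chart of M to an open subset carrying a section e, the
   coframe e . rho(s) has fibre coordinate s. *)
Definition Gstructure (A : normedModType R) (S : set A) (rho : A -> 'M[R]_3)
    (Z : set (T * 'M[R]_3)) : premanifold (T * 'M[R]_3)%type (V * A)%type :=
  Premanifold Z
    [set Q : patch (T * 'M[R]_3)%type (V * A)%type |
       exists (P : patch T V) (W : set V) (e : T -> 'M[R]_3),
       [/\ atlas M P, open W /\ W `<=` dom P, coframe_on (par P @` W) e,
           (forall x, (par P @` W) x -> Z (x, e x)) &
           Q = Patch [set z : V * A | W z.1 /\ S z.2]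
                 (fun z => (par P z.1, e (par P z.1) *m rho z.2))]].

Definition coframe_bundle : premanifold (T * 'M[R]_3)%type (V * 'M[R]_3)%type :=
  Gstructure [set A : 'M[R]_3 | A \in unitmx] id
    [set p | pts M p.1 /\ p.2 \in unitmx].

(* Component i of the tautological form u o d pi_u on the coframe bundle. *)
Definition taut (i : 'I_3) (p : T * 'M[R]_3) (v : V * 'M[R]_3) : R :=
  (mdiff coframe_bundle M fst p v *m p.2) 0 i.

(* (u^1, u^2, u^3) |-> (u^1 / s, s u^2, u^3) *)
Definition rho (s : R^o) : 'M[R]_3 :=
  diag_mx (\row_(i < 3) [:: s^-1; s; 1]`_i).

Definition Bact (s : R) (p : T * 'M[R]_3) : T * 'M[R]_3 := (p.1, p.2 *m rho s).

Definition is_reduction (U : set T) (B : premanifold (T * 'M[R]_3)%type (V * R^o)%type)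
    : Prop :=
  [/\ is_manifold B /\ smooth_map B (pts B) coframe_bundle id,
      (forall p, pts B p -> U p.1 /\ pts coframe_bundle p),
      (forall s p, s != 0 -> pts B p -> pts B (Bact s p)),
      (forall p q, pts B p -> pts B q -> p.1 = q.1 ->
         exists! s : R, s != 0 /\ q = Bact s p) &
      (forall x, U x -> exists (W : set T) (e : T -> 'M[R]_3),
         [/\ mopen M W, W `<=` U, W x, coframe_on W e &
             forall z, W z -> pts B (z, e z)])].

Definition adapted_coframe (eta : T -> V -> R) (W : set T) (e : T -> 'M[R]_3)
    : Prop :=
  [/\ coframe_on W e,
      (forall x, W x -> forall v, cmp i3 e x v = eta x v),
      (forall x, W x -> forall v w,
         dform M (cmp i3 e) x v w = wedge (cmp i1 e) (cmp i2 e) x v w),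
      (forall x, W x -> forall v, L2 x v -> cmp i1 e x v = 0) &
      (forall x, W x -> forall v, L1 x v -> cmp i2 e x v = 0)].

Section Reduction.
Variables (U : set T) (eta : T -> V -> R).

Definition Bset : set (T * 'M[R]_3) :=
  [set p | let: (x, u) := p in
     let c i v := (v *m u) 0 i in
     [/\ U x /\ u \in unitmx,
         (forall v : V, c i3 v = eta x v),
         (forall v w : V,
            dform M eta x v w = c i1 v * c i2 w - c i1 w * c i2 v),
         (forall v : V, L2 x v -> c i1 v = 0) &
         (forall v : V, L1 x v -> c i2 v = 0)]].

Definition B : premanifold (T * 'M[R]_3)%type (V * R^o)%type :=
  Gstructure [set s : R^o | s != 0] rho Bset.

(* The restriction of the tautological forms to B. *)
Definition om (i : 'I_3) : T * 'M[R]_3 -> V * R^o -> R :=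
  pull1 B coframe_bundle id (taut i).

(* The vector field on B generating the action: d/ds (s . u) at s = 1. *)
Definition generator (p : T * 'M[R]_3) : V * R^o :=
  'D_1 ((fun s : R^o => coord (patch_at B p) (Bact s p)) : R^o -> V * R^o) 1.

(* The group being abelian, equivariance of a connection is invariance. *)
Definition is_connection (al : T * 'M[R]_3 -> V * R^o -> R) : Prop :=
  [/\ is_form1 B Bset al,
      (forall p, Bset p -> al p (generator p) = 1) &
      (forall s p v, s != 0 -> Bset p -> pull1 B B (Bact s) al p v = al p v)].

Definition adapted_connection (al : T * 'M[R]_3 -> V * R^o -> R) : Prop :=
  is_connection al /\
  exists a1 a2 : T * 'M[R]_3 -> R,
  [/\ smooth_fun B Bset a1, smooth_fun B Bset a2 &
    forall p v w, Bset p ->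
    [/\ dform B (om i1) p v w =
          - wedge al (om i1) p v w + a1 p * wedge (om i2) (om i3) p v w,
        dform B (om i2) p v w =
          wedge al (om i2) p v w + a2 p * wedge (om i3) (om i1) p v w &
        dform B (om i3) p v w = wedge (om i1) (om i2) p v w]].

Definition curvature_fun (al : T * 'M[R]_3 -> V * R^o -> R)
    (K : T * 'M[R]_3 -> R) : Prop :=
  exists b1 b2 : T * 'M[R]_3 -> R,
  [/\ smooth_fun B Bset b1, smooth_fun B Bset b2, smooth_fun B Bset K &
    forall p v w, Bset p ->
      dform B al p v w =
        b1 p * wedge (om i2) (om i3) p v w + b2 p * wedge (om i3) (om i1) p v w
        + K p * wedge (om i1) (om i2) p v w].

Definition sigma (al : T * 'M[R]_3 -> V * R^o -> R) (K : T * 'M[R]_3 -> R)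
    (p : T * 'M[R]_3) (v : V * R^o) : R :=
  - (2 / 3) * al p v + (1 / 6) * K p * om i3 p v.

Definition gB (al : T * 'M[R]_3 -> V * R^o -> R) (K : T * 'M[R]_3 -> R)
    (p : T * 'M[R]_3) (v w : V * R^o) : R :=
  symprod (om i1) (om i2) p v w + symprod (om i3) (sigma al K) p v w.

(* h (x, u) = (x, [X]) with (u^1(X), u^2(X), u^3(X)) = (1, 1, 0). *)
Definition h (p : T * 'M[R]_3) : T * set V :=
  (p.1, ray ((\row_(i < 3) [:: 1; 1; 0]`_i) *m invmx p.2)).

(* G is the metric obtained on SD^* over U by transporting g by h to SD^+
   and by J o h to SD^-. *)
Definition fefferman_metric (G : T * set V -> V * R^o -> V * R^o -> R) : Prop :=
  exists al K, [/\ adapted_connection al, curvature_fun al K &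
    forall p v w, Bset p ->
      pull2 B SD h G p v w = gB al K p v w /\
      pull2 B SD (SDJ \o h) G p v w = gB al K p v w].

End Reduction.
End PathGeometry.

(* Main.v *)
(* A coframe (c1, c2, c3) adapted to a contact form has d c3 = c1 /\ c2; writing c^k_ij for the
   coefficients of d c^k, the connection is ds/s + c^2_12 c1 + c^1_12 c2 - c^1_31 c3 over the coframe
   c . rho(s), the coefficient of c3 being consistent because d d c3 = 0. The structure equations
   determine the connection pointwise, so the local formulas agree. In the coordinates (y, s) of B
   and (y, t) of SD the maps h and J o h read t = s^2, hence the transported metric is given on SD by
   the formula of the metric on B with ds/s replaced by dt/(2t).
   The coframe adapted to f * c3 is (f c1 - f_2 c3, c2 + (f_1/f) c3, f c3), where d f = f_1 c1 + f_2 c2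
   + f_3 c3; its frame of D rescales t by |f|, and the terms in f_i, which d d f = 0 relates to each
   other, cancel in the metric up to the overall factor f. Any two contact forms are locally
   proportional, so the local metrics generate one maximal conformal family. *)
Require Import Defs.
From HB Require Import structures.
From mathcomp Require Import all_boot all_order all_algebra.
From mathcomp Require Import all_classical all_reals all_analysis.
From mathcomp Require Import ring lra.
Set Implicit Arguments.
Unset Strict Implicit.
Unset Printing Implicit Defensive.
Import Order.TTheory GRing.Theory Num.Theory.
Import numFieldNormedType.Exports.
Import Defs.
Local Open Scope classical_set_scope.
Local Open Scope ring_scope.

(** * Smooth maps between normed spaces *)

(** The constants in [sigma] are forced by the rescaling. Passing from eta to f * eta changes c1 .
    c2, up to the overall factor f, by (f_1/f) c1 . c3 - (f_2/f) c2 . c3 and a multiple of c3 . c3,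
    so sigma has to change by the opposite linear form. The form dt/(2t) + alf changes by 3/2 times
    (f_1/f) c1 - (f_2/f) c2 modulo c3, whence the factor -2/3; comparing the c3-components then
    forces the multiple 1/6 of K. A tangent vector at p is given by its components in a chart chosen
    separately for each p, so a coframe, as a matrix-valued function, need not vary smoothly. Every
    computation is therefore moved to one fixed chart by [dpatch] and [tcoord], where it becomes an
    identity between 1-forms on a normed space. Smoothness means iterated directional derivatives,
    and is handled as a property of germs, [sm]. The fibre of B has two components, and the charts
    of SD contain only the rays t Y1 + Y2. Signs k, d, p with square 1 record the component of s,
    the choice between h and J o h, and the sign of f. *)

Section Calculus.
Context {R : realType}.

(** A map vanishing near x is its own expansion with zero linear part, and [diff_unique] turns such
    an expansion into the differential. By subtraction this makes differentiability a local
    property. *)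
Lemma differentiable_near0 (V W : normedModType R) (f : V -> W) x :
  (\near x, f x = 0) -> differentiable f x.
Proof.
move=> f0.
have E : f \o shift x = cst (f x) + (\0 : V -> W) +o_ 0 id.
  apply/eqaddoP => _/posnumP[e]; rewrite (nbhs_singleton f0).
  have : \forall y \near (0 : V), f (y + x) = 0.
    by move: f0; rewrite (near_shift 0 x)/= => f0; apply: filterS f0 => y /=; rewrite subr0.
  apply: filterS => y fy.
  have -> : (f \o shift x - (cst 0 + \0)) y = f (y + x) - (0 + 0) by [].
  by rewrite fy addr0 subr0 normr0 mulr_ge0.
have c0 : continuous (\0 : V -> W) by exact: cst_continuous.
apply/diff_locallyP; rewrite (diff_unique c0 E); split => //.
Qed.

Lemma differentiable_near_eq (V W : normedModType R) (f g : V -> W) x :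
  (\near x, f x = g x) -> differentiable f x -> differentiable g x.
Proof.
move=> fg df; have -> : g = f + (g - f) by rewrite addrC subrK.
apply: differentiableD => //; apply: differentiable_near0.
by apply: filterS fg => y; rewrite !fctE => ->; rewrite subrr.
Qed.

Lemma CkSE (V W : normedModType R) k (U : set V) (f : V -> W) :
  Ck k.+1 U f <-> (forall x, U x -> differentiable f x) /\
                 (forall v, Ck k U (fun x => 'D_v f x)).
Proof. by []. Qed.

(** Derivatives are taken in the whole space, so [Ck k [set x] f] already involves f near x, and the
    conditions at different points are independent of each other. This is what allows local
    smoothness to be glued. *)
Lemma CkP (V W : normedModType R) k (U : set V) (f : V -> W) :
  Ck k U f <-> forall x, U x -> Ck k [set x] f.
Proof.
elim: k f => [|k IH] f /=; split.
- by move=> H x Ux y ->; exact: H.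
- by move=> H x Ux; exact: H Ux x erefl.
- move=> [H1 H2] x Ux; split; first by move=> y ->; exact: H1.
  by move=> v; have /IH := H2 v; apply.
- move=> H; split; first by move=> x Ux; have [+ _] := H x Ux; apply.
  by move=> v; apply/IH => x Ux; have [_ +] := H x Ux; apply.
Qed.

Lemma smooth_onP (V W : normedModType R) (U : set V) (f : V -> W) :
  smooth_on U f <-> forall x, U x -> smooth_on [set x] f.
Proof.
split=> [H x Ux k|H k]; first by have /CkP := H k; apply.
by apply/CkP => x Ux; exact: H.
Qed.

Lemma Ck_sub (V W : normedModType R) k (U U' : set V) (f : V -> W) :
  U' `<=` U -> Ck k U f -> Ck k U' f.
Proof. by move=> s /CkP H; apply/CkP => x /s; exact: H. Qed.

Lemma CkS (V W : normedModType R) k (U : set V) (f : V -> W) :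
  Ck k.+1 U f -> Ck k U f.
Proof.
elim: k f => [|k IH] f [H1 H2]; first by move=> x /H1; exact: differentiable_continuous.
by split => // v; exact: IH.
Qed.

Lemma Ck_ext (V W : normedModType R) k (U : set V) (f g : V -> W) :
  open U -> (forall x, U x -> f x = g x) -> Ck k U f -> Ck k U g.
Proof.
move=> oU; elim: k f g => [|k IH] f g fg.
  move=> H x Ux; have fgx : \near x, f x = g x.
    by near=> y; apply: fg; near: y; exact: open_nbhs_nbhs.
  rewrite /prop_for /continuous_at -(fg _ Ux).
  by apply: cvg_trans (H x Ux); apply: near_eq_cvg.
move=> [H1 H2]; have fgx x : U x -> \near x, f x = g x.
  by move=> Ux; near=> y; apply: fg; near: y; exact: open_nbhs_nbhs.
split; first by move=> x Ux; apply: differentiable_near_eq (fgx x Ux) (H1 x Ux).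
move=> v; apply: IH (H2 v) => x Ux; exact: near_eq_derive (fgx x Ux).
Unshelve. all: by end_near. Qed.

Lemma Ck_cst (V W : normedModType R) k (U : set V) (c : W) : Ck k U (cst c : V -> W).
Proof.
elim: k c => [|k IH] c /=; first by move=> x _; exact: cst_continuous.
split => [x _|v]; first exact: differentiable_cst.
have -> : (fun x => 'D_v (cst c : V -> W) x) = cst 0 by apply/funext => x; rewrite derive_cst.
exact: IH.
Qed.

Lemma Ck_linear (V W : normedModType R) k (U : set V) (L : {linear V -> W}) :
  continuous L -> Ck k U L.
Proof.
move=> cL; case: k => [|k] /=; first by move=> x _; exact: cL.
split => [x _|v]; first exact: linear_differentiable.
have -> : (fun x => 'D_v L x) = cst (L v).
  by apply/funext => x; rewrite deriveE; [rewrite diff_lin|exact: linear_differentiable].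
exact: Ck_cst.
Qed.

Lemma Ck_add (V W : normedModType R) k (U : set V) (f g : V -> W) :
  open U -> Ck k U f -> Ck k U g -> Ck k U (f \+ g).
Proof.
move=> oU; elim: k f g => [|k IH] f g.
  by move=> Hf Hg x Ux; apply: continuousD; [exact: Hf|exact: Hg].
move=> /CkSE[f1 f2] /CkSE[g1 g2]; split=> [x Ux|v].
  by apply: differentiableD; [exact: f1|exact: g1].
apply: (@Ck_ext _ _ _ _ ((fun x => 'D_v f x) \+ (fun x => 'D_v g x))) => //.
  by move=> x Ux; rewrite deriveD //; apply: diff_derivable; [exact: f1|exact: g1].
exact: IH (f2 v) (g2 v).
Qed.

Lemma Ck_comp_linear (V W Z : normedModType R) k (U : set V) (f : V -> W) (L : {linear W -> Z}) :
  open U -> continuous L -> Ck k U f -> Ck k U (L \o f).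
Proof.
move=> oU cL; elim: k f => [|k IH] f.
  by move=> H x Ux; apply: continuous_comp; [exact: H|exact: cL].
move=> /CkSE[f1 f2]; split=> [x Ux|v].
  by apply: differentiable_comp; [exact: f1|exact: linear_differentiable].
apply: (@Ck_ext _ _ _ _ (L \o (fun x => 'D_v f x))) => //; last exact: IH (f2 v).
move=> x Ux /=; have dL y : differentiable L y by exact: linear_differentiable.
rewrite [in RHS]deriveE; last by apply: differentiable_comp; [exact: f1|].
by rewrite diff_comp ?diff_lin//=; [rewrite deriveE//; exact: f1|exact: f1].
Qed.

Lemma Ck_mul (V : normedModType R) k (U : set V) (f g : V -> R^o) :
  open U -> Ck k U f -> Ck k U g -> Ck k U (f \* g : V -> R^o).
Proof.
move=> oU; elim: k f g => [|k IH] f g.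
  by move=> Hf Hg x Ux; apply: continuousM; [exact: Hf|exact: Hg].
move=> Hf Hg; have /CkSE[f1 f2] := Hf; have /CkSE[g1 g2] := Hg; split=> [x Ux|v].
  by apply: differentiableM; [exact: f1|exact: g1].
apply: (@Ck_ext _ _ _ _ ((f \* (fun x => 'D_v g x)) \+ (g \* (fun x => 'D_v f x)))) => //.
  by move=> x Ux /=; rewrite deriveM //; apply: diff_derivable; [exact: f1|exact: g1].
by apply: Ck_add => //; [have := IH _ _ (CkS Hf) (g2 v)|have := IH _ _ (CkS Hg) (f2 v)].
Qed.

Lemma Ck_inv (V : normedModType R) k (U : set V) (f : V -> R^o) :
  open U -> (forall x, U x -> f x != 0) -> Ck k U f -> Ck k U ((fun x => (f x)^-1) : V -> R^o).
Proof.
move=> oU f0; elim: k => [|k IH].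
  by move=> Hf x Ux; apply: continuousV; [exact: f0|exact: Hf].
move=> Hf; have /CkSE[f1 f2] := Hf; split=> [x Ux|v].
  by apply: differentiableV; [exact: f1|exact: f0].
apply: (@Ck_ext _ _ _ _ (((fun x => (f x)^-1 : R^o) \* (fun x => (f x)^-1 : R^o)) \*
    (cst (-1) \* (fun x => 'D_v f x)))) => //.
  move=> x Ux /=; rewrite deriveV ?f0//; last by apply: diff_derivable; exact: f1.
  by rewrite -exprVn expr2 mulN1r scaleNr mulrN.
have Hi := IH (CkS Hf).
apply: Ck_mul => //; first exact: Ck_mul.
by apply: Ck_mul => //; exact: Ck_cst.
Qed.

(** The derivative of the root contains [Num.sqrt (f x)] again, in a factor to which the induction
    hypothesis applies. The root serves to invert s |-> s^2, the coordinate form of [h]. *)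
Lemma Ck_sqrt (V : normedModType R) k (U : set V) (f : V -> R^o) :
  open U -> (forall x, U x -> 0 < f x) -> Ck k U f -> Ck k U ((fun x => Num.sqrt (f x)) : V -> R^o).
Proof.
move=> oU f0; elim: k => [|k IH].
  by move=> Hf x Ux; apply: continuous_comp; [exact: Hf|exact: sqrt_continuous].
move=> Hf; have /CkSE[f1 f2] := Hf.
have ds x : U x -> differentiable (Num.sqrt : R -> R) (f x).
  move=> Ux; apply/derivable1_diffP.
  by have [] := is_derive1_sqrt (f0 _ Ux).
split=> [x Ux|v].
  by apply: differentiable_comp; [exact: f1|exact: ds].
apply: (@Ck_ext _ _ _ _ ((fun x => (2 * Num.sqrt (f x))^-1 : R^o) \* (fun x => 'D_v f x))) => //.
  move=> x Ux /=; rewrite [in RHS]deriveE; last by apply: differentiable_comp; [exact: f1|exact: ds].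
  rewrite (diff_comp (f1 x Ux) (ds x Ux))/= deriveE; last exact: f1.
  have H := ds x Ux; rewrite -[LHS]mulrC.
  by rewrite (diff1E H) derive1E derive_sqrt ?f0.
apply: Ck_mul => //; apply: Ck_inv => //.
  by move=> x Ux; rewrite mulf_neq0// gt_eqF// sqrtr_gt0 f0.
apply: Ck_mul => //; first exact: Ck_cst.
exact: IH (CkS Hf).
Qed.

Lemma Ck_sum (V W : normedModType R) (I : finType) k (U : set V) (f : I -> V -> W) :
  open U -> (forall i, Ck k U (f i)) -> Ck k U (fun x => \sum_i f i x).
Proof.
move=> oU Hf.
suff : forall s : seq I, Ck k U (fun x => \sum_(i <- s) f i x) by [].
elim=> [|i s IH].
  have -> : (fun x => \sum_(i <- [::]) f i x) = cst 0 :> (V -> W).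
    by apply/funext => x; rewrite big_nil.
  exact: Ck_cst.
have -> : (fun x => \sum_(i <- i :: s) f i x) = f i \+ (fun x => \sum_(i <- s) f i x).
  by apply/funext => x; rewrite big_cons.
exact: Ck_add.
Qed.

(** [Ck] differentiates in fixed directions, whereas the chain rule produces the variable direction
    D_v f. A finite basis with continuous linear coordinates turns it into a finite sum over fixed
    directions. *)
Class findim (V : normedModType R) := Findim {
  fdI : finType;
  fdb : fdI -> V;
  fdc : fdI -> {linear V -> R^o};
  fdc_cont : forall i, continuous (fdc i);
  fdE : forall v, v = \sum_i fdc i v *: fdb i }.

Lemma fd_inj (V : normedModType R) {fV : findim V} (u v : V) :
  (forall i, fdc i u = fdc i v) -> u = v.
Proof. by move=> H; rewrite (fdE u) (fdE v); apply: eq_bigr => i _; rewrite H. Qed.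

Lemma derive_linear (V W : normedModType R) (f : V -> W) x (I : finType)
    (c : I -> R) (b : I -> V) : differentiable f x ->
  'D_(\sum_i c i *: b i) f x = \sum_i c i *: 'D_(b i) f x.
Proof.
move=> df; rewrite deriveE// linear_sum; apply: eq_bigr => i _.
by rewrite linearZ deriveE.
Qed.

(** By the chain rule the derivative is a sum of products of a coordinate of D_v f with a partial
    derivative of g composed with f. A scalar target keeps these products within [Ck_mul]; [sm_comp]
    recovers vector targets coordinate by coordinate. *)
Lemma Ck_comp1 (V W : normedModType R) {fW : findim W} k (U : set V) (O : set W)
    (f : V -> W) (g : W -> R^o) : open U -> open O -> (forall x, U x -> O (f x)) ->
  Ck k U f -> Ck k O g -> Ck k U (g \o f).
Proof.
move=> oU oO fUO; elim: k g => [|k IH] g.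
  by move=> Hf Hg x Ux; apply: continuous_comp; [exact: Hf|exact/Hg/fUO].
move=> Hf Hg; have /CkSE[f1 f2] := Hf; have /CkSE[g1 g2] := Hg; split=> [x Ux|v].
  by apply: differentiable_comp; [exact: f1|exact/g1/fUO].
apply: (@Ck_ext _ _ _ _ (fun x => \sum_i ((fdc i \o (fun x => 'D_v f x)) \*
    ((fun y => 'D_(fdb i) g y) \o f) : V -> R^o) x)) => //.
  move=> x Ux; have dgf := differentiable_comp (f1 x Ux) (g1 _ (fUO _ Ux)).
  rewrite [RHS]deriveE// diff_comp; [|exact: f1|exact/g1/fUO].
  rewrite /= -(deriveE v (f1 x Ux)) -(deriveE _ (g1 _ (fUO _ Ux))).
  rewrite [in RHS](fdE ('D_v f x)) derive_linear//; exact/g1/fUO.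
apply: Ck_sum => // i; apply: Ck_mul => //.
  by apply: (Ck_comp_linear oU (@fdc_cont _ _ i) (f2 v)).
exact: IH (CkS Hf) (g2 _).
Qed.

(** Smoothness of the germ at x: the open set is hidden, so intersections of domains need no
    bookkeeping, and the notion is stable under ['D_v]. *)
Definition sm (V W : normedModType R) (f : V -> W) x :=
  exists U, [/\ open U, U x & smooth_on U f].

Lemma sm_on (V W : normedModType R) (U : set V) (f : V -> W) x :
  open U -> smooth_on U f -> U x -> sm f x.
Proof. by move=> ? ? ?; exists U. Qed.

Lemma smooth_on_sm (V W : normedModType R) (U : set V) (f : V -> W) :
  (forall x, U x -> sm f x) -> smooth_on U f.
Proof.
by move=> H; apply/smooth_onP => x /H [U' [_ Ox /smooth_onP +]]; apply.
Qed.

Lemma near_open (V : topologicalType) (U : set V) x : open U -> U x -> \near x, U x.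
Proof. by move=> oU Ux; apply: open_nbhs_nbhs. Qed.

Lemma near_openP (V : topologicalType) (P : V -> Prop) x :
  (\near x, P x) -> exists U, [/\ open U, U x & forall y, U y -> P y].
Proof. by rewrite /prop_near1 nbhsE => -[U [oU Ux] HU]; exists U; split. Qed.

Lemma near_forall_fin (V : topologicalType) (I : finType) (P : I -> V -> Prop) (x : V) :
  (forall i, \forall y \near x, P i y) -> \forall y \near x, forall i, P i y.
Proof.
move=> H; have : \forall y \near x, forall i, i \in enum I -> P i y.
  elim: (enum I) => [|i s IH]; first by apply: nearW.
  apply: filterS2 (H i) IH => y Hi Hs j; rewrite inE => /orP[/eqP->//|]; exact: Hs.
by apply: filterS => y Hy i; apply: Hy; rewrite mem_enum.
Qed.

Lemma near_and3 (V : topologicalType) (P Q S : V -> Prop) (x : V) :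
  (\near x, P x) -> (\near x, Q x) -> (\near x, S x) ->
  \forall y \near x, [/\ P y, Q y & S y].
Proof. by move=> p q s; apply: filterS3 p q s => y; split. Qed.

Lemma sm_near (V W : normedModType R) (f : V -> W) x : sm f x -> \near x, sm f x.
Proof.
move=> [U [oU Ux Hf]]; have := near_open oU Ux.
by apply: filterS => y Uy; exists U.
Qed.

Lemma sm_diff (V W : normedModType R) (f : V -> W) x : sm f x -> differentiable f x.
Proof. by move=> [U [oU Ux Hf]]; have /CkSE[+ _] := Hf 1%N; apply. Qed.

Lemma sm_cont (V W : normedModType R) (f : V -> W) x : sm f x -> {for x, continuous f}.
Proof. by move=> /sm_diff; exact: differentiable_continuous. Qed.

Lemma sm_der (V W : normedModType R) (f : V -> W) x v : sm f x -> derivable f x v.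
Proof. by move=> /sm_diff; exact: diff_derivable. Qed.

Lemma sm_near_comp (V W : normedModType R) (f : V -> W) (P : W -> Prop) x :
  sm f x -> (\forall y \near f x, P y) -> \forall z \near x, P (f z).
Proof. by move=> sf HP; exact: (sm_cont sf HP). Qed.

Lemma sm_D (V W : normedModType R) (f : V -> W) x v : sm f x -> sm (fun y => 'D_v f y) x.
Proof.
move=> [U [oU Ux Hf]]; exists U; split=> // k.
by have /CkSE[_ +] := Hf k.+1; apply.
Qed.

Lemma sm_ext (V W : normedModType R) (f g : V -> W) x :
  (\near x, f x = g x) -> sm f x -> sm g x.
Proof.
move=> fg [U [oU Ux Hf]].
have [U' [oU' Ux' HU']] := near_openP fg.
exists (U `&` U'); split=> //; first exact: openI.
move=> k; apply: (Ck_ext (f := f)); first exact: openI.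
  by move=> y [_ /HU'].
by apply: Ck_sub (Hf k) => y [].
Qed.

Lemma sm_cst (V W : normedModType R) (c : W) (x : V) : sm (fun=> c) x.
Proof. by exists setT; split; [exact: openT|by []|move=> k; exact: Ck_cst]. Qed.

Lemma sm_linear (V W : normedModType R) (L : {linear V -> W}) x : continuous L -> sm L x.
Proof. by move=> cL; exists setT; split; [exact: openT|by []|move=> k; exact: Ck_linear]. Qed.

Lemma sm_id (V : normedModType R) (x : V) : sm id x.
Proof. by apply: (@sm_linear _ _ idfun) => y; exact: cvg_id. Qed.

Lemma sm_comp_linear (V W Z : normedModType R) (f : V -> W) (L : {linear W -> Z}) x :
  continuous L -> sm f x -> sm (L \o f) x.
Proof. by move=> cL [U [oU Ux Hf]]; exists U; split=> // k; exact: Ck_comp_linear. Qed.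

Lemma sm2 (V W W' : normedModType R) (f : V -> W) (g : V -> W') x :
  sm f x -> sm g x -> exists U, [/\ open U, U x, smooth_on U f & smooth_on U g].
Proof.
move=> [U [oU Ux Hf]] [U' [oU' Ox Hg]]; exists (U `&` U'); split => //.
- exact: openI.
- by move=> k; apply: Ck_sub (Hf k) => y [].
- by move=> k; apply: Ck_sub (Hg k) => y [].
Qed.

Lemma sm_add (V W : normedModType R) (f g : V -> W) x :
  sm f x -> sm g x -> sm (fun y => f y + g y) x.
Proof.
move=> sf sg; have [U [oU Ux Hf Hg]] := sm2 sf sg.
by exists U; split=> // k; exact: Ck_add.
Qed.

Lemma sm_mul (V : normedModType R) (f g : V -> R^o) x :
  sm f x -> sm g x -> sm (fun y => f y * g y : R^o) x.
Proof.
move=> sf sg; have [U [oU Ux Hf Hg]] := sm2 sf sg.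
by exists U; split=> // k; exact: Ck_mul.
Qed.

Lemma sm_scalel (V W : normedModType R) (f : V -> W) (c : R) x :
  sm f x -> sm (fun y => c *: f y) x.
Proof. apply: sm_comp_linear; exact: scaler_continuous. Qed.

Lemma sm_opp (V W : normedModType R) (f : V -> W) x : sm f x -> sm (fun y => - f y) x.
Proof.
move=> /(sm_scalel (-1)); apply: sm_ext; apply: nearW => y; by rewrite scaleN1r.
Qed.

Lemma sm_sub (V W : normedModType R) (f g : V -> W) x :
  sm f x -> sm g x -> sm (fun y => f y - g y) x.
Proof. by move=> sf sg; apply: sm_add => //; exact: sm_opp. Qed.

Lemma sm_restrict (V W : normedModType R) (f : V -> W) x (P : V -> Prop) :
  sm f x -> (\near x, P x) -> exists U, [/\ open U, U x, smooth_on U f & forall y, U y -> P y].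
Proof.
move=> [U [oU Ux Hf]] /near_openP [U' [oU' Ux' HU']].
exists (U `&` U'); split=> //; first exact: openI.
  by move=> k; apply: Ck_sub (Hf k) => y [].
by move=> y [_ /HU'].
Qed.

Lemma near_neq0 (V : normedModType R) (f : V -> R^o) x :
  f x != 0 -> {for x, continuous f} -> \near x, f x != 0.
Proof.
move=> f0 cf.
exact: (cf _ (near_open (V := R^o) (@open_neq R 0) f0)).
Qed.

Lemma near_gt0 (V : normedModType R) (f : V -> R^o) x :
  0 < f x -> {for x, continuous f} -> \near x, 0 < f x.
Proof.
move=> f0 cf.
exact: (cf _ (near_open (V := R^o) (@open_gt R 0) f0)).
Qed.

Lemma sm_inv (V : normedModType R) (f : V -> R^o) x :
  f x != 0 -> sm f x -> sm (fun y => (f y)^-1 : R^o) x.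
Proof.
move=> f0 sf; have [U [oU Ux Hf HU]] := sm_restrict sf (near_neq0 f0 (sm_cont sf)).
by exists U; split=> // k; exact: Ck_inv.
Qed.

Lemma sm_sqrt (V : normedModType R) (f : V -> R^o) x :
  0 < f x -> sm f x -> sm (fun y => Num.sqrt (f y) : R^o) x.
Proof.
move=> f0 sf; have [U [oU Ux Hf HU]] := sm_restrict sf (near_gt0 f0 (sm_cont sf)).
by exists U; split=> // k; exact: Ck_sqrt.
Qed.

Lemma sm_sum (V W : normedModType R) (I : Type) (r : seq I) (P : pred I) (f : I -> V -> W) x :
  (forall i, sm (f i) x) -> sm (fun y => \sum_(i <- r | P i) f i y) x.
Proof.
move=> Hf; elim: r => [|i s IH].
  apply: (sm_ext _ (sm_cst 0 x)); apply: nearW => y; by rewrite big_nil.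
case Pi: (P i).
  apply: (sm_ext _ (sm_add (Hf i) IH)); apply: nearW => y; by rewrite big_cons Pi.
apply: (sm_ext _ IH); apply: nearW => y; by rewrite big_cons Pi.
Qed.

Lemma sm_prod (V : normedModType R) (I : Type) (r : seq I) (P : pred I) (f : I -> V -> R^o) x :
  (forall i, sm (f i) x) -> sm (fun y => \prod_(i <- r | P i) f i y : R^o) x.
Proof.
move=> Hf; elim: r => [|i s IH].
  apply: (sm_ext _ (sm_cst (1 : R^o) x)); apply: nearW => y; by rewrite big_nil.
case Pi: (P i).
  apply: (sm_ext _ (sm_mul (Hf i) IH)); apply: nearW => y; by rewrite big_cons Pi.
apply: (sm_ext _ IH); apply: nearW => y; by rewrite big_cons Pi.
Qed.

Definition scalev (W : normedModType R) (w : W) (c : R^o) : W := (c : R) *: w.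
Lemma scalev_linear (W : normedModType R) (w : W) : linear (scalev w).
Proof. by move=> a u v; rewrite /scalev scalerDl scalerA. Qed.
HB.instance Definition _ (W : normedModType R) (w : W) :=
  GRing.isLinear.Build R R^o W *:%R (scalev w) (scalev_linear w).

Lemma sm_scaler (V W : normedModType R) (f : V -> R^o) (w : W) x :
  sm f x -> sm (fun y => (f y : R) *: w) x.
Proof. apply: (sm_comp_linear (L := scalev w)); exact: scalel_continuous. Qed.

Lemma sm_fdc (V W : normedModType R) {fW : findim W} (f : V -> W) x :
  (forall i, sm (fdc i \o f) x) -> sm f x.
Proof.
move=> H; apply: (sm_ext (f := fun y => \sum_i (fdc i (f y) : R) *: fdb i)).
  by apply: nearW => y; rewrite -fdE.
by apply: sm_sum => i; apply: sm_scaler; exact: H.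
Qed.

Lemma sm_comp1 (V W : normedModType R) {fW : findim W}
    (f : V -> W) (g : W -> R^o) x : sm f x -> sm g (f x) -> sm (g \o f) x.
Proof.
move=> sf [U' [oU' Ux' Hg]].
have [U [oU Ux Hf HU]] := sm_restrict sf (sm_cont sf (near_open oU' Ux')).
by exists U; split=> // k; exact: (Ck_comp1 oU oU' HU).
Qed.

Lemma sm_comp (V W Z : normedModType R) {fW : findim W} {fZ : findim Z}
    (f : V -> W) (g : W -> Z) x : sm f x -> sm g (f x) -> sm (g \o f) x.
Proof.
move=> sf sg; apply: sm_fdc => i; apply: (sm_comp1 (g := fdc i \o g) sf).
apply: sm_comp_linear sg; exact: fdc_cont.
Qed.


(** * Smooth maps into products and matrices *)

Definition findim_R : findim R^o.
Proof.
refine (@Findim R^o unit (fun=> (1 : R^o)) (fun=> idfun) _ _).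
  by move=> _ y; exact: cvg_id.
by move=> v; rewrite (big_pred1 tt) /=; [rewrite [RHS]mulr1|case].
Defined.

Definition mxentry m n (i : 'I_m) (j : 'I_n) (A : 'M[R]_(m, n)) : R^o := A i j.
Lemma mxentry_linear m n (i : 'I_m) (j : 'I_n) : linear (mxentry i j).
Proof. by move=> a u v; rewrite /mxentry !mxE. Qed.
HB.instance Definition _ m n (i : 'I_m) (j : 'I_n) :=
  GRing.isLinear.Build R 'M[R]_(m, n) R^o *:%R (mxentry i j) (mxentry_linear i j).

Definition findim_mx m n : findim 'M[R]_(m.+1, n.+1).
Proof.
refine (@Findim _ ('I_m.+1 * 'I_n.+1)%type (fun ij => delta_mx ij.1 ij.2)
   (fun ij => mxentry ij.1 ij.2) _ _).
  by move=> [i j] y; exact: coord_continuous.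
by move=> v; rewrite {1}(matrix_sum_delta v) pair_big.
Defined.

Section Prod.
Variables V W : normedModType R.
Definition pfst (z : V * W) : V := z.1.
Definition psnd (z : V * W) : W := z.2.
Definition pinl (z : V) : V * W := (z, 0).
Definition pinr (z : W) : V * W := (0, z).
Lemma pfst_linear : linear pfst. Proof. by []. Qed.
Lemma psnd_linear : linear psnd. Proof. by []. Qed.
Lemma pinl_linear : linear pinl.
Proof. by move=> a u v; congr pair; rewrite /= ?scaler0 ?addr0. Qed.
Lemma pinr_linear : linear pinr.
Proof. by move=> a u v; congr pair; rewrite /= ?scaler0 ?addr0. Qed.
HB.instance Definition _ := GRing.isLinear.Build R _ _ _ pfst pfst_linear.
HB.instance Definition _ := GRing.isLinear.Build R _ _ _ psnd psnd_linear.
HB.instance Definition _ := GRing.isLinear.Build R _ _ _ pinl pinl_linear.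
HB.instance Definition _ := GRing.isLinear.Build R _ _ _ pinr pinr_linear.
Lemma pfst_continuous : continuous pfst. Proof. by move=> z; exact: cvg_fst. Qed.
Lemma psnd_continuous : continuous psnd. Proof. by move=> z; exact: cvg_snd. Qed.
Lemma pinl_continuous : continuous pinl.
Proof. by move=> z; apply: cvg_pair; [exact: cvg_id|exact: cvg_cst]. Qed.
Lemma pinr_continuous : continuous pinr.
Proof. by move=> z; apply: cvg_pair; [exact: cvg_cst|exact: cvg_id]. Qed.
End Prod.

Definition findim_prod (V W : normedModType R) (fV : findim V) (fW : findim W) :
  findim (V * W)%type.
Proof.
refine (@Findim _ (@fdI _ fV + @fdI _ fW)%type
  (fun i => match i with inl i => pinl W (fdb i) | inr i => pinr V (fdb i) end)
  (fun i => match i with inl i => fdc i \o @pfst V W : {linear _ -> _}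
              | inr i => fdc i \o @psnd V W : {linear _ -> _} end) _ _).
  move=> [i|i] y; apply: continuous_comp.
  - exact: pfst_continuous.
  - exact: fdc_cont.
  - exact: psnd_continuous.
  - exact: fdc_cont.
move=> [v w]; rewrite big_sumType /=.
have -> : \sum_i fdc i v *: pinl W (fdb i) = pinl W v.
  by rewrite [in RHS](fdE v) linear_sum; apply: eq_bigr => i _; rewrite linearZ.
have -> : \sum_i fdc i w *: pinr V (fdb i) = pinr V w.
  by rewrite [in RHS](fdE w) linear_sum; apply: eq_bigr => i _; rewrite linearZ.
by congr pair; rewrite /= ?addr0 ?add0r.
Defined.

#[local] Existing Instances findim_R findim_mx findim_prod.

Lemma sm_fst (V W : normedModType R) (z : V * W) : sm (fun z => z.1) z.
Proof. apply: (sm_linear (L := @pfst V W)); exact: pfst_continuous. Qed.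
Lemma sm_snd (V W : normedModType R) (z : V * W) : sm (fun z => z.2) z.
Proof. apply: (sm_linear (L := @psnd V W)); exact: psnd_continuous. Qed.

Lemma sm_pair (V W Z : normedModType R) (f : V -> W) (g : V -> Z) x :
  sm f x -> sm g x -> sm (fun y => (f y, g y)) x.
Proof.
move=> sf sg; apply: (@sm_ext V (W * Z)%type (fun y => (@pinl W Z \o f) y + (@pinr W Z \o g) y)).
  by apply: nearW => y; congr pair; rewrite /= ?addr0 ?add0r.
apply: sm_add; apply: sm_comp_linear => //; [exact: pinl_continuous|exact: pinr_continuous].
Qed.

Lemma sm_entry (V : normedModType R) m n (f : V -> 'M[R]_(m.+1, n.+1)) i j x :
  sm f x -> sm (fun y => f y i j : R^o) x.
Proof. move=> sf; apply: (sm_comp_linear (L := mxentry i j)) sf; exact: coord_continuous. Qed.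

Lemma sm_mx (V : normedModType R) m n (f : V -> 'M[R]_(m.+1, n.+1)) x :
  (forall i j, sm (fun y => f y i j : R^o) x) -> sm f x.
Proof. by move=> H; apply: (@sm_fdc _ _ (findim_mx m n)) => ij; exact: H. Qed.

Lemma sm_mulmx (V : normedModType R) m n p (f : V -> 'M[R]_(m.+1, n.+1))
    (g : V -> 'M[R]_(n.+1, p.+1)) x :
  sm f x -> sm g x -> sm (fun y => f y *m g y) x.
Proof.
move=> sf sg; apply: sm_mx => i j.
apply: (sm_ext (f := fun y => \sum_k f y i k * g y k j : R^o)).
  by apply: nearW => y; rewrite mxE.
by apply: sm_sum => k; apply: sm_mul; exact: sm_entry.
Qed.

Lemma sm_det (V : normedModType R) n (f : V -> 'M[R]_n) x :
  (forall i j, sm (fun y => f y i j : R^o) x) -> sm (fun y => \det (f y) : R^o) x.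
Proof.
move=> sf; apply: sm_sum => s; apply: sm_mul; first exact: sm_cst.
by apply: sm_prod => i; exact: sf.
Qed.

(** Cramer's formula, valid on the neighbourhood where the determinant does not vanish; the entries
    of the adjugate are signed minors, hence polynomial in the entries of f. *)
Lemma sm_invmx (V : normedModType R) n (f : V -> 'M[R]_n.+1) x :
  f x \in unitmx -> sm f x -> sm (fun y => invmx (f y)) x.
Proof.
move=> ux sf.
have sd : sm (fun y => \det (f y) : R^o) x by apply: sm_det => i j; exact: sm_entry.
have d0 : \det (f x) != 0 by rewrite -unitfE -unitmxE.
apply: (sm_ext (f := fun y => (\det (f y))^-1 *: \adj (f y))).
  have := near_neq0 (f := fun y => \det (f y) : R^o) d0 (sm_cont sd).
  apply: filterS => y dy.
  by rewrite /invmx unitmxE unitfE dy.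
apply: sm_mx => i j.
apply: (sm_ext (f := fun y => (\det (f y))^-1 * ((-1) ^+ (j + i) *
   \det (row' j (col' i (f y)))) : R^o)).
  by apply: nearW => y; rewrite !mxE.
apply: sm_mul; first exact: sm_inv.
apply: sm_mul; first exact: sm_cst.
apply: sm_det => a b.
apply: (sm_ext (f := fun y => f y (lift j a) (lift i b) : R^o)); last exact: sm_entry.
by apply: nearW => y; rewrite !mxE.
Qed.

(** * Rules for directional derivatives *)

Section Drules.
Variables (V : normedModType R) (x v : V).
Lemma D_lin (W : normedModType R) (f : V -> W) (a : R) u w : sm f x ->
  'D_(a *: u + w) f x = a *: 'D_u f x + 'D_w f x.
Proof. by move=> /sm_diff df; rewrite !deriveE// linearP. Qed.

Lemma D_cst (W : normedModType R) (c : W) : 'D_v (fun=> c) x = 0.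
Proof. exact: derive_cst. Qed.

Lemma D_add (W : normedModType R) (f g : V -> W) : sm f x -> sm g x ->
  'D_v (fun y => f y + g y) x = 'D_v f x + 'D_v g x.
Proof. by move=> sf sg; rewrite -deriveD//; exact: sm_der. Qed.

Lemma D_opp (W : normedModType R) (f : V -> W) : sm f x ->
  'D_v (fun y => - f y) x = - 'D_v f x.
Proof. by move=> sf; rewrite -deriveN//; exact: sm_der. Qed.

Lemma D_sub (W : normedModType R) (f g : V -> W) : sm f x -> sm g x ->
  'D_v (fun y => f y - g y) x = 'D_v f x - 'D_v g x.
Proof. by move=> sf sg; rewrite -deriveB//; exact: sm_der. Qed.

Lemma D_mul (f g : V -> R^o) : sm f x -> sm g x ->
  'D_v (fun y => f y * g y : R^o) x = f x * 'D_v g x + g x * 'D_v f x.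
Proof. by move=> sf sg; rewrite (deriveM (f := f) (g := g))//; exact: sm_der. Qed.

Lemma D_inv (f : V -> R^o) : sm f x -> f x != 0 ->
  'D_v (fun y => (f y)^-1 : R^o) x = - 'D_v f x / f x ^+ 2.
Proof.
by move=> sf f0; rewrite (deriveV (f := f))//; [rewrite scaleNr mulNr mulrC|exact: sm_der].
Qed.

Lemma D_complin (W Z : normedModType R) (f : V -> W) (L : {linear W -> Z}) :
  continuous L -> sm f x -> 'D_v (L \o f) x = L ('D_v f x).
Proof.
move=> cL sf; have dL y : differentiable L y by exact: linear_differentiable.
have df := sm_diff sf.
rewrite deriveE; last exact: differentiable_comp.
by rewrite diff_comp// diff_lin//= deriveE.
Qed.

Lemma D_comp (W Z : normedModType R) (f : V -> W) (g : W -> Z) :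
  sm f x -> sm g (f x) -> 'D_v (g \o f) x = 'D_('D_v f x) g (f x).
Proof.
move=> /sm_diff sf /sm_diff sg.
rewrite (deriveE v sf) (deriveE _ sg) deriveE; last exact: differentiable_comp.
by rewrite diff_comp.
Qed.

Lemma D_sum (W : normedModType R) (I : Type) (r : seq I) (f : I -> V -> W) :
  (forall i, sm (f i) x) ->
  'D_v (fun y => \sum_(i <- r) f i y) x = \sum_(i <- r) 'D_v (f i) x.
Proof.
move=> Hf; elim: r => [|i r IH].
  rewrite big_nil -[RHS](D_cst 0); apply: near_eq_derive.
  by apply: nearW => y; rewrite big_nil.
rewrite big_cons -IH -D_add//; last exact: sm_sum.
by apply: near_eq_derive; apply: nearW => y; rewrite big_cons.
Qed.

Lemma D_scaler (W : normedModType R) (f : V -> R^o) (w : W) : sm f x ->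
  'D_v (fun y => (f y : R) *: w) x = ('D_v f x : R) *: w.
Proof. by move=> sf; apply: (D_complin (L := scalev w)) => //; exact: scalel_continuous. Qed.

Lemma D_scalel (W : normedModType R) (f : V -> W) (c : R) : sm f x ->
  'D_v (fun y => c *: f y) x = c *: 'D_v f x.
Proof. by move=> sf; rewrite -deriveZ//; exact: sm_der. Qed.

Lemma D_id : 'D_v id x = v.
Proof. exact: derive_id. Qed.

End Drules.

Lemma D_linear (V W : normedModType R) (L : {linear V -> W}) x v :
  continuous L -> 'D_v L x = L v.
Proof. by move=> cL; rewrite deriveE ?diff_lin//; exact: linear_differentiable. Qed.

Lemma D_fst (V W : normedModType R) (z v : V * W) : 'D_v (fun z => z.1) z = v.1.
Proof. apply: (D_linear (L := @pfst V W)); exact: pfst_continuous. Qed.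
Lemma D_snd (V W : normedModType R) (z v : V * W) : 'D_v (fun z => z.2) z = v.2.
Proof. apply: (D_linear (L := @psnd V W)); exact: psnd_continuous. Qed.

Lemma D_pair (V W Z : normedModType R) (f : V -> W) (g : V -> Z) x v :
  sm f x -> sm g x -> 'D_v (fun y => (f y, g y)) x = ('D_v f x, 'D_v g x).
Proof.
move=> sf sg; have sp := sm_pair sf sg; apply: injective_projections.
  by rewrite -[LHS](D_complin v (L := @pfst W Z) _ sp)//; exact: pfst_continuous.
by rewrite -[LHS](D_complin v (L := @psnd W Z) _ sp)//; exact: psnd_continuous.
Qed.

Lemma D_ext (V W : normedModType R) (f g : V -> W) x v :
  (\near x, f x = g x) -> 'D_v f x = 'D_v g x.
Proof. exact: near_eq_derive. Qed.


(** * Symmetry of second derivatives *)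

Lemma MVT0 (g dg : R -> R) (h : R) : 0 < h ->
  (forall s, 0 <= s <= h -> is_derive s 1 g (dg s)) ->
  exists2 c, 0 <= c <= h & g h - g 0 = dg c * h.
Proof.
move=> h0 Dg.
have H1 s : s \in `]0, h[ -> is_derive s 1 g (dg s).
  by move=> Hs; apply: Dg; rewrite !(itvP Hs).
have H2 : {within `[0, h], continuous g}.
  apply: derivable_within_continuous => s Hs.
  by apply: (@ex_derive _ _ _ _ _ _ _ (Dg s _)); rewrite !(itvP Hs).
have [c Hc E] := MVT h0 H1 H2.
by exists c; [rewrite !(itvP Hc)|rewrite E subr0].
Qed.

Lemma close_norm (a b c e : R) : `|a - c| < e / 2 -> `|b - c| < e / 2 -> `|a - b| <= e.
Proof.
move=> H1 H2; rewrite (splitr e) -(subrK c a) -addrA (le_trans (ler_normD _ _))//.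
by rewrite lerD// ?(distrC c)// ltW.
Qed.

Section Schwarz.
Variable V : normedModType R.

Lemma line_derive (f : V -> R^o) (x v : V) (s : R) : differentiable f (x + s *: v) ->
  is_derive s 1 (fun s : R => f (x + s *: v) : R) ('D_v f (x + s *: v)).
Proof.
move=> df; pose a (s : R^o) : V := x + (s : R) *: v.
have sa : sm a s by apply: sm_add; [exact: sm_cst|apply: sm_scaler; exact: sm_id].
have Da : 'D_1 a s = v.
  rewrite D_add; [|exact: sm_cst|by apply: sm_scaler; exact: sm_id].
  by rewrite D_cst D_scaler ?D_id ?scale1r ?add0r//; exact: sm_id.
have da := sm_diff sa.
have dc : differentiable (f \o a) s by exact: differentiable_comp.
have dd : derivable (f \o a) s 1 by exact: diff_derivable.
apply: DeriveDef; first exact: dd.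
have -> : 'D_v f (x + s *: v) = 'D_('D_1 a s) f (a s) by rewrite Da.
rewrite -[LHS]/('D_1 (f \o a) s) (deriveE _ dc) (deriveE _ da) deriveE//.
by rewrite diff_comp.
Qed.

(** The mean value theorem is applied twice to the second difference of f over the parallelogram
    with sides h v and h w: first in the direction v, then in the direction w. *)
Lemma schwarz_mean (f : V -> R^o) (x v w : V) (h : R) :
  0 < h -> (forall s t : R, 0 <= s <= h -> 0 <= t <= h -> sm f (x + s *: v + t *: w)) ->
  exists s t : R, [/\ 0 <= s <= h, 0 <= t <= h &
    f (x + h *: v + h *: w) - f (x + h *: v) - (f (x + h *: w) - f x) =
    h * h * 'D_w (fun y => 'D_v f y) (x + s *: v + t *: w)].
Proof.
move=> h0 Hf.
pose g s : R := f (x + s *: v + h *: w) - f (x + s *: v).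
pose dg s : R := 'D_v f (x + s *: v + h *: w) - 'D_v f (x + s *: v).
have Dg s : 0 <= s <= h -> is_derive s 1 g (dg s).
  move=> Hs; rewrite /g /dg; apply: is_deriveB.
    have -> : (fun s => f (x + s *: v + h *: w) : R) = fun s => f (x + h *: w + s *: v).
      by apply/funext => y; rewrite addrAC.
    rewrite addrAC; apply: line_derive; rewrite addrAC; apply: sm_diff.
    by apply: Hf => //; rewrite lexx ltW.
  apply: line_derive; apply: sm_diff; have := Hf s 0 Hs; rewrite scale0r addr0; apply.
  by rewrite lexx ltW.
have [s Hs Es] := MVT0 h0 Dg.
pose k t : R := 'D_v f (x + s *: v + t *: w).
have Dk t : 0 <= t <= h -> is_derive t 1 k ('D_w (fun y => 'D_v f y) (x + s *: v + t *: w)).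
  by move=> Ht; apply: line_derive; apply/sm_diff/sm_D; exact: Hf.
have [t Ht Et] := MVT0 h0 Dk.
exists s, t; split => //.
have -> : f (x + h *: v + h *: w) - f (x + h *: v) - (f (x + h *: w) - f x) = g h - g 0.
  by rewrite /g scale0r addr0.
rewrite Es -mulrA mulrC; congr (_ * _).
have -> : dg s = k h - k 0 by rewrite /k scale0r addr0.
by rewrite Et mulrC.
Qed.

Lemma schwarz (f : V -> R^o) (x v w : V) : sm f x ->
  'D_v (fun y => 'D_w f y) x = 'D_w (fun y => 'D_v f y) x.
Proof.
move=> sf; apply/eqP; rewrite -subr_eq0 -normr_le0; apply/ler_addgt0Pl => e e0.
set C := fun x => 'D_v (fun y => 'D_w f y) x; set C' := fun x => 'D_w (fun y => 'D_v f y) x.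
have c1 : {for x, continuous C} by apply/sm_cont/sm_D/sm_D.
have c2 : {for x, continuous C'} by apply/sm_cont/sm_D/sm_D.
have e20 : 0 < e / 2 by rewrite divr_gt0.
have /nbhs_ballP [r /= r0 HU] : \forall y \near x, [/\ sm f y,
    `|C x - C y| < e / 2 & `|C' x - C' y| < e / 2].
  have n1 := sm_near sf.
  have n2 : \forall y \near x, `|C x - C y| < e / 2 by move: c1 => /cvgr_dist_lt; apply.
  have n3 : \forall y \near x, `|C' x - C' y| < e / 2 by move: c2 => /cvgr_dist_lt; apply.
  exact: (near_and3 n1 n2 n3).
(* The step h keeps x + s v + t w in the ball for all s, t in [0, h]; the summand 1 keeps d positive
   when v and w vanish. *)
pose d := `|v| + `|w| + 1; have d0 : 0 < d by rewrite ltr_wpDl// addr_ge0.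
pose h := r / (2 * d); have h0 : 0 < h by rewrite divr_gt0// mulr_gt0.
have hd : h * d < r.
  by rewrite /h invfM mulrA mulfVK ?gt_eqF// gtr_pMr// invf_lt1// ltr1n.
have Hst s t : 0 <= s <= h -> 0 <= t <= h -> ball x r (x + s *: v + t *: w).
  move=> /andP[s0 sh] /andP[t0 th]; rewrite -ball_normE /= -(addrA x) opprD addrA subrr add0r.
  rewrite normrN (le_lt_trans _ hd)// (le_trans (ler_normD _ _))//.
  rewrite !normrZ !ger0_norm// /d !mulrDr mulr1 -[leLHS]addr0.
  by apply: lerD; [apply: lerD; rewrite ler_wpM2r|exact: ltW].
have [s [t [Hs Ht E]]] := schwarz_mean h0 (fun s t Hs Ht => let: And3 H _ _ := HU _ (Hst s t Hs Ht) in H).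
have Hst' s1 t1 : 0 <= s1 <= h -> 0 <= t1 <= h -> ball x r (x + s1 *: w + t1 *: v).
  by move=> ? ?; rewrite addrAC; exact: Hst.
have [s' [t' [Hs' Ht' E']]] := schwarz_mean h0 (fun s t Hs Ht => let: And3 H _ _ := HU _ (Hst' s t Hs Ht) in H).
(* Both mean values come from the same second difference, which is symmetric in v and w. *)
have EE : C' (x + s *: v + t *: w) = C (x + s' *: w + t' *: v).
  have hh : h * h != 0 by rewrite mulf_neq0// gt_eqF.
  apply: (mulfI hh); etransitivity; first exact: (esym E).
  etransitivity; last exact: E'.
  rewrite [x + h *: w + h *: v]addrAC; ring.
have [_ _ H1] := HU _ (Hst s t Hs Ht).
have [_ H2 _] := HU _ (Hst' s' t' Hs' Ht').
rewrite EE in H1; rewrite addr0; exact: (close_norm H2 H1).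
Unshelve. all: by end_near. Qed.

End Schwarz.

Lemma scaleRo (a : R) (c : R^o) : a *: c = a * c. Proof. by []. Qed.

Section Scalar.
Variables (V : lmodType R) (f : V -> R).
Hypothesis sf : scalar f.
Lemma scal0 : f 0 = 0.
Proof. by have := sf (-1) 0 0; rewrite scaler0 addr0 mulN1r addNr. Qed.
Lemma scalZ a u : f (a *: u) = a * f u.
Proof. by have := sf a u 0; rewrite addr0 scal0 addr0. Qed.
Lemma scalD u v : f (u + v) = f u + f v.
Proof. by have := sf 1 u v; rewrite scale1r mul1r. Qed.
Lemma scalB u v : f (u - v) = f u - f v.
Proof. by rewrite scalD -scaleN1r scalZ mulN1r. Qed.
Lemma scal_sum (I : Type) (r : seq I) (g : I -> V) :
  f (\sum_(i <- r) g i) = \sum_(i <- r) f (g i).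
Proof.
by elim: r => [|i r IH]; rewrite ?big_nil ?scal0// !big_cons scalD IH.
Qed.
End Scalar.

Section Linear.
Variables (U U' : lmodType R) (f : U -> U').
Hypothesis lf : linear f.
Lemma lin0 : f 0 = 0.
Proof. by have := lf (-1) 0 0; rewrite scaler0 add0r scaleN1r addNr. Qed.
Lemma linZ a u : f (a *: u) = a *: f u.
Proof. by have := lf a u 0; rewrite lin0 !addr0. Qed.
Lemma linear_comb (n : nat) (k : 'I_n -> R) (u : 'I_n -> U) :
  f (\sum_i k i *: u i) = \sum_i k i *: f (u i).
Proof.
elim/big_ind2: _ => [|x' x y' y ex ey|i _]; [exact: lin0| |exact: linZ].
by have := lf 1 x y; rewrite !scale1r ex ey.
Qed.
End Linear.

(** * Differential forms in coordinates *)

Section Forms.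
Variable E : normedModType R.
Implicit Types (b : E -> E -> R) (y u v w : E).

(** The exterior derivative on the constant fields v and w, whose bracket vanishes. *)
Definition cd b y v w : R :=
  'D_v (fun z => b z w : R^o) y - 'D_w (fun z => b z v : R^o) y.

(** Linearity is required near y and not everywhere, because the components of a form in a chart are
    linear only over the domain where the form is given. *)
Definition smf b y := (forall u, sm (fun z => b z u : R^o) y) /\
  (\forall z \near y, scalar (b z)).

(** The neighbourhood on which [b z u] is smooth depends on u. Linearity reduces all u to a finite
    basis, for which a common neighbourhood exists. *)
Lemma smf_near b y {fE : findim E} : smf b y -> \forall z \near y, smf b z.
Proof.
move=> [sb lb].
have nb : \forall z \near y, forall i, sm (fun z => b z (fdb i) : R^o) z.
  by apply: near_forall_fin => i; exact: sm_near.
have lb' : \forall z \near y, \forall t \near z, scalar (b t) by exact: near_join.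
apply: filterS2 nb lb' => z nz lz; split=> // u.
apply: (sm_ext (f := fun t => \sum_i fdc i u *: (b t (fdb i) : R^o))).
  apply: filterS lz => t lt; rewrite [in RHS](fdE u) scal_sum//.
  by apply: eq_bigr => i _; rewrite scalZ.
by apply: sm_sum => i; apply: sm_scalel.
Qed.
Lemma smf_var b y {fE : findim E} (Z : normedModType R) (z : Z) (p : Z -> E) (X : Z -> E) :
  p z = y -> smf b y -> sm p z -> sm X z -> sm (fun t => b (p t) (X t) : R^o) z.
Proof.
move=> py [sb lb] sp sX.
apply: (sm_ext (f := fun t => \sum_i fdc i (X t) * b (p t) (fdb i) : R^o)).
  have : \forall t \near z, scalar (b (p t)).
    by apply: (sm_near_comp (P := fun y => scalar (b y)) sp); rewrite py.
  apply: filterS => t lt; rewrite [in RHS](fdE (X t)) scal_sum//.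
  by apply: eq_bigr => i _; rewrite scalZ.
apply: sm_sum => i; apply: sm_mul.
  by apply: sm_comp_linear sX; exact: fdc_cont.
by apply: (sm_comp1 (g := fun z => b z (fdb i) : R^o) sp); rewrite py.
Qed.

Lemma cd_ext b b' y v w : (\forall z \near y, forall u, b z u = b' z u) ->
  cd b y v w = cd b' y v w.
Proof.
by move=> H; congr (_ - _); apply: D_ext; apply: filterS H => z ->.
Qed.

Lemma smf_ext b b' y : (\forall z \near y, forall u, b z u = b' z u) ->
  smf b y -> smf b' y.
Proof.
move=> H [sb lb]; split=> [u|]; first by apply: sm_ext (sb u); apply: filterS H => z ->.
by apply: filterS2 H lb => z Hz lz a u1 u2; rewrite -!Hz lz.
Qed.

Lemma cdC b y v w : cd b y v w = - cd b y w v.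
Proof. by rewrite /cd opprB. Qed.

Lemma smf_lin b y : smf b y -> scalar (b y).
Proof. by move=> [_ /nbhs_singleton]. Qed.

Lemma smf_Dlin b y v : smf b y -> scalar (fun u => 'D_v (fun z => b z u : R^o) y).
Proof.
move=> [sb lb] a u w.
transitivity ('D_v (fun z => a *: (b z u : R^o) + (b z w : R^o)) y).
  by apply: D_ext; apply: filterS lb => z lz; rewrite lz.
by rewrite D_add// ?D_scalel//; exact: sm_scalel.
Qed.

Lemma cd_linl b y w : smf b y -> scalar (fun v => cd b y v w).
Proof.
move=> Hb a u v; rewrite /cd D_lin; last by case: Hb.
by rewrite (smf_Dlin w Hb) !scaleRo; ring.
Qed.

Lemma cd_linr b y v : smf b y -> scalar (fun w => cd b y v w).
Proof.
by move=> Hb a u w; rewrite cdC (cd_linl v Hb) !(cdC b y v); ring.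
Qed.

Lemma smf_scale (f : E -> R^o) b y : sm f y -> smf b y ->
  smf (fun z u => f z * b z u) y.
Proof.
move=> sf [sb lb]; split=> [u|]; first exact: sm_mul.
by apply: filterS lb => z lz a u v; rewrite lz; ring.
Qed.

Lemma smf_add b b' y : smf b y -> smf b' y -> smf (fun z u => b z u + b' z u) y.
Proof.
move=> [sb lb] [sb' lb']; split=> [u|]; first exact: sm_add.
by apply: filterS2 lb lb' => z lz lz' a u v; rewrite lz lz'; ring.
Qed.

Lemma cd_scale (f : E -> R^o) b y v w : sm f y -> smf b y ->
  cd (fun z u => f z * b z u) y v w =
  'D_v f y * b y w - 'D_w f y * b y v + f y * cd b y v w.
Proof. by move=> sf [sb _]; rewrite /cd !D_mul//; ring. Qed.

Lemma cd_add b b' y v w : smf b y -> smf b' y ->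
  cd (fun z u => b z u + b' z u) y v w = cd b y v w + cd b' y v w.
Proof. by move=> [sb _] [sb' _]; rewrite /cd !D_add//; ring. Qed.

Lemma smf_d (f : E -> R^o) y : sm f y -> smf (fun z u => 'D_u f z) y.
Proof.
move=> sf; split=> [u|]; first exact: sm_D.
by apply: filterS (sm_near sf) => z sz a u v; rewrite D_lin.
Qed.

Lemma cd_d (f : E -> R^o) y v w : sm f y -> cd (fun z u => 'D_u f z) y v w = 0.
Proof. by move=> sf; rewrite /cd schwarz// subrr. Qed.

End Forms.

(** * Pullback of forms *)

Section Pull.
Context {E E' : normedModType R} {fE : findim E} {fE' : findim E'}.
Variables (t : E -> E') (y : E) (b : E' -> E' -> R).
Hypotheses (st : sm t y) (sb : smf b (t y)).

Lemma smf_pull : smf (fun z u => b (t z) ('D_u t z)) y.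
Proof.
split=> [u|]; first by apply: (smf_var erefl sb st); exact: sm_D.
have : \forall z \near y, scalar (b (t z)).
  by apply: (sm_near_comp (P := fun y => scalar (b y)) st); case: sb.
by apply: filterS2 (sm_near st) => z sz lz a u v; rewrite D_lin// lz.
Qed.

Lemma D_pull v w : 'D_v (fun z => b (t z) ('D_w t z) : R^o) y =
  b (t y) ('D_v (fun z => 'D_w t z) y) +
  'D_('D_v t y) (fun z => b z ('D_w t y) : R^o) (t y).
Proof.
have [sb1 lb] := sb.
have lbt : \forall z \near y, scalar (b (t z)).
  exact: (sm_near_comp (P := fun y => scalar (b y)) st lb).
transitivity ('D_v (fun z => \sum_i fdc i ('D_w t z) * b (t z) (fdb i) : R^o) y).
  apply: D_ext; apply: filterS lbt => z lz; rewrite [in LHS](fdE ('D_w t z)) scal_sum//.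
  by apply: eq_bigr => i _; rewrite scalZ.
have s1 i : sm (fun z => fdc i ('D_w t z) : R^o) y.
  by apply: (sm_comp_linear (L := fdc i)); [exact: fdc_cont|exact: sm_D].
have s2 i : sm (fun z => b (t z) (fdb i) : R^o) y.
  by apply: (sm_comp1 (g := fun z => b z (fdb i) : R^o) st).
rewrite D_sum; last by move=> i; exact: sm_mul.
rewrite [in X in _ = X + _](fdE ('D_v (fun z => 'D_w t z) y)).
rewrite [in X in _ = _ + X](fdE ('D_w t y)).
rewrite (scal_sum (smf_lin sb)) (scal_sum (smf_Dlin _ sb)) -big_split.
apply: eq_bigr => i _ /=; rewrite D_mul//.
rewrite (D_comp (g := fun z => b z (fdb i) : R^o) v st)//.
rewrite (scalZ (smf_Dlin _ sb)) (scalZ (smf_lin sb)) addrC.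
congr (_ + _); rewrite mulrC; congr (_ * _).
exact: (D_complin v (@fdc_cont _ _ i) (sm_D w st)).
Qed.

Lemma schwarzE v w : 'D_v (fun z => 'D_w t z) y = 'D_w (fun z => 'D_v t z) y.
Proof.
apply: fd_inj => i.
rewrite -(D_complin v (@fdc_cont _ _ i) (sm_D w st)).
rewrite -(D_complin w (@fdc_cont _ _ i) (sm_D v st)).
have H u : \forall z \near y, (fdc i \o (fun z => 'D_u t z)) z = 'D_u (fdc i \o t) z.
  apply: filterS (sm_near st) => z sz; rewrite D_complin//; exact: fdc_cont.
rewrite (D_ext v (H w)) (D_ext w (H v)); apply: schwarz.
apply: sm_comp_linear st; exact: fdc_cont.
Qed.

(** Differentiating the pulled back form produces second derivatives of t, which are symmetric in v
    and w and cancel in the difference. *)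
Lemma cd_pull v w : cd (fun z u => b (t z) ('D_u t z)) y v w =
  cd b (t y) ('D_v t y) ('D_w t y).
Proof. by rewrite /cd !D_pull schwarzE opprD addrACA subrr add0r. Qed.

End Pull.

End Calculus.
#[global] Existing Instance findim_R.
#[global] Existing Instance findim_mx.
#[global] Existing Instance findim_prod.

(** * Manifolds *)

Section ManifoldCharts.
Context {R : realType} {T : Type} {E : normedModType R} {fE : findim E}.
Implicit Types (P Q S : patch T E) (N : premanifold T E) (p : T) (y v w u : E) (O : set T).

(** The part of [is_manifold] on which the calculus in charts rests. For B and SD it is shown first;
    separation and countability are then lifted from M by [fibred_manifold]. *)
Definition charted N : Prop :=
  [/\ (forall P, atlas N P ->
         [/\ open (dom P), {in dom P &, injective (par P)} & rng P `<=` pts N]),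
      (forall p, pts N p -> exists2 P, atlas N P & rng P p) &
      (forall P Q, atlas N P -> atlas N Q ->
         let W := dom P `&` par P @^-1` rng Q in
         open W /\ smooth_on W (coord Q \o par P))].

Lemma is_manifold_charted N : is_manifold N -> charted N.
Proof. by case. Qed.

Lemma coord_rng P p : rng P p -> dom P (coord P p) /\ par P (coord P p) = p.
Proof. by move=> [y Py yp]; exact: (@xgetPex _ 0 [set y | dom P y /\ par P y = p] (ex_intro _ y (conj Py yp))). Qed.

Lemma rng_par P y : dom P y -> rng P (par P y).
Proof. by exists y. Qed.

Variables (N : premanifold T E) (cN : charted N).

Lemma chart_open P : atlas N P -> open (dom P).
Proof. by case: cN => + _ _ aP => /(_ _ aP) []. Qed.

Lemma chart_pts P y : atlas N P -> dom P y -> pts N (par P y).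
Proof. by case: cN => + _ _ aP => /(_ _ aP) [_ _ + Py]; apply; exists y. Qed.

Lemma coordK P y : atlas N P -> dom P y -> coord P (par P y) = y.
Proof.
move=> aP Py; have [d e] := coord_rng (rng_par Py).
by case: cN => + _ _ => /(_ _ aP) [_ inj _]; apply: inj; rewrite ?inE.
Qed.

Lemma near_dom P y : atlas N P -> dom P y -> \forall z \near y, dom P z.
Proof. by move=> aP Py; apply: near_open Py; exact: chart_open. Qed.

Lemma trans_near P Q y : atlas N P -> atlas N Q -> dom P y -> rng Q (par P y) ->
  \forall z \near y, dom P z /\ rng Q (par P z).
Proof.
move=> aP aQ Py Qy; case: cN => _ _ /(_ _ _ aP aQ) [oW _].
exact: (near_open oW (conj Py Qy)).
Qed.

Lemma trans_sm P Q y : atlas N P -> atlas N Q -> dom P y -> rng Q (par P y) ->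
  sm (coord Q \o par P) y.
Proof.
move=> aP aQ Py Qy; case: cN => _ _ /(_ _ _ aP aQ) [oW sW].
exact: (sm_on oW sW (conj Py Qy)).
Qed.

Lemma patch_atP p : pts N p -> atlas N (patch_at N p) /\ rng (patch_at N p) p.
Proof.
move=> Np; rewrite /patch_at; case: pselect => [h|]; first by case: (cid h).
by case: cN => _ /(_ _ Np) [P aP Pp] _ []; exists P.
Qed.

(** Near y the transition from P to S factors through Q; the changes of components below reduce to
    this chain rule. *)
Lemma trans_chain P Q S y : atlas N P -> atlas N Q -> atlas N S ->
  dom P y -> rng Q (par P y) -> rng S (par P y) ->
  forall v, 'D_v (coord S \o par P) y =
    'D_('D_v (coord Q \o par P) y) (coord S \o par Q) (coord Q (par P y)).
Proof.
move=> aP aQ aS Py Qy Sy v; have [d e] := coord_rng Qy.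
rewrite -(D_comp v (f := coord Q \o par P) (g := coord S \o par Q)).
- apply: D_ext; have := trans_near aP aQ Py Qy; apply: filterS => z [_ /coord_rng [_]].
  by move=> /= ->.
- exact: trans_sm.
- by apply: trans_sm => //=; rewrite e.
Qed.

Lemma trans_id P y v : atlas N P -> dom P y -> 'D_v (coord P \o par P) y = v.
Proof.
move=> aP Py; rewrite -[RHS](D_id y v); apply: D_ext.
by have := near_dom aP Py; apply: filterS => z Pz /=; rewrite coordK.
Qed.

Lemma tcoord_dpatch P Q y v : atlas N P -> atlas N Q -> dom P y -> rng Q (par P y) ->
  tcoord N Q (par P y) (dpatch N P y v) = 'D_v (coord Q \o par P) y.
Proof.
move=> aP aQ Py Qy; have [a0 r0] := patch_atP (chart_pts aP Py).
by rewrite (trans_chain aP a0 aQ).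
Qed.

Lemma dpatchK P y v : atlas N P -> dom P y -> tcoord N P (par P y) (dpatch N P y v) = v.
Proof.
by move=> aP Py; rewrite tcoord_dpatch ?trans_id//; exact: rng_par.
Qed.

Lemma tcoordK P y w : atlas N P -> dom P y -> dpatch N P y (tcoord N P (par P y) w) = w.
Proof.
move=> aP Py; have [a0 r0] := patch_atP (chart_pts aP Py).
have [d0 e0] := coord_rng r0.
rewrite /dpatch /tcoord -{2}(coordK aP Py) -[in X in 'D__ _ (coord P X)]e0.
rewrite -(trans_chain a0 aP a0) ?e0//; [exact: trans_id|exact: rng_par].
Qed.

Lemma dpatch_change P Q y v : atlas N P -> atlas N Q -> dom P y -> rng Q (par P y) ->
  dpatch N Q (coord Q (par P y)) ('D_v (coord Q \o par P) y) = dpatch N P y v.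
Proof.
move=> aP aQ Py Qy; have [a0 r0] := patch_atP (chart_pts aP Py).
have [d e] := coord_rng Qy.
by rewrite /dpatch e -(trans_chain aP aQ a0).
Qed.

Lemma dpatch_lin P y a u v : atlas N P -> dom P y ->
  dpatch N P y (a *: u + v) = a *: dpatch N P y u + dpatch N P y v.
Proof.
move=> aP Py; have [a0 r0] := patch_atP (chart_pts aP Py).
by apply: D_lin; exact: trans_sm.
Qed.

Lemma tcoord_lin P y a u v : atlas N P -> dom P y ->
  tcoord N P (par P y) (a *: u + v) = a *: tcoord N P (par P y) u + tcoord N P (par P y) v.
Proof.
move=> aP Py; have [a0 r0] := patch_atP (chart_pts aP Py).
have [d0 e0] := coord_rng r0.
by apply: D_lin; apply: trans_sm; rewrite ?e0//; exact: rng_par.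
Qed.

Lemma dpatch_self p v : pts N p -> dpatch N (patch_at N p) (coord (patch_at N p) p) v = v.
Proof.
move=> Np; have [a0 r0] := patch_atP Np; have [d0 e0] := coord_rng r0.
by rewrite /dpatch e0 trans_id.
Qed.

Definition rep1 P (a : T -> E -> R) (z u : E) : R := a (par P z) (dpatch N P z u).

Lemma rep1_change P Q y a : atlas N P -> atlas N Q -> dom P y -> rng Q (par P y) ->
  \forall z \near y, forall u, rep1 P a z u =
    rep1 Q a ((coord Q \o par P) z) ('D_u (coord Q \o par P) z).
Proof.
move=> aP aQ Py Qy; have := trans_near aP aQ Py Qy.
apply: filterS => z [Pz Qz] u; have [d e] := coord_rng Qz.
by rewrite /rep1 /= e dpatch_change.
Qed.

Lemma smf_change P Q y a : atlas N P -> atlas N Q -> dom P y -> rng Q (par P y) ->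
  smf (rep1 Q a) (coord Q (par P y)) -> smf (rep1 P a) y.
Proof.
move=> aP aQ Py Qy sQ; have st := trans_sm aP aQ Py Qy.
apply: smf_ext (smf_pull st sQ).
have := rep1_change a aP aQ Py Qy; by apply: filterS => z H u; rewrite -H.
Qed.

(** [dform] is computed in the chart chosen at the point. Another chart differs from it by a
    pullback along the transition map, with which [cd] commutes. *)
Lemma dformE P y a v w : atlas N P -> dom P y -> smf (rep1 P a) y ->
  dform N a (par P y) (dpatch N P y v) (dpatch N P y w) = cd (rep1 P a) y v w.
Proof.
move=> aP Py sa; have [a0 r0] := patch_atP (chart_pts aP Py).
have [d0 e0] := coord_rng r0.
have s0 : smf (rep1 (patch_at N (par P y)) a) ((coord (patch_at N (par P y)) \o par P) y).
  apply: (smf_change a0 aP) => //; first by rewrite e0; exact: rng_par.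
  by rewrite /= e0 coordK.
rewrite (cd_ext _ _ (rep1_change a aP a0 Py r0)) cd_pull//; exact: trans_sm.
Qed.

Lemma mopen_near O P y : mopen N O -> atlas N P -> dom P y -> O (par P y) ->
  \forall z \near y, dom P z /\ O (par P z).
Proof. by move=> [_ oO] aP Py Oy; apply: (near_open (oO _ aP)). Qed.

(** The definition tests every chart of the atlas; as transitions are continuous, one chart around
    each point is enough. [form1_intro], [smooth_fun_intro] and [smooth_field_intro] make the same
    reduction for forms, functions and fields. *)
Lemma mopen_intro O : O `<=` pts N ->
  (forall p, O p -> exists P y, [/\ atlas N P, dom P y, par P y = p &
     \forall z \near y, O (par P z)]) -> mopen N O.
Proof.
move=> ON H; split=> // Q aQ; rewrite openE => y [Qy Oy].
have [P [x [aP Px xy Hx]]] := H _ Oy.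
have Py : rng P (par Q y) by rewrite -xy; exact: rng_par.
have cx : coord P (par Q y) = x by rewrite -xy coordK.
have n1 : \forall z \near y, O (par P (coord P (par Q z))).
  by apply: (sm_near_comp (P := fun z => O (par P z)) (trans_sm aQ aP Qy Py)); rewrite /= cx.
apply: filterS2 n1 (trans_near aQ aP Qy Py) => z Oz [Qz Pz]; split=> //.
by have [_ e] := coord_rng Pz; rewrite /= -e.
Qed.

Lemma mopenI O O' : mopen N O -> mopen N O' -> mopen N (O `&` O').
Proof.
move=> [ON oO] [ON' oO']; split=> [p [/ON]//|P aP].
have -> : dom P `&` par P @^-1` (O `&` O') = (dom P `&` par P @^-1` O) `&` (dom P `&` par P @^-1` O').
  by apply/seteqP; split=> z /=; tauto.
by apply: openI; [exact: oO|exact: oO'].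
Qed.

Lemma mopen_pts : mopen N (pts N).
Proof.
split=> // P aP; rewrite (_ : dom P `&` _ = dom P); first exact: chart_open.
by apply/seteqP; split=> [z []//|z Pz]; split=> //; exact: chart_pts.
Qed.

Lemma mopen_par P (W : set E) : atlas N P -> open W -> W `<=` dom P -> mopen N (par P @` W).
Proof.
move=> aP oW WP; apply: mopen_intro.
  by move=> p [y Wy <-]; apply: chart_pts => //; exact: WP.
move=> p [y Wy <-]; exists P, y; split=> //; first exact: WP.
by apply: filterS (near_open oW Wy) => z Wz; exists z.
Qed.

Lemma mopen_rng P : atlas N P -> mopen N (rng P).
Proof. by move=> aP; apply: mopen_par => //; exact: chart_open. Qed.

Lemma form1_smf O a P y : mopen N O -> is_form1 N O a -> atlas N P -> dom P y ->
  O (par P y) -> smf (rep1 P a) y.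
Proof.
move=> oO [la sa] aP Py Oy; split=> [u|].
  by apply: (sm_on _ (sa _ aP u)) => //; case: oO => _; apply.
apply: filterS (mopen_near oO aP Py Oy) => z [Pz Oz] c u v.
by rewrite /rep1 dpatch_lin// la.
Qed.

Lemma form1_intro O a : (forall p, O p -> exists P y, [/\ atlas N P, dom P y, par P y = p &
     smf (rep1 P a) y]) -> is_form1 N O a.
Proof.
move=> H; split=> [p /H[P [y [aP Py <- sa]]] c u v|Q aQ v].
  have := smf_lin sa c (tcoord N P (par P y) u) (tcoord N P (par P y) v).
  by rewrite /rep1 dpatch_lin// !tcoordK.
apply: smooth_on_sm => y [Qy Oy]; have [P [x [aP Px xy sa]]] := H _ Oy.
have Py : rng P (par Q y) by rewrite -xy; exact: rng_par.
have [+ _] : smf (rep1 Q a) y by apply: (smf_change aQ aP) => //; rewrite -xy coordK.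
exact.
Qed.

Lemma smooth_fun_sm O f P y : mopen N O -> smooth_fun N O f -> atlas N P -> dom P y ->
  O (par P y) -> sm (f \o par P : E -> R^o) y.
Proof.
by move=> oO sf aP Py Oy; apply: (sm_on _ (sf _ aP)) => //; case: oO => _; apply.
Qed.

Lemma smooth_fun_intro O (f : T -> R) : (forall p, O p -> exists P y,
   [/\ atlas N P, dom P y, par P y = p & sm (f \o par P : E -> R^o) y]) -> smooth_fun N O f.
Proof.
move=> H Q aQ; apply: smooth_on_sm => y [Qy Oy]; have [P [x [aP Px xy sa]]] := H _ Oy.
have Py : rng P (par Q y) by rewrite -xy; exact: rng_par.
have cx : coord P (par Q y) = x by rewrite -xy coordK.
apply: (sm_ext (f := (f \o par P) \o (coord P \o par Q))).
  apply: filterS (trans_near aQ aP Qy Py) => z [Qz Pz] /=.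
  by have [_ ->] := coord_rng Pz.
by apply: sm_comp1; [exact: trans_sm|rewrite /= cx].
Qed.

Lemma smooth_field_sm O X P y : mopen N O -> smooth_field N O X -> atlas N P -> dom P y ->
  O (par P y) -> sm (fun z => tcoord N P (par P z) (X (par P z))) y.
Proof.
by move=> oO sf aP Py Oy; apply: (sm_on _ (sf _ aP)) => //; case: oO => _; apply.
Qed.

Lemma sm_Dvar (t X : E -> E) y : sm t y -> sm X y -> sm (fun z => 'D_(X z) t z) y.
Proof.
move=> st sX; apply: (sm_ext (f := fun z => \sum_i (fdc i (X z) : R) *: 'D_(fdb i) t z)).
  by apply: filterS (sm_near st) => z sz; rewrite [in RHS](fdE (X z)) derive_linear//; exact: sm_diff.
apply: sm_sum => i; apply: sm_fdc => j.
apply: (sm_ext (f := fun z => fdc i (X z) * fdc j ('D_(fdb i) t z) : R^o)).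
  by apply: nearW => z /=; rewrite linearZ.
apply: sm_mul; first by apply: sm_comp_linear sX; exact: fdc_cont.
by apply: (sm_comp_linear (L := fdc j)); [exact: fdc_cont|exact: sm_D].
Qed.

Lemma tcoord_change P Q y w : atlas N P -> atlas N Q -> dom P y -> rng Q (par P y) ->
  tcoord N Q (par P y) w = 'D_(tcoord N P (par P y) w) (coord Q \o par P) y.
Proof.
by move=> aP aQ Py Qy; rewrite -{1}(tcoordK w aP Py) tcoord_dpatch.
Qed.

Lemma smooth_field_intro O X : (forall p, O p -> exists P y,
   [/\ atlas N P, dom P y, par P y = p &
     sm (fun z => tcoord N P (par P z) (X (par P z))) y]) -> smooth_field N O X.
Proof.
move=> H Q aQ; apply: smooth_on_sm => y [Qy Oy]; have [P [x [aP Px xy sa]]] := H _ Oy.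
have Py : rng P (par Q y) by rewrite -xy; exact: rng_par.
have Qx : rng Q (par P x) by rewrite xy; exact: rng_par.
have cx : coord P (par Q y) = x by rewrite -xy coordK.
apply: (sm_ext (f := (fun z => 'D_(tcoord N P (par P z) (X (par P z))) (coord Q \o par P) z)
    \o (coord P \o par Q))).
  apply: filterS (trans_near aQ aP Qy Py) => z [Qz Pz] /=; have [d e] := coord_rng Pz.
  by rewrite -tcoord_change ?e//; exact: rng_par.
apply: sm_comp; first exact: trans_sm.
by rewrite /= cx; apply: sm_Dvar => //; exact: trans_sm.
Qed.

Lemma bilin_expand (b : E -> E -> R) v w : (forall u, scalar (b u)) ->
  (forall u, scalar (fun u' => b u' u)) ->
  b v w = \sum_i \sum_j fdc i v * (fdc j w * b (fdb i) (fdb j)).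
Proof.
move=> lr ll; rewrite [in LHS](fdE v) (scal_sum (ll w)); apply: eq_bigr => i _.
rewrite (scalZ (ll w)) -mulr_sumr [in LHS](fdE w) (scal_sum (lr _)).
by congr (_ * _); apply: eq_bigr => j _; rewrite (scalZ (lr _)).
Qed.

Definition rep2 P (g : T -> E -> E -> R) (z u v : E) : R :=
  g (par P z) (dpatch N P z u) (dpatch N P z v).

Lemma bilin_smooth_intro O (g : T -> E -> E -> R) : mopen N O ->
  (forall p, O p -> (forall v, scalar (g p v)) /\ (forall v w, g p v w = g p w v)) ->
  (forall p, O p -> exists P y, [/\ atlas N P, dom P y, par P y = p &
     forall u v, sm (fun z => rep2 P g z u v : R^o) y]) ->
  forall P, atlas N P -> forall v w,
    smooth_on (dom P `&` par P @^-1` O) ((fun y => rep2 P g y v w) : E -> R^o).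
Proof.
move=> oO lg H Q aQ v w; apply: smooth_on_sm => y [Qy Oy].
have [P [x [aP Px xy sa]]] := H _ Oy.
have Py : rng P (par Q y) by rewrite -xy; exact: rng_par.
have cx : coord P (par Q y) = x by rewrite -xy coordK.
pose t := coord P \o par Q; have st : sm t y by exact: trans_sm.
(* The components in the chart Q are those in P composed with the transition t and contracted twice
   with its derivative, a finite sum of smooth products. *)
apply: (sm_ext (f := fun z => \sum_i \sum_j fdc i ('D_v t z) * (fdc j ('D_w t z) *
   rep2 P g (t z) (fdb i) (fdb j)) : R^o)).
  apply: filterS2 (mopen_near oO aQ Qy Oy) (trans_near aQ aP Qy Py) => z [Qz Oz] [_ Pz].
  have [lz cz] := lg _ Oz; have [d e] := coord_rng Pz.
  have lz' u : scalar (fun u' => g (par Q z) u' u) by move=> c u1 u2; rewrite cz lz !(cz u).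
  rewrite /rep2 -!(dpatch_change _ aQ aP Qz Pz) /t /= e.
  have ldp a u1 u2 : dpatch N P (coord P (par Q z)) (a *: u1 + u2) =
     a *: dpatch N P (coord P (par Q z)) u1 + dpatch N P (coord P (par Q z)) u2.
    exact: dpatch_lin.
  symmetry; apply: (bilin_expand (b := fun u v => g (par Q z)
     (dpatch N P (coord P (par Q z)) u) (dpatch N P (coord P (par Q z)) v))).
    by move=> u c u1 u2; rewrite ldp lz.
  by move=> u c u1 u2; rewrite ldp lz'.
apply: sm_sum => i; apply: sm_sum => j; apply: sm_mul.
  by apply: (sm_comp_linear (L := fdc i)); [exact: fdc_cont|exact: sm_D].
apply: sm_mul; first by apply: (sm_comp_linear (L := fdc j)); [exact: fdc_cont|exact: sm_D].
by apply: (sm_comp1 (g := fun z => rep2 P g z (fdb i) (fdb j) : R^o) st); rewrite /t /= cx.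
Qed.

Lemma dform_ext O a a' p v w : mopen N O -> O p -> (forall q, O q -> a q = a' q) ->
  dform N a p v w = dform N a' p v w.
Proof.
move=> oO Op H; have Np : pts N p by case: oO => + _; apply.
have [a0 r0] := patch_atP Np; have [d0 e0] := coord_rng r0.
have n : \forall z \near (coord (patch_at N p) p), forall u,
    rep1 (patch_at N p) a z u = rep1 (patch_at N p) a' z u.
  apply: filterS (mopen_near oO a0 d0 _); last by rewrite e0.
  by move=> z [_ Oz] u; rewrite /rep1 H.
exact: (cd_ext v w n).
Qed.

End ManifoldCharts.

(** * Smooth maps between manifolds and their differentials *)

Section ManifoldMaps.
Context {R : realType} {T T' : Type} {E E' : normedModType R} {fE : findim E} {fE' : findim E'}.
Variables (N : premanifold T E) (N' : premanifold T' E') (cN : charted N) (cN' : charted N').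
Implicit Types (f : T -> T').

(** [coord Q] takes the default value 0 outside [rng Q], so smoothness of the coordinate expression
    is meaningful only when f sends a whole neighbourhood into [rng Q]. *)
Definition smat (P : patch T E) (Q : patch T' E') f y :=
  (\forall z \near y, rng Q (f (par P z))) /\ sm (coord Q \o f \o par P) y.

Definition smooth_at f p := exists P Q y,
  [/\ atlas N P, atlas N' Q, dom P y, par P y = p & smat P Q f y].

Lemma smat_change P P' Q Q' f y : atlas N P -> atlas N P' -> atlas N' Q -> atlas N' Q' ->
  dom P y -> rng P' (par P y) -> rng Q' (f (par P y)) ->
  smat P' Q f (coord P' (par P y)) -> smat P Q' f y.
Proof.
move=> aP aP' aQ aQ' Py P'y Q'y [n' s'].
have st := trans_sm cN aP aP' Py P'y.
have n1 : \forall z \near y, rng Q (f (par P' (coord P' (par P z)))).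
  exact: (sm_near_comp (P := fun z => rng Q (f (par P' z))) st n').
have n2 : \forall z \near y, rng Q (f (par P z)).
  apply: filterS2 n1 (trans_near cN aP aP' Py P'y) => z Qz [_ Hz].
  by have [_ <-] := coord_rng Hz.
have Qy := nbhs_singleton n2.
have s1 : sm (coord Q \o f \o par P) y.
  apply: (sm_ext (f := (coord Q \o f \o par P') \o (coord P' \o par P))).
    apply: filterS (trans_near cN aP aP' Py P'y) => z [_ Hz] /=.
    by have [_ ->] := coord_rng Hz.
  exact: sm_comp.
have [d e] := coord_rng Qy.
split.
  have n3 := trans_near cN' aQ aQ' d _; rewrite e in n3.
  have n4 := sm_near_comp s1 (n3 Q'y).
  by apply: filterS2 n4 n2 => z [_ Hz] Hz'; have [_ <-] := coord_rng Hz'.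
apply: (sm_ext (f := (coord Q' \o par Q) \o (coord Q \o f \o par P))).
  by apply: filterS n2 => z Hz /=; have [_ ->] := coord_rng Hz.
by apply: sm_comp => //; apply: (trans_sm cN') => //=; rewrite e.
Qed.

Lemma smooth_at_smat P Q f y : atlas N P -> atlas N' Q -> dom P y -> rng Q (f (par P y)) ->
  smooth_at f (par P y) -> smat P Q f y.
Proof.
move=> aP aQ Py Qy [P' [Q' [y' [aP' aQ' P'y' e s]]]].
have P'y : rng P' (par P y) by rewrite -e; exact: rng_par.
by apply: (smat_change (P' := P') (Q := Q')) => //; rewrite -e (coordK cN).
Qed.

Lemma smooth_map_intro O f : mopen N O ->
  (forall p, O p -> smooth_at f p) -> smooth_map N O N' f.
Proof.
move=> oO H; split=> [p Op|P Q aP aQ W].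
  have [P [Q [y [aP aQ Py <- [/nbhs_singleton Qy _]]]]] := H _ Op.
  by have [d <-] := coord_rng Qy; apply: (chart_pts cN').
have WH y : W y -> smat P Q f y.
  by move=> [Py Oy Qy]; apply: smooth_at_smat => //; exact: H.
split; last by apply: smooth_on_sm => y /WH [].
rewrite openE => y Wy; have [n _] := WH _ Wy; have [Py Oy Qy] := Wy.
by apply: filterS2 n (mopen_near oO aP Py Oy) => z ? [].
Qed.

(** [mdiff] is computed in the charts chosen at p and at f p; the chain rule through both
    transitions moves it to arbitrary charts P and Q. *)
Lemma mdiffE P Q f y v : atlas N P -> atlas N' Q -> dom P y -> rng Q (f (par P y)) ->
  smooth_at f (par P y) ->
  mdiff N N' f (par P y) (dpatch N P y v) =
  dpatch N' Q (coord Q (f (par P y))) ('D_v (coord Q \o f \o par P) y).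
Proof.
move=> aP aQ Py Qy sf; have Np := chart_pts cN aP Py.
have [a0 r0] := patch_atP cN Np; have [d0 e0] := coord_rng r0.
have [dQ eQ] := coord_rng Qy.
have N'f : pts N' (f (par P y)) by rewrite -eQ; apply: (chart_pts cN').
have [a1 r1] := patch_atP cN' N'f.
have [n s] := smooth_at_smat aP aQ Py Qy sf.
have s1 : smat (patch_at N (par P y)) (patch_at N' (f (par P y))) f (coord (patch_at N (par P y)) (par P y)).
  by apply: smooth_at_smat => //; rewrite e0.
rewrite /mdiff /dpatch eQ -(D_comp v (trans_sm cN aP a0 Py r0) s1.2).
rewrite -(D_comp v s); last by apply: (trans_sm cN') => //=; rewrite eQ.
apply: D_ext; apply: filterS2 n (trans_near cN aP a0 Py r0) => z Hz [_ Hz'].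
by have [_ e] := coord_rng Hz; have [_ e'] := coord_rng Hz'; rewrite /= e e'.
Qed.

Lemma smooth_at_ext O f f' p : mopen N O -> O p -> (forall q, O q -> f q = f' q) ->
  smooth_at f p -> smooth_at f' p.
Proof.
move=> oO Op H [P [Q [y [aP aQ Py e [n s]]]]]; exists P, Q, y; split=> //.
have nO : \forall z \near y, dom P z /\ O (par P z) by apply: (mopen_near oO aP Py); rewrite e.
split; first by apply: filterS2 n nO => z + [_ Oz]; rewrite H.
by apply: sm_ext s; apply: filterS nO => z [_ Oz] /=; rewrite H.
Qed.

Lemma mdiff_ext O f f' p v : mopen N O -> O p -> (forall q, O q -> f q = f' q) ->
  mdiff N N' f p v = mdiff N N' f' p v.
Proof.
move=> oO Op H; have Np : pts N p by case: oO => + _; apply.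
have [a0 r0] := patch_atP cN Np; have [d0 e0] := coord_rng r0.
have Op' : O (par (patch_at N p) (coord (patch_at N p) p)) by rewrite e0.
rewrite /mdiff -(H _ Op); apply: D_ext.
by apply: filterS (mopen_near oO a0 d0 Op') => z [_ Oz] /=; rewrite (H _ Oz).
Qed.

End ManifoldMaps.

(** * Separation and countability *)

Section Separation.
Context {R : realType} {T : Type} {E : normedModType R} {fE : findim E}.
Variables (N : premanifold T E) (cN : charted N).

Lemma separate_chart P p q : atlas N P -> rng P p -> rng P q -> p <> q ->
  exists O O' : set T, [/\ mopen N O, mopen N O', O p, O' q & O `&` O' = set0].
Proof.
move=> aP rp rq pq; have [dp ep] := coord_rng rp; have [dq eq] := coord_rng rq.
have cpq : coord P p != coord P q by apply/eqP => e; apply: pq; rewrite -ep -eq e.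
have := @norm_hausdorff R E; rewrite open_hausdorff => /(_ _ _ cpq).
move=> [[A B] /= [/set_mem Ap /set_mem Bq] [oA oB /eqP AB]].
have oP := chart_open cN aP.
exists (par P @` (dom P `&` A)), (par P @` (dom P `&` B)); split.
- by apply: (mopen_par cN aP) => [|z []//]; exact: openI.
- by apply: (mopen_par cN aP) => [|z []//]; exact: openI.
- by exists (coord P p).
- by exists (coord P q).
- apply/seteqP; split=> // r [[y [Py Ay] <-] [z [Pz Bz] e]].
  have : (A `&` B) y by split=> //; rewrite -(coordK cN aP Py) -e (coordK cN aP Pz).
  by rewrite AB.
Qed.

(** An open set is open in each chart, so the chart images of base sets of E form a base. [Q] may
    have indices that give no chart of the atlas; these contribute the empty set. *)
Lemma countable_base (I : countType) (Q : I -> patch T E) :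
  (exists b : nat -> set E, (forall n, open (b n)) /\
     forall O x, open O -> O x -> exists n, b n x /\ b n `<=` O) ->
  (forall p, pts N p -> exists i, atlas N (Q i) /\ rng (Q i) p) ->
  exists b : nat -> set T, (forall n, mopen N (b n)) /\
    forall O p, mopen N O -> O p -> exists n, b n p /\ b n `<=` O.
Proof.
move=> [b [ob Hb]] HQ.
pose c (x : I * nat) : set T :=
  if pselect (atlas N (Q x.1)) then par (Q x.1) @` (dom (Q x.1) `&` b x.2) else set0.
exists (fun n => if unpickle n is Some x then c x else set0); split.
  have m0 : mopen N set0.
    split=> [p []//|P aP]; rewrite (_ : _ `&` _ = set0); first exact: open0.
    by apply/seteqP; split => z // [].
  move=> n; case: (unpickle n) => [[i k]|//]; rewrite /c; case: pselect => [a|//] /=.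
  by apply: (mopen_par cN a) => [|z []//]; apply: openI; [exact: (chart_open cN)|exact: ob].
move=> O p oO Op; have Np : pts N p by case: oO => + _; apply.
have [i [a r]] := HQ _ Np; have [d e] := coord_rng r.
have [k [bk bO]] : exists n, b n (coord (Q i) p) /\ b n `<=` dom (Q i) `&` par (Q i) @^-1` O.
  by apply: Hb; [case: oO => _; apply|split; rewrite //= e].
exists (pickle (i, k)); rewrite pickleK /c; case: pselect => [_|//] /=; split.
  by exists (coord (Q i) p).
by move=> q [y [_ /bO [_ Oy]] <-].
Qed.

End Separation.

Section CountableBase.
Context {R : realType} {E : normedModType R} {fE : findim E}.

(** Balls with rational centre and radius 1/(n+1): if 1/(n+1) < e/2 and the centre is that close to
    x, the ball contains x and lies in the ball of radius e around x. *)
Lemma findim_countable_base : exists b : nat -> set E, (forall n, open (b n)) /\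
  forall O x, open O -> O x -> exists n, b n x /\ b n `<=` O.
Proof.
pose pt (q : {ffun @fdI _ _ fE -> rat}) : E := \sum_i (ratr (q i) : R) *: @fdb _ _ fE i.
pose c (x : {ffun @fdI _ _ fE -> rat} * nat) : set E := ball (pt x.1) (x.2.+1%:R^-1).
exists (fun n => if unpickle n is Some x then c x else set0); split.
  by move=> n; case: (unpickle n) => [x|]; [exact: ball_open|exact: open0].
move=> O x oO Ox.
have /nbhs_ballP [e /= e0 He] : nbhs x O by exact: open_nbhs_nbhs.
have [n Hn] : exists n : nat, n.+1%:R^-1 < e / 2 :> R.
  have e2 : 0 < e / 2 by rewrite divr_gt0.
  have [n _ /(_ n) Hn] := near_infty_natSinv_lt (PosNum e2).
  by exists n; apply: Hn => /=.
set d : R := n.+1%:R^-1 in Hn *; have d0 : 0 < d by rewrite invr_gt0.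
(* M exceeds the sum of the norms of the basis vectors, so coordinates approximated up to d / M move
   the point by less than d. *)
pose M : R := \sum_i `|@fdb _ _ fE i| + 1; have M0 : 0 < M by rewrite ltr_wpDl// sumr_ge0.
have Hq (i : @fdI _ _ fE) : exists q : rat, `|fdc i x - ratr q| < d / M.
  have dM : 0 < d / M by rewrite divr_gt0.
  have [|q] := @rat_in_itvoo R (fdc i x - d / M) (fdc i x + d / M).
    by rewrite ltrBlDr -addrA ltrDl addr_gt0.
  rewrite in_itv /= => /andP[q1 q2]; exists q.
  by rewrite ltr_norml; apply/andP; split; lra.
have [q Hqi] : exists q : {ffun fdI -> rat}, forall i, `|fdc i x - ratr (q i)| < d / M.
  by exists [ffun i => projT1 (cid (Hq i))] => i; rewrite ffunE; case: (cid (Hq i)).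
have xq : `|pt q - x| < d.
  rewrite (fdE x) /pt -sumrB (le_lt_trans (ler_norm_sum _ _ _))//.
  apply: (@le_lt_trans _ _ (\sum_i (d / M * `|fdb i|))).
    apply: ler_sum => i _; rewrite -scalerBl normrZ distrC ler_wpM2r//; exact/ltW/Hqi.
  by rewrite -mulr_sumr mulrAC ltr_pdivrMr// ltr_pM2l// /M ltrDl.
exists (pickle (q, n)); rewrite pickleK /c -ball_normE /=; split => //.
move=> y /= Hy; apply: He; rewrite -ball_normE /=.
rewrite -(subrK (pt q) x) -addrA (le_lt_trans (ler_normD _ _))//.
by rewrite (splitr e) ltrD// ?(lt_trans _ Hn)// distrC.
Qed.

End CountableBase.

(** * Coframes adapted to a contact form, in coordinates *)

Section Index3.
Lemma sum3 (V : nmodType) (F : 'I_3 -> V) : \sum_i F i = F i1 + F i2 + F i3.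
Proof.
rewrite !big_ord_recl big_ord0 addr0 addrA; congr (F _ + F _ + F _);
  by apply/val_inj; rewrite /= inordK.
Qed.
Lemma i11 : (i1 == i1) = true. Proof. exact: eqxx. Qed.
Lemma i22 : (i2 == i2) = true. Proof. exact: eqxx. Qed.
Lemma i33 : (i3 == i3) = true. Proof. exact: eqxx. Qed.
Lemma i12 : (i1 == i2) = false. Proof. by rewrite -val_eqE /= !inordK. Qed.
Lemma i13 : (i1 == i3) = false. Proof. by rewrite -val_eqE /= !inordK. Qed.
Lemma i21 : (i2 == i1) = false. Proof. by rewrite -val_eqE /= !inordK. Qed.
Lemma i23 : (i2 == i3) = false. Proof. by rewrite -val_eqE /= !inordK. Qed.
Lemma i31 : (i3 == i1) = false. Proof. by rewrite -val_eqE /= !inordK. Qed.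
Lemma i32 : (i3 == i2) = false. Proof. by rewrite -val_eqE /= !inordK. Qed.
Definition iE := (i11, i22, i33, i12, i13, i21, i23, i31, i32).
Lemma i1v : nat_of_ord i1 = 0%N. Proof. exact: inordK. Qed.
Lemma i2v : nat_of_ord i2 = 1%N. Proof. exact: inordK. Qed.
Lemma i3v : nat_of_ord i3 = 2%N. Proof. exact: inordK. Qed.
Lemma ord3P (P : 'I_3 -> Prop) : P i1 -> P i2 -> P i3 -> forall i, P i.
Proof.
move=> p1 p2 p3 [[|[|[|//]]] Hi].
- by rewrite (_ : Ordinal Hi = i1)//; apply/val_inj; rewrite /= inordK.
- by rewrite (_ : Ordinal Hi = i2)//; apply/val_inj; rewrite /= inordK.
- by rewrite (_ : Ordinal Hi = i3)//; apply/val_inj; rewrite /= inordK.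
Qed.
End Index3.
#[global] Opaque i1 i2 i3.

Section TwoForms.
Context {R : realType} {W : lmodType R}.
Implicit Types (b : W -> W -> R) (v w : W).

Definition alt2 (b : W -> W -> R) := (forall w, scalar (fun v => b v w)) /\
  (forall v w, b v w = - b w v).

Lemma alt2r b : alt2 b -> forall v, scalar (b v).
Proof. by move=> [l a] v c u1 u2; rewrite a l !(a v); ring. Qed.

Lemma alt2_0 b v : alt2 b -> b v v = 0.
Proof. by move=> [_ a]; have := a v v => H; lra. Qed.

Lemma alt2_expand b (x : 'I_3 -> W) (c : 'I_3 -> W -> R) : alt2 b ->
  (forall v, v = \sum_i c i v *: x i) -> forall v w,
  b v w = b (x i1) (x i2) * (c i1 v * c i2 w - c i1 w * c i2 v) +
          b (x i2) (x i3) * (c i2 v * c i3 w - c i2 w * c i3 v) +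
          b (x i3) (x i1) * (c i3 v * c i1 w - c i3 w * c i1 v).
Proof.
move=> ab Hx v w; have lr := alt2r ab; have [ll aa] := ab.
have E u : b u w = \sum_j c j w * b u (x j).
  by rewrite {1}(Hx w) (scal_sum (lr u)); apply: eq_bigr => j _; rewrite (scalZ (lr u)).
have E' u : b v u = \sum_j c j v * b (x j) u.
  by rewrite {1}(Hx v) (scal_sum (ll u)); apply: eq_bigr => j _; rewrite (scalZ (ll u)).
rewrite E sum3 !E' !sum3 !(alt2_0 _ ab) (aa (x i2) (x i1)) (aa (x i3) (x i2)) (aa (x i1) (x i3)).
ring.
Qed.

(** Contracting the first equation with e1 gives be up to the multiple [be e1] of o1, and the second
    equation on (e1, e2) gives [be e1]. *)
Lemma connection_unique (O1 O2 : W -> W -> R) (be o1 o2 o3 : W -> R) (a1 a2 : R) (e1 e2 : W) :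
  (forall v w, O1 v w = - (be v * o1 w - be w * o1 v) + a1 * (o2 v * o3 w - o2 w * o3 v)) ->
  (forall v w, O2 v w = (be v * o2 w - be w * o2 v) + a2 * (o3 v * o1 w - o3 w * o1 v)) ->
  o1 e1 = 1 -> o2 e1 = 0 -> o3 e1 = 0 -> o1 e2 = 0 -> o2 e2 = 1 -> o3 e2 = 0 ->
  forall v, be v = - O1 v e1 + O2 e1 e2 * o1 v.
Proof. by move=> H1 H2 e11 e12 e13 e21 e22 e23 v; rewrite H1 H2 e11 e12 e13 e21 e22 e23; ring. Qed.

End TwoForms.

Lemma near_all {R : realType} (V : normedModType R) (P : V -> Prop) (y : V) :
  (forall z, P z) -> \forall z \near y, P z.
Proof. by move=> H; exact: nearW. Qed.

Section Gauge.
Context {R : realType} {V : normedModType R} {fV : findim V}.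
Implicit Types (y v w : V) (i j k : 'I_3).

Section Def.
Variables (c : 'I_3 -> V -> V -> R) (x : 'I_3 -> V -> V).

Definition str k i j y : R := cd (c k) y (x i y) (x j y).
Definition alf y v : R :=
  str i2 i1 i2 y * c i1 y v + str i1 i1 i2 y * c i2 y v - str i1 i3 i1 y * c i3 y v.
(** The term ds/s of the connection form is closed and om1 /\ om2 = c1 /\ c2, so the function K of B
    is already the corresponding coefficient of d alf on the base. *)
Definition Kf y : R := cd alf y (x i1 y) (x i2 y).

(* In the coordinates (y, t) of SD, sigma on a vector (v, tau), with th = tau / (2 t). *)
Definition sg y (th : R) v : R :=
  - (2 / 3) * (th + alf y v) + (1 / 6) * Kf y * c i3 y v.
Definition Feff y v (th : R) w (th' : R) : R :=
  (c i1 y v * c i2 y w + c i2 y v * c i1 y w) / 2 +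
  (c i3 y v * sg y th' w + sg y th v * c i3 y w) / 2.

Definition dual_at y := (forall i j, c j y (x i y) = (i == j)%:R) /\
  (forall v, v = \sum_i c i y v *: x i y).

(* Near y, c is a coframe with dual frame x and d c^3 = c^1 /\ c^2. *)
Definition gauge y := [/\ forall i, smf (c i) y, forall i, sm (x i) y,
  \forall z \near y, dual_at z &
  \forall z \near y, forall v w, cd (c i3) z v w = c i1 z v * c i2 z w - c i1 z w * c i2 z v].
End Def.

Lemma alt2_cd (b : V -> V -> R) y : smf b y -> alt2 (cd b y).
Proof. by move=> sb; split=> [w|v w]; [exact: cd_linl|exact: cdC]. Qed.

Lemma sm_cd (b : V -> V -> R) (X Y : V -> V) y : smf b y -> sm X y -> sm Y y ->
  sm (fun z => cd b z (X z) (Y z) : R^o) y.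
Proof.
move=> sb sX sY.
apply: (sm_ext (f := fun z => \sum_i \sum_j fdc i (X z) * (fdc j (Y z) * cd b z (fdb i) (fdb j)) : R^o)).
  apply: filterS (smf_near sb) => z sz; symmetry.
  rewrite [in LHS](fdE (X z)) (scal_sum (cd_linl (Y z) sz)); apply: eq_bigr => i _.
  rewrite (scalZ (cd_linl (Y z) sz)) -mulr_sumr [in LHS](fdE (Y z)) (scal_sum (cd_linr _ sz)).
  by congr (_ * _); apply: eq_bigr => j _; rewrite (scalZ (cd_linr _ sz)).
apply: sm_sum => i; apply: sm_sum => j; apply: sm_mul.
  by apply: sm_comp_linear sX; exact: fdc_cont.
apply: sm_mul; first by apply: sm_comp_linear sY; exact: fdc_cont.
by apply: sm_sub; apply: sm_D; case: sb.
Qed.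

(** d d b = 0 on three constant vectors: the six second derivatives cancel in pairs by [schwarz]. *)
Lemma cd_cycle (b : V -> V -> R) y u v w : smf b y ->
  'D_u (fun z => cd b z v w : R^o) y + 'D_v (fun z => cd b z w u : R^o) y +
  'D_w (fun z => cd b z u v : R^o) y = 0.
Proof.
move=> [sb _]; have sD u' v' : sm (fun z => 'D_u' (fun z => b z v' : R^o) z) y by apply: sm_D.
rewrite /cd !D_sub// (schwarz u v (sb w)) (schwarz u w (sb v)) (schwarz v w (sb u)).
move: ('D__ _ y) ('D__ _ y) ('D__ _ y) => a1 a2 a3; ring.
Qed.

Section Theory.
Variables (c : 'I_3 -> V -> V -> R) (x : 'I_3 -> V -> V) (y : V).
Hypothesis g : gauge c x y.

Lemma gauge_near : \forall z \near y, gauge c x z.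
Proof.
case: g => sc sx du st.
have n1 : \forall z \near y, forall i, smf (c i) z.
  by apply: near_forall_fin => i; exact: smf_near.
have n2 : \forall z \near y, forall i, sm (x i) z.
  by apply: near_forall_fin => i; exact: sm_near.
have n3 := near_join du; have n4 := near_join st.
by apply: filterS2 (filterI n1 n2) (filterI n3 n4) => z [? ?] [? ?]; split.
Qed.

Lemma gauge_dual i j : c j y (x i y) = (i == j)%:R.
Proof. by case: g => _ _ /nbhs_singleton [+ _] _; apply. Qed.

Lemma gauge_expand v : v = \sum_i c i y v *: x i y.
Proof. by case: g => _ _ /nbhs_singleton [_ +] _; apply. Qed.

Lemma gauge_inj u v : (forall i, c i y u = c i y v) -> u = v.
Proof.
move=> H; rewrite (gauge_expand u) (gauge_expand v).
by apply: eq_bigr => i _; rewrite H.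
Qed.

Lemma gauge_smf i : smf (c i) y. Proof. by case: g. Qed.
Lemma gauge_sm i : sm (x i) y. Proof. by case: g. Qed.

Lemma gauge_cd3 v w : cd (c i3) y v w = c i1 y v * c i2 y w - c i1 y w * c i2 y v.
Proof. by case: g => _ _ _ /nbhs_singleton. Qed.

Lemma sm_str k i j : sm (str c x k i j : V -> R^o) y.
Proof. by apply: sm_cd; [exact: gauge_smf|exact: gauge_sm|exact: gauge_sm]. Qed.

Lemma smf_alf : smf (alf c x) y.
Proof.
rewrite /alf; have [s1 _] := gauge_smf i1; have [s2 _] := gauge_smf i2; have [s3 _] := gauge_smf i3.
split=> [u|].
  by apply: sm_sub; [apply: sm_add|]; apply: sm_mul; rewrite //; exact: sm_str.
apply: filterS gauge_near => z [sc _ _ _] a u v.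
by rewrite (smf_lin (sc i1)) (smf_lin (sc i2)) (smf_lin (sc i3)); ring.
Qed.

Lemma sm_Kf : sm (Kf c x : V -> R^o) y.
Proof. by apply: sm_cd; [exact: smf_alf|exact: gauge_sm|exact: gauge_sm]. Qed.

Lemma cd_expand (b : V -> V -> R) v w : smf b y ->
  cd b y v w = cd b y (x i1 y) (x i2 y) * (c i1 y v * c i2 y w - c i1 y w * c i2 y v) +
   cd b y (x i2 y) (x i3 y) * (c i2 y v * c i3 y w - c i2 y w * c i3 y v) +
   cd b y (x i3 y) (x i1 y) * (c i3 y v * c i1 y w - c i3 y w * c i1 y v).
Proof.
move=> sb; apply: (alt2_expand (x := x ^~ y) (c := fun i => c i y)).
  exact: alt2_cd.
by move=> u; exact: gauge_expand.
Qed.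

(** 0 = d d c3 = d c1 /\ c2 - c1 /\ d c2, evaluated on the frame. *)
Lemma gauge_bianchi : str c x i1 i3 i1 y = str c x i2 i2 i3 y.
Proof.
have [sc sx du st] := g.
have s1 u : sm (fun z => c i1 z u : R^o) y by case: (sc i1).
have s2 u : sm (fun z => c i2 z u : R^o) y by case: (sc i2).
(* The vectors are constants here, so that only the coefficients of c1 /\ c2 are differentiated and
   no brackets of frame fields appear; the frame at y is inserted afterwards. *)
have H u v w : 'D_u (fun z => cd (c i3) z v w : R^o) y =
   c i1 y v * 'D_u (fun z => c i2 z w : R^o) y
   + c i2 y w * 'D_u (fun z => c i1 z v : R^o) y
   - (c i1 y w * 'D_u (fun z => c i2 z v : R^o) y
   + c i2 y v * 'D_u (fun z => c i1 z w : R^o) y).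
  rewrite -(D_mul u (s1 v) (s2 w)) -(D_mul u (s1 w) (s2 v)) -D_sub.
  - by apply: D_ext; apply: filterS st => z ->.
  - exact: sm_mul.
  - exact: sm_mul.
have := cd_cycle (x i1 y) (x i2 y) (x i3 y) (sc i3).
rewrite !H !gauge_dual !iE /str /cd /=.
move: ('D__ _ y) ('D__ _ y) ('D__ _ y) ('D__ _ y) => a1 a2 a3 a4.
rewrite !mul0r !mul1r !(add0r, addr0, subr0, sub0r) => H0.
apply/eqP; rewrite -subr_eq0 -H0; apply/eqP; ring.
Qed.

Lemma gauge_structure v w :
  cd (c i1) y v w = - (alf c x y v * c i1 y w - alf c x y w * c i1 y v)
    + str c x i1 i2 i3 y * (c i2 y v * c i3 y w - c i2 y w * c i3 y v) /\
  cd (c i2) y v w = (alf c x y v * c i2 y w - alf c x y w * c i2 y v)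
    + str c x i2 i3 i1 y * (c i3 y v * c i1 y w - c i3 y w * c i1 y v).
Proof.
rewrite (cd_expand v w (gauge_smf i1)) (cd_expand v w (gauge_smf i2)) /alf.
have b := gauge_bianchi; rewrite /str in b *; rewrite b.
move: (cd _ _ _ _) (cd _ _ _ _) (cd _ _ _ _) (cd _ _ _ _) (cd _ _ _ _).
move: (c _ _ _) (c _ _ _) (c _ _ _) (c _ _ _) (c _ _ _) (c _ _ _) => *.
split; ring.
Qed.

End Theory.

(** * Change of the contact form in coordinates *)

Section Rescale.
Variables (c : 'I_3 -> V -> V -> R) (x : 'I_3 -> V -> V) (f : V -> R^o).

Definition fd i (z : V) : R^o := 'D_(x i z) f z.
(* The coframe adapted to f * c^3: the multiples of c^3 in the first two forms absorb df /\ c^3. *)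
Definition rc i (z v : V) : R :=
  if i == i1 then f z * c i1 z v + (- fd i2 z) * c i3 z v
  else if i == i2 then c i2 z v + (fd i1 z / f z) * c i3 z v
  else f z * c i3 z v.
Definition rx i (z : V) : V :=
  if i == i1 then (f z)^-1 *: x i1 z
  else if i == i2 then x i2 z
  else (f z)^-1 *: (x i3 z + (fd i2 z / f z) *: x i1 z - (fd i1 z / f z) *: x i2 z).

Definition rcoef (z : V) : R^o :=
  - (fd i3 z / f z + fd i1 z * fd i2 z / f z ^+ 2 + 'D_(x i1 z) (fd i2) z / f z
     + fd i2 z / f z * str c x i2 i1 i2 z).

Variable y : V.
Hypotheses (g : gauge c x y) (sf : sm f y) (f0 : f y != 0).

Lemma sm_Dfield (k : V -> R^o) (X : V -> V) : sm k y -> sm X y ->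
  sm (fun z => 'D_(X z) k z : R^o) y.
Proof. by move=> sk sX; apply: (smf_var erefl (smf_d sk) (sm_id y) sX). Qed.

Lemma sm_fd i : sm (fd i) y.
Proof. by apply: sm_Dfield => //; exact: gauge_sm g i. Qed.

Lemma sm_finv : sm (fun z => (f z)^-1 : R^o) y.
Proof. exact: sm_inv. Qed.

Lemma sm_fdf i : sm (fun z => fd i z / f z : R^o) y.
Proof. by apply: sm_mul; [exact: sm_fd|exact: sm_finv]. Qed.

Lemma smf_rc i : smf (rc i) y.
Proof.
have s1 := gauge_smf g i1; have s2 := gauge_smf g i2; have s3 := gauge_smf g i3.
rewrite /rc; case: (i == i1); [|case: (i == i2)].
- by apply: smf_add; apply: smf_scale => //; apply/sm_opp/sm_fd.
- by apply: smf_add => //; apply: smf_scale => //; exact: sm_fdf.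
- exact: smf_scale.
Qed.

Lemma sm_scalef (k : V -> R^o) (X : V -> V) : sm k y -> sm X y ->
  sm (fun z => (k z : R) *: X z) y.
Proof.
move=> sk sX; apply: sm_fdc => j.
apply: (sm_ext (f := fun z => k z * fdc j (X z) : R^o)).
  by apply: near_all => z /=; rewrite linearZ.
by apply: sm_mul => //; apply: sm_comp_linear sX; exact: fdc_cont.
Qed.

Lemma sm_rx i : sm (rx i) y.
Proof.
have s1 := gauge_sm g i1; have s2 := gauge_sm g i2; have s3 := gauge_sm g i3.
rewrite /rx; case: (i == i1); [|case: (i == i2)].
- by apply: (sm_scalef sm_finv).
- exact: s2.
- apply: (sm_scalef sm_finv); apply: sm_sub; first apply: sm_add => //.
    exact: (sm_scalef (sm_fdf i2)).
  exact: (sm_scalef (sm_fdf i1)).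
Qed.

Lemma rc1 v : rc i1 y v = f y * c i1 y v + (- fd i2 y) * c i3 y v.
Proof. by rewrite /rc iE. Qed.
Lemma rc2 v : rc i2 y v = c i2 y v + (fd i1 y / f y) * c i3 y v.
Proof. by rewrite /rc !iE. Qed.
Lemma rc3 v : rc i3 y v = f y * c i3 y v.
Proof. by rewrite /rc !iE. Qed.
Lemma rx1 : rx i1 y = (f y)^-1 *: x i1 y.
Proof. by rewrite /rx iE. Qed.
Lemma rx2 : rx i2 y = x i2 y.
Proof. by rewrite /rx !iE. Qed.
Lemma rx3 : rx i3 y = (f y)^-1 *: (x i3 y + (fd i2 y / f y) *: x i1 y - (fd i1 y / f y) *: x i2 y).
Proof. by rewrite /rx !iE. Qed.

Lemma rdual : dual_at rc rx y.
Proof.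
have lc i : scalar (c i y) := smf_lin (gauge_smf g i).
have cx := gauge_dual g.
split.
  apply: ord3P; apply: ord3P; rewrite ?rx1 ?rx2 ?rx3 ?rc1 ?rc2 ?rc3;
  rewrite ?(scalZ (lc _)) ?(scalB (lc _)) ?(scalD (lc _)) ?(scalZ (lc _)) !cx !iE /=;
  move: (fd i1 y) (fd i2 y) f0; move: (f y) => F a1 a2 F0; field; rewrite ?F0//.
move=> v; apply: (gauge_inj g) => k; move: k; apply: ord3P;
  rewrite sum3 rx1 rx2 rx3 rc1 rc2 rc3;
  rewrite !(scalD (lc _)) !(scalZ (lc _)) !(scalB (lc _)) !(scalD (lc _)) !(scalZ (lc _)) !cx !iE /=;
  move: (c _ _ _) (c _ _ _) (c _ _ _) (fd i1 y) (fd i2 y) f0; move: (f y) => F k1 k2 k3 a1 a2 F0;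
  field; rewrite ?F0//.
Qed.

Lemma D_f i : 'D_(x i y) f y = fd i y. Proof. by []. Qed.

Lemma cd_rc1 v w : cd (rc i1) y v w = 'D_v f y * c i1 y w - 'D_w f y * c i1 y v
  + f y * cd (c i1) y v w
  - ('D_v (fd i2) y * c i3 y w - 'D_w (fd i2) y * c i3 y v + fd i2 y * cd (c i3) y v w).
Proof.
have s1 := gauge_smf g i1; have s3 := gauge_smf g i3.
have -> : rc i1 = (fun z u => f z * c i1 z u + (- fd i2 z) * c i3 z u).
  by apply/funext => z; apply/funext => u; rewrite /rc iE.
rewrite cd_add; [|exact: smf_scale|by apply: smf_scale => //; apply/sm_opp/sm_fd].
rewrite !cd_scale//; last by apply/sm_opp/sm_fd.
rewrite !D_opp; [|exact: sm_fd..].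
move: ('D__ _ y) ('D__ _ y) ('D__ _ y) ('D__ _ y) (cd _ _ _ _) (cd _ _ _ _) => *; ring.
Qed.

Lemma cd_rc2 v w : cd (rc i2) y v w = cd (c i2) y v w
  + ('D_v (fun z => fd i1 z / f z : R^o) y * c i3 y w
     - 'D_w (fun z => fd i1 z / f z : R^o) y * c i3 y v + fd i1 y / f y * cd (c i3) y v w).
Proof.
have s2 := gauge_smf g i2; have s3 := gauge_smf g i3; have sq := sm_fdf i1.
have -> : rc i2 = (fun z u => c i2 z u + (fd i1 z / f z) * c i3 z u).
  by apply/funext => z; apply/funext => u; rewrite /rc !iE.
by rewrite cd_add ?(cd_scale _ _ sq)//; exact: smf_scale.
Qed.

Lemma cd_rc3 v w : cd (rc i3) y v w = 'D_v f y * c i3 y w - 'D_w f y * c i3 y v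
  + f y * cd (c i3) y v w.
Proof.
have s3 := gauge_smf g i3.
have -> : rc i3 = (fun z u => f z * c i3 z u).
  by apply/funext => z; apply/funext => u; rewrite /rc !iE.
exact: cd_scale.
Qed.

Lemma Df_expand v : 'D_v f y = \sum_i c i y v * fd i y.
Proof.
rewrite {1}(gauge_expand g v) derive_linear//; exact: sm_diff.
Qed.

(** d (f c3) = df /\ c3 + f c1 /\ c2, where the f_3 term of df drops out; the remaining terms factor
    as the wedge product of the corrected first two forms. *)
Lemma rstruct v w : cd (rc i3) y v w = rc i1 y v * rc i2 y w - rc i1 y w * rc i2 y v.
Proof.
rewrite cd_rc3 (gauge_cd3 g) rc1 rc2 rc1 rc2 !Df_expand !sum3.
by move: (fd i1 y) (fd i2 y) (fd i3 y) f0; move: (f y) => F a1 a2 a3 F0; field.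
Qed.

Lemma rstr112 : str rc rx i1 i1 i2 y = str c x i1 i1 i2 y - 2 * fd i2 y / f y.
Proof.
rewrite /str rx1 rx2 (scalZ (cd_linl _ (smf_rc i1))) cd_rc1 !(gauge_cd3 g) !(gauge_dual g) !iE !D_f /=.
by move: (cd _ _ _ _) ('D__ _ y) ('D__ _ y) (fd i1 y) (fd i2 y) f0; move: (f y) => F c1 ? ? a1 a2 F0; field.
Qed.

Lemma rstr212 : str rc rx i2 i1 i2 y = (str c x i2 i1 i2 y + fd i1 y / f y) / f y.
Proof.
rewrite /str rx1 rx2 (scalZ (cd_linl _ (smf_rc i2))) cd_rc2 !(gauge_cd3 g) !(gauge_dual g) !iE /=.
by move: (cd _ _ _ _) ('D__ _ y) ('D__ _ y) (fd i1 y) f0; move: (f y) => F c1 ? ? a1 F0; field.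
Qed.

Lemma rstr131 : str rc rx i1 i3 i1 y = (f y ^+ 2)^-1 * (fd i3 y - 2 * fd i1 y * fd i2 y / f y
   + f y * str c x i1 i3 i1 y + fd i1 y * str c x i1 i1 i2 y + 'D_(x i1 y) (fd i2) y).
Proof.
have s1 := smf_rc i1.
have ll w := cd_linl w s1.
rewrite /str rx1 rx3 (scalZ (cd_linr _ s1)) (scalZ (ll _)) (scalB (ll _)) (scalD (ll _)) !(scalZ (ll _)).
rewrite !cd_rc1 !(gauge_cd3 g) !(gauge_dual g) !iE !D_f /= (cdC (c i1) y (x i2 y)).
rewrite (alt2_0 (x i1 y) (alt2_cd (gauge_smf g i1))).
by move: (cd _ _ _ _) (cd _ _ _ _) ('D__ _ y) ('D__ _ y) ('D__ _ y) (fd i1 y) (fd i2 y) (fd i3 y) f0;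
  move: (f y) => F c1 c2 ? ? ? a1 a2 a3 F0; field.
Qed.

(** The coefficients 1 and -2 are unequal because the factor f was put into the first form alone.
    The term df/(2f) coming from the fibre coordinate makes them 3/2 and -3/2. [rcoef] collects the
    c3-component. *)
Lemma ralf v : alf rc rx y v = alf c x y v + fd i1 y / f y * c i1 y v
  + (- 2 * (fd i2 y / f y)) * c i2 y v + rcoef y * c i3 y v.
Proof.
rewrite /alf rstr112 rstr212 rstr131 rc1 rc2 rc3 /rcoef.
move: (str _ _ _ _ _ _) (str _ _ _ _ _ _) (str _ _ _ _ _ _) (c _ _ _) (c _ _ _) (c _ _ _).
move: ('D__ _ _) (fd i1 y) (fd i2 y) (fd i3 y) f0; move: (f y) => F d a1 a2 a3 F0 *.
by field.
Qed.

End Rescale.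

Section Rescale2.
Variables (c : 'I_3 -> V -> V -> R) (x : 'I_3 -> V -> V) (f : V -> R^o) (y : V).
Hypotheses (g : gauge c x y) (sf : sm f y) (f0 : f y != 0).
Local Notation fd := (fd x f).
Local Notation rc := (rc c x f).
Local Notation rx := (rx x f).

Lemma near_rescale : \forall z \near y, [/\ gauge c x z, sm f z & f z != 0].
Proof. by apply: near_and3; [exact: gauge_near|exact: sm_near|exact: near_neq0 (sm_cont sf)]. Qed.

Lemma rgauge : gauge rc rx y.
Proof.
split=> [i|i||].
- exact: smf_rc.
- exact: sm_rx g sf f0 i.
- by apply: filterS near_rescale => z [? ? ?]; exact: rdual.
- by apply: filterS near_rescale => z [? ? ?] v w; exact: rstruct.
Qed.

Lemma sm_rcoef : sm (rcoef c x f) y.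
Proof.
have s1 := sm_fdf g sf f0 i1; have s2 := sm_fdf g sf f0 i2; have s3 := sm_fdf g sf f0 i3.
apply: sm_opp; apply: sm_add; [apply: sm_add; [apply: sm_add => //|]|].
- apply: sm_mul; first by apply: sm_mul; exact: (sm_fd g sf).
  by apply: (sm_inv (f := fun z => f z ^+ 2 : R^o)); [rewrite expf_neq0|apply: sm_mul].
- by apply: sm_mul; [apply: sm_Dfield; [exact: (sm_fd g sf)|exact: gauge_sm g i1]|exact: sm_finv].
- by apply: sm_mul => //; exact: sm_str.
Qed.

Lemma D_fdf i v : 'D_v (fun z => fd i z / f z : R^o) y =
  'D_v (fd i) y / f y - fd i y * 'D_v f y / f y ^+ 2.
Proof.
rewrite (D_mul _ (sm_fd g sf i) (sm_finv sf f0)) D_inv//.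
move: ('D__ _ y) ('D__ _ y) (fd i y) f0; move: (f y) => F a b d F0; by field.
Qed.

(** Differentiates [ralf] on (x1, x2); the factor f on the left compensates the 1/f in the first
    vector of [rx]. The derivative of [rcoef], of third order in f, is multiplied by c3 and vanishes
    there, while [rcoef] itself survives through d c3 (x1, x2) = 1. *)
Lemma rK : f y * Kf rc rx y = Kf c x y - 'D_(x i2 y) (fd i1) y / f y
  + 3 * (fd i1 y * fd i2 y / f y ^+ 2) + fd i1 y / f y * str c x i1 i1 i2 y
  - 2 * ('D_(x i1 y) (fd i2) y / f y) - 2 * (fd i2 y / f y) * str c x i2 i1 i2 y
  + rcoef c x f y.
Proof.
have sc i := gauge_smf g i; have s1 := sm_fdf g sf f0 i1; have s2 := sm_fdf g sf f0 i2.
have s2' : sm (fun z => - 2 * (fd i2 z / f z) : R^o) y by apply: sm_mul => //; exact: sm_cst.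
rewrite /Kf (rx1 x f y) (rx2 x f y) (scalZ (cd_linl _ (smf_alf rgauge))).
rewrite (cd_ext (b' := fun z v => alf c x z v + fd i1 z / f z * c i1 z v
  + (- 2 * (fd i2 z / f z)) * c i2 z v + rcoef c x f z * c i3 z v)); last first.
  by apply: filterS near_rescale => z [gz sz fz] v; exact: ralf.
have sa := smf_alf g.
have t1 := smf_scale s1 (sc i1); have t2 := smf_scale s2' (sc i2).
have t3 := smf_scale sm_rcoef (sc i3).
rewrite (cd_add _ _ (smf_add (smf_add sa t1) t2) t3) (cd_add _ _ (smf_add sa t1) t2).
rewrite (cd_add _ _ sa t1) (cd_scale _ _ s1 (sc i1)) (cd_scale _ _ s2' (sc i2)).
rewrite (cd_scale _ _ sm_rcoef (sc i3)) !(gauge_cd3 g) !(gauge_dual g) !iE /=.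
rewrite (D_mul _ (sm_cst (- 2 : R^o) y) s2) !D_cst !D_fdf.
rewrite !(D_f x f y) /str.
move: (rcoef c x f y) ('D_(x i1 y) (rcoef c x f) y) ('D_(x i2 y) (rcoef c x f) y).
move: ('D_(x i2 y) (fun z => - 2 * (fd i2 z / f z) : R^o) y).
move: ('D_(x i1 y) (fd i1) y) ('D_(x i2 y) (fd i1) y) ('D_(x i1 y) (fd i2) y).
move: (cd (alf c x) _ _ _) (cd (c i1) _ _ _) (cd (c i2) _ _ _) (fd i1 y) (fd i2 y) f0.
by move: (f y) => F c0 c1 c2 a1 a2 F0 *; field.
Qed.

(** d d f = 0 evaluated on (x1, x2). It trades the derivative of f_1 along x2, occurring in [rK],
    for the derivative of f_2 along x1, occurring in [rcoef]. *)
Lemma rd2 : 'D_(x i2 y) (fd i1) y = fd i1 y * str c x i1 i1 i2 y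
   + 'D_(x i1 y) (fd i2) y + fd i2 y * str c x i2 i1 i2 y + fd i3 y.
Proof.
have sc i := gauge_smf g i; have sd i := sm_fd g sf i.
have H := cd_d (x i1 y) (x i2 y) sf; move: H.
rewrite (cd_ext (b' := fun z v => fd i1 z * c i1 z v + fd i2 z * c i2 z v + fd i3 z * c i3 z v)); last first.
  by apply: filterS near_rescale => z [gz sz fz] v; rewrite (Df_expand gz sz) sum3 ![_ * fd _ _]mulrC.
have t i := smf_scale (sd i) (sc i).
rewrite (cd_add _ _ (smf_add (t i1) (t i2)) (t i3)) (cd_add _ _ (t i1) (t i2)).
rewrite !(cd_scale _ _ (sd _) (sc _)) !(gauge_cd3 g) !(gauge_dual g) !iE /= /str.
move: (cd (c i1) _ _ _) (cd (c i2) _ _ _).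
move: ('D_(x i1 y) (fd i1) y) ('D_(x i2 y) (fd i1) y) ('D_(x i1 y) (fd i2) y) ('D_(x i2 y) (fd i2) y).
move: ('D_(x i1 y) (fd i3) y) ('D_(x i2 y) (fd i3) y) (fd i1 y) (fd i2 y) (fd i3 y).
move=> a1 a2 a3 a4 a5 a6 a7 a8 a9 a10 a11 H.
apply/eqP; rewrite -subr_eq0; apply/eqP; rewrite -[RHS]oppr0 -[in RHS]H; ring.
Qed.

(** The corrections on the right are the ones that cancel against the terms produced by c1 . c2 in
    [rFeff]. After [rd2] the only second derivative left is that of f_2 along x1; it enters with
    weight 2/3 from the connection term and -4/6 from the curvature term. *)
Lemma rsigma th v : f y * sg rc rx y th v =
  f y * (sg c x y (th - 'D_v f y / (2 * f y)) v - fd i1 y / f y * c i1 y v + fd i2 y / f y * c i2 y v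
  + fd i1 y * fd i2 y / f y ^+ 2 * c i3 y v).
Proof.
rewrite /sg ralf// (Df_expand g sf) sum3 rc3.
rewrite (_ : 1 / 6 * Kf rc rx y * (f y * c i3 y v) = 1 / 6 * (f y * Kf rc rx y) * c i3 y v); last by ring.
rewrite rK /rcoef.
rewrite rd2 /str.
move: (alf c x y v) (Kf c x y) (cd (c i1) _ _ _) (cd (c i2) _ _ _) (c i1 y v) (c i2 y v) (c i3 y v).
move: ('D_(x i1 y) (fd i2) y) (fd i1 y) (fd i2 y) (fd i3 y) f0; move: (f y) => F d a1 a2 a3 F0 *.
by field.
Qed.

(* Multiplying the contact form by f multiplies the coordinate t of SD by |f|, so that
   th = tau / (2 t) is shifted by half the logarithmic derivative of f. *)
Lemma rFeff v th w th' : Feff rc rx y v th w th' =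
  f y * Feff c x y v (th - 'D_v f y / (2 * f y)) w (th' - 'D_w f y / (2 * f y)).
Proof.
have Ev := rsigma th v; have Ew := rsigma th' w.
rewrite /Feff rc1 rc2 rc3 rc1 rc2 rc3.
rewrite (_ : f y * c i3 y v * sg rc rx y th' w + sg rc rx y th v * (f y * c i3 y w) =
  c i3 y v * (f y * sg rc rx y th' w) + (f y * sg rc rx y th v) * c i3 y w); last by ring.
rewrite Ev Ew.
move: (sg _ _ _ _ _) (sg _ _ _ _ _) (c _ _ _) (c _ _ _) (c _ _ _) (c _ _ _) (c _ _ _) (c _ _ _).
move: (fd i1 y) (fd i2 y) f0; move: (f y) => F a1 a2 F0 *.
by field.
Qed.

End Rescale2.
End Gauge.

(** * Adapted coframes and the reduction B *)

Section TwoFormsPlane.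
Context {R : realType} {W : lmodType R}.
Variables (e : W -> R) (b : W -> W -> R) (Z X1 X2 : W).
Hypotheses (ab : alt2 b)
  (HZ : forall w, exists p q, w = e w *: Z + p *: X1 + q *: X2).

Lemma alt2_plane (p q p' q' c c' : R) :
  b (c *: Z + p *: X1 + q *: X2) (c' *: Z + p' *: X1 + q' *: X2) =
   c * p' * b Z X1 + c * q' * b Z X2 - p * c' * b Z X1 - q * c' * b Z X2 + (p * q' - p' * q) * b X1 X2.
Proof.
have lr := alt2r ab; have [ll aa] := ab.
rewrite !(scalD (ll _)) !(scalZ (ll _)) !(scalD (lr _)) !(scalZ (lr _)).
rewrite !(alt2_0 _ ab) (aa X1 Z) (aa X2 Z) (aa X2 X1).
by move: (b Z X1) (b Z X2) (b X1 X2) => *; ring.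
Qed.

(** X1 and X2 span a complement of Z; if b vanishes on this plane, then b is divisible by e, so that
    e /\ b = 0. *)
Lemma alt2_three : b X1 X2 = 0 -> forall v1 v2 v3,
  e v1 * b v2 v3 + e v2 * b v3 v1 + e v3 * b v1 v2 = 0.
Proof.
move=> b0 v1 v2 v3.
have [p1 [q1 E1]] := HZ v1; have [p2 [q2 E2]] := HZ v2; have [p3 [q3 E3]] := HZ v3.
rewrite [in b v2 v3]E2 [in b _ v3]E3 [in b v3 v1]E3 [in b _ v1]E1 [in b v1 v2]E1 [in b _ v2]E2 !alt2_plane b0.
by move: (b Z X1) (b Z X2) (e v1) (e v2) (e v3) => *; ring.
Qed.

(* On a 3-space a 2-form b satisfies b /\ b = 0. *)
Lemma alt2_plucker v w : b v w * b X1 X2 = b v X2 * b X1 w - b w X2 * b X1 v.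
Proof.
have [p1 [q1 E1]] := HZ v; have [p2 [q2 E2]] := HZ w.
have F1 : X1 = 0 *: Z + 1 *: X1 + 0 *: X2 by rewrite !scale0r scale1r add0r addr0.
have F2 : X2 = 0 *: Z + 0 *: X1 + 1 *: X2 by rewrite !scale0r scale1r !add0r.
rewrite [in b v w]E1 [in b _ w]E2 [in b v X2]E1 [in b X1 w]E2 [in b w X2]E2 [in b X1 v]E1.
rewrite [X in b _ X * _ - _]F2 [X in _ * b X _ - _]F1 [X in _ - b _ X * _]F2 [X in _ - _ * b X _]F1.
rewrite !alt2_plane.
by move: (b Z X1) (b Z X2) (b X1 X2) (e v) (e w) => *; ring.
Qed.

End TwoFormsPlane.

(** * Adapted coframes at a point *)

Section Pointwise.
Context {R : realType} {T : Type}.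
Local Notation V := 'rV[R]_3.
Variables (M : premanifold T V) (L1 L2 : T -> set V).
Hypothesis hM : path_geometry M L1 L2.

Lemma cM : charted M.
Proof. by case: hM => m _ _ _ _; exact: is_manifold_charted. Qed.

Lemma line_field_at L x : line_field M L -> pts M x ->
  exists X : V, X != 0 /\ L x = [set c *: X | c in setT].
Proof. by move=> H Mx; have [W [X [_ Wx _ /(_ _ Wx) ?]]] := H _ Mx; exists (X x). Qed.

Lemma DP x X1 X2 : X1 != 0 -> X2 != 0 -> L1 x = [set c *: X1 | c in setT] ->
  L2 x = [set c *: X2 | c in setT] -> pts M x ->
  (forall a b : R, a *: X1 + b *: X2 = 0 -> a = 0 /\ b = 0) /\
  D L1 L2 x = [set v | exists a b : R, v = a *: X1 + b *: X2].
Proof.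
move=> X10 X20 E1 E2 Mx; split=> [a b H|].
  have : (L1 x `&` L2 x) (a *: X1).
    by rewrite E1 E2; split; [exists a|exists (- b) => //; rewrite scaleNr; apply/esym/eqP; rewrite -addr_eq0 H].
  case: hM => _ _ _ /(_ _ Mx) -> _ /= /eqP; rewrite scaler_eq0 (negPf X10) orbF => /eqP a0.
  move: H; rewrite a0 scale0r add0r => /eqP; rewrite scaler_eq0 (negPf X20) orbF => /eqP //.
apply/seteqP; split=> v /=.
  by move=> [Y1 [Y2 []]]; rewrite E1 E2 => -[a _ <-] [b _ <-] ->; exists a, b.
move=> [a [b ->]]; exists (a *: X1), (b *: X2).
by split=> //; rewrite ?E1 ?E2; [exists a|exists b].
Qed.

Lemma dform_alt2 (U : set T) eta x : mopen M U -> is_form1 M U eta -> U x -> alt2 (dform M eta x).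
Proof.
move=> oU fe Ux; have Mx : pts M x by case: oU => + _; apply.
have [a0 r0] := patch_atP cM Mx; have [d0 e0] := coord_rng r0.
have Ux' : U (par (patch_at M x) (coord (patch_at M x) x)) by rewrite e0.
exact: (alt2_cd (form1_smf cM oU fe a0 d0 Ux')).
Qed.

(** If d eta vanished on D = ker eta, then eta /\ d eta would vanish by [alt2_three], against the
    contact condition. The vector Z completes a frame of D to a frame of the tangent space. *)
Lemma contact_nondeg U eta x X1 X2 : contact_form M L1 L2 U eta -> U x ->
  D L1 L2 x = [set v | exists a b : R, v = a *: X1 + b *: X2] ->
  dform M eta x X1 X2 != 0 /\ exists Z, eta x Z = 1 /\
  forall v, exists a b, v = eta x v *: Z + a *: X1 + b *: X2.
Proof.
move=> [oU fe nd ke] Ux eD; have [v1 [v2 [v3 H]]] := nd _ Ux.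
have le : scalar (eta x) by case: fe => + _; apply.
have [v ev] : exists v, eta x v != 0.
  apply: contrapT => /forallNP F; move/eqP: H; apply.
  have e0 w : eta x w = 0 by apply/eqP; have /negP := F w; rewrite negbK.
  rewrite (e0 v1) (e0 v2) (e0 v3).
  by move: (dform M eta x v2 v3) (dform M eta x v3 v1) (dform M eta x v1 v2) => *; ring.
pose Z := (eta x v)^-1 *: v.
have eZ : eta x Z = 1 by rewrite /Z (scalZ le) mulVf.
have HZ w : exists a b, w = eta x w *: Z + a *: X1 + b *: X2.
  have : D L1 L2 x (w - eta x w *: Z).
    by apply/(ke _ Ux); rewrite (scalB le) (scalZ le) eZ mulr1 subrr.
  rewrite eD => -[a [b E]]; exists a, b.
  by rewrite -addrA -E addrC subrK.
split; last by exists Z.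
apply/eqP => d0; move/eqP: H; apply.
exact: (alt2_three (dform_alt2 oU fe Ux) HZ d0).
Qed.

Lemma ker_unitmx n (A : 'M[R]_n) : (forall v : 'rV[R]_n, v *m A = 0 -> v = 0) -> A \in unitmx.
Proof. by move=> H; rewrite -row_free_unit; apply: inj_row_free. Qed.

Lemma rho_mul (s t : R) : rho s *m rho t = rho (s * t).
Proof.
rewrite /rho mulmx_diag; congr diag_mx; apply/rowP; case=> -[|[|[|//]]] Hi; rewrite !mxE //=.
  by rewrite invfM.
by rewrite mulr1.
Qed.

Lemma rho1 : rho (1 : R) = 1%:M.
Proof.
rewrite /rho -diag_const_mx; congr diag_mx; apply/rowP; case=> -[|[|[|//]]] Hi; rewrite !mxE //=.
by rewrite invr1.
Qed.

Lemma rhoV (s : R) : s != 0 -> rho s *m rho s^-1 = 1%:M.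
Proof. by move=> s0; rewrite rho_mul mulfV// rho1. Qed.

Lemma rho_unit (s : R) : s != 0 -> rho s \in unitmx.
Proof. by move=> /rhoV /mulmx1_unit []. Qed.

Lemma rho_entry (s : R) (u : 'rV[R]_3) i : (u *m rho s) 0 i = u 0 i * [:: s^-1; s; 1]`_i.
Proof. by rewrite /rho mul_mx_diag !mxE. Qed.

Lemma rho_e1 (s : R) (u : 'rV[R]_3) : (u *m rho s) 0 i1 = u 0 i1 / s.
Proof. by rewrite rho_entry i1v. Qed.
Lemma rho_e2 (s : R) (u : 'rV[R]_3) : (u *m rho s) 0 i2 = s * u 0 i2.
Proof. by rewrite rho_entry mulrC i2v. Qed.
Lemma rho_e3 (s : R) (u : 'rV[R]_3) : (u *m rho s) 0 i3 = u 0 i3.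
Proof. by rewrite rho_entry i3v /= mulr1. Qed.

Section Adapted.
Variables (U : set T) (eta : T -> V -> R).
Hypothesis ce : contact_form M L1 L2 U eta.
Local Notation Bs := (Bset M L1 L2 U eta).

Definition cc (u : 'M[R]_3) (i : 'I_3) (v : V) : R := (v *m u) 0 i.
(** Vectors are rows and covectors columns, so the frame dual to the columns of u consists of the
    rows of the inverse matrix. *)
Definition xi (u : 'M[R]_3) (i : 'I_3) : V := row i (invmx u).

Lemma cc_lin u i : scalar (cc u i).
Proof. by move=> a v w; rewrite /cc mulmxDl -scalemxAl !mxE. Qed.

Lemma cc_xi u i j : u \in unitmx -> cc u j (xi u i) = (i == j)%:R.
Proof. by move=> uu; rewrite /cc /xi -row_mul mulVmx// !mxE. Qed.

Lemma xi_expand u v : u \in unitmx -> v = \sum_i cc u i v *: xi u i.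
Proof. by move=> uu; rewrite -[LHS](mulmxK uu) mulmx_sum_row. Qed.

Lemma BsetP x u : Bs (x, u) -> [/\ U x /\ u \in unitmx, (forall v, cc u i3 v = eta x v),
  (forall v w, dform M eta x v w = cc u i1 v * cc u i2 w - cc u i1 w * cc u i2 v),
  (forall v, L2 x v -> cc u i1 v = 0) & (forall v, L1 x v -> cc u i2 v = 0)].
Proof. by []. Qed.

Lemma U_pts x : U x -> pts M x.
Proof. by case: ce => [[+ _] _ _ _]; apply. Qed.

(** A vector of L1 is killed by u^2, by adaptedness, and by u^3 = eta, whose kernel contains L1;
    hence it is a multiple of the first dual vector. Likewise for L2. *)
Lemma Bset_lines x u : Bs (x, u) -> L1 x = [set c *: xi u i1 | c in setT] /\
  L2 x = [set c *: xi u i2 | c in setT].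
Proof.
move=> Bu; have [[Ux uu] H3 Hd H1 H2] := BsetP Bu; have Mx := U_pts Ux.
have [_ l1 l2 _ _] := hM; have [_ _ _ kD] := ce.
have [X1 [X10 E1]] := line_field_at l1 Mx; have [X2 [X20 E2]] := line_field_at l2 Mx.
have LX1 : L1 x X1 by rewrite E1; exists 1; rewrite ?scale1r.
have LX2 : L2 x X2 by rewrite E2; exists 1; rewrite ?scale1r.
have z1 : eta x X1 = 0.
  by apply/(kD _ Ux); exists X1, 0; split; rewrite ?addr0// E2; exists 0; rewrite ?scale0r.
have z2 : eta x X2 = 0.
  by apply/(kD _ Ux); exists 0, X2; split; rewrite ?add0r// E1; exists 0; rewrite ?scale0r.
have F1 : X1 = cc u i1 X1 *: xi u i1.
  by rewrite {1}(xi_expand X1 uu) sum3 H2// H3 z1 !scale0r !addr0.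
have F2 : X2 = cc u i2 X2 *: xi u i2.
  by rewrite {1}(xi_expand X2 uu) sum3 H1// H3 z2 !scale0r add0r addr0.
have n1 : cc u i1 X1 != 0 by apply: contraNneq X10 => c0; rewrite F1 c0 scale0r.
have n2 : cc u i2 X2 != 0 by apply: contraNneq X20 => c0; rewrite F2 c0 scale0r.
have G1 : xi u i1 = (cc u i1 X1)^-1 *: X1 by rewrite -[LHS]scale1r -(mulVf n1) -scalerA -F1.
have G2 : xi u i2 = (cc u i2 X2)^-1 *: X2 by rewrite -[LHS]scale1r -(mulVf n2) -scalerA -F2.
split; rewrite ?E1 ?E2; apply/seteqP; split=> v [c _ <-].
- by exists (c * cc u i1 X1); rewrite // -scalerA -F1.
- by exists (c / cc u i1 X1); rewrite // -scalerA -G1.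
- by exists (c * cc u i2 X2); rewrite // -scalerA -F2.
- by exists (c / cc u i2 X2); rewrite // -scalerA -G2.
Qed.

Lemma xi_L1 x u : Bs (x, u) -> L1 x = [set c *: xi u i1 | c in setT].
Proof. by move=> /Bset_lines []. Qed.

Lemma xi_L2 x u : Bs (x, u) -> L2 x = [set c *: xi u i2 | c in setT].
Proof. by move=> /Bset_lines []. Qed.

Lemma Bset_D x u : Bs (x, u) -> (forall a b : R, a *: xi u i1 + b *: xi u i2 = 0 -> a = 0 /\ b = 0) /\
  D L1 L2 x = [set v | exists a b : R, v = a *: xi u i1 + b *: xi u i2].
Proof.
move=> Bu; have [[Ux uu] _ _ _ _] := BsetP Bu.
apply: DP; [| |exact: xi_L1|exact: xi_L2|exact: U_pts].
  by apply/eqP => H; have := cc_xi i1 i1 uu; rewrite H /cc mul0mx mxE iE => /eqP; rewrite eq_sym oner_eq0.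
by apply/eqP => H; have := cc_xi i2 i2 uu; rewrite H /cc mul0mx mxE iE => /eqP; rewrite eq_sym oner_eq0.
Qed.

Lemma Bset_xi x u : Bs (x, u) -> [/\ L1 x (xi u i1), L2 x (xi u i2),
  eta x (xi u i1) = 0, eta x (xi u i2) = 0 & dform M eta x (xi u i1) (xi u i2) = 1].
Proof.
move=> Bu; have [[Ux uu] H3 Hd H1 H2] := BsetP Bu; split.
- by rewrite (xi_L1 Bu); exists 1; rewrite ?scale1r.
- by rewrite (xi_L2 Bu); exists 1; rewrite ?scale1r.
- by rewrite -H3 cc_xi// iE.
- by rewrite -H3 cc_xi// iE.
- by rewrite Hd !cc_xi// !iE /= mulr0 subr0 mulr1.
Qed.

(** On D the forms u'^1 and u'^2 are multiples of u^1 and u^2, with product of the factors equal to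
    1 by d eta. The vector [xi u i3] is the Reeb direction, in the kernel of d eta; pairing it with
    D under d eta shows that u'^1 and u'^2 vanish on it too. *)
Lemma Bset_torsor x u u' : Bs (x, u) -> Bs (x, u') -> exists s : R, s != 0 /\ u' = u *m rho s.
Proof.
move=> Bu Bu'; have [[Ux uu] H3 Hd H1 H2] := BsetP Bu.
have [[_ uu'] H3' Hd' H1' H2'] := BsetP Bu'.
have [l1 l2 e1 e2 d12] := Bset_xi Bu.
have z12 : cc u' i1 (xi u i2) = 0 by exact: H1'.
have z21 : cc u' i2 (xi u i1) = 0 by exact: H2'.
have p1 : cc u' i1 (xi u i1) * cc u' i2 (xi u i2) = 1.
  by move: d12; rewrite Hd' z12 mul0r subr0.
have n1 : cc u' i1 (xi u i1) != 0 by apply/eqP => z; move/eqP: p1; rewrite z mul0r eq_sym oner_eq0.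
have n2 : cc u' i2 (xi u i2) != 0 by apply/eqP => z; move/eqP: p1; rewrite z mulr0 eq_sym oner_eq0.
have q1 : cc u' i1 (xi u i3) = 0.
  have : dform M eta x (xi u i3) (xi u i2) = 0 by rewrite Hd !cc_xi// !iE /= mul0r mulr0 subr0.
  by rewrite Hd' z12 mul0r subr0 => /eqP; rewrite mulf_eq0 (negPf n2) orbF => /eqP.
have q2 : cc u' i2 (xi u i3) = 0.
  have : dform M eta x (xi u i1) (xi u i3) = 0 by rewrite Hd !cc_xi// !iE /= mulr0 mul0r subr0.
  by rewrite Hd' z21 mulr0 subr0 => /eqP; rewrite mulf_eq0 (negPf n1) => /eqP.
pose s := cc u' i2 (xi u i2); exists s; split=> //.
have s1 : cc u' i1 (xi u i1) = s^-1 by apply: (mulIf n2); rewrite p1 mulVf.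
have E (v : V) : v *m u' = v *m (u *m rho s).
  apply/rowP; apply: ord3P; rewrite mulmxA ?rho_e1 ?rho_e2 ?rho_e3 -!/(cc _ _ v).
  - rewrite {1}(xi_expand v uu) sum3 !(scalD (cc_lin _ _)) !(scalZ (cc_lin _ _)) z12 q1 s1.
    by rewrite !mulr0 !addr0.
  - rewrite {1}(xi_expand v uu) sum3 !(scalD (cc_lin _ _)) !(scalZ (cc_lin _ _)) z21 q2.
    by rewrite !mulr0 add0r addr0 mulrC.
  - by rewrite H3 H3'.
by apply/row_matrixP => i; rewrite !rowE E.
Qed.

Lemma Bset_act x u s : s != 0 -> Bs (x, u) -> Bs (x, u *m rho s).
Proof.
move=> s0 Bu; have [[Ux uu] H3 Hd H1 H2] := BsetP Bu; split; rewrite ?mulmxA.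
- by rewrite unitmx_mul uu rho_unit.
- by move=> v; rewrite mulmxA rho_e3; exact: H3.
- move=> v w; rewrite !mulmxA !rho_e1 !rho_e2 Hd /cc.
  by move: s0 (_ 0 _) (_ 0 _) (_ 0 _) (_ 0 _) => s0 a b c d; field.
- by move=> v /H1 H; rewrite mulmxA rho_e1 (_ : (v *m u) 0 i1 = 0)// mul0r.
- by move=> v /H2 H; rewrite mulmxA rho_e2 (_ : (v *m u) 0 i2 = 0)// mulr0.
Qed.

End Adapted.
End Pointwise.

(** * Charts of G-structures *)

Section Gstruct.
Context {R : realType} {T : Type}.
Local Notation V := 'rV[R]_3.
Variables (M : premanifold T V) (cM : charted M).

(** The matrix of the coframe in the fixed chart P. The matrix e p itself refers to the chart chosen
    at p and may jump with p, whereas [Em P e] is smooth. *)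
Definition Em (P : patch T V) (e : T -> 'M[R]_3) (y : V) : 'M[R]_3 :=
  \matrix_(i, j) cmp j e (par P y) (dpatch M P y (delta_mx 0 i)).

Lemma Em_mul P e y (v : V) : atlas M P -> dom P y ->
  v *m Em P e y = dpatch M P y v *m e (par P y).
Proof.
move=> aP Py.
have lc j : scalar (fun u : V => cmp j e (par P y) (dpatch M P y u)).
  by move=> a u w; rewrite (dpatch_lin cM a u w aP Py); exact: cc_lin.
apply/rowP => j; rewrite mxE -/(cmp j e (par P y) (dpatch M P y v)).
rewrite [in RHS](row_sum_delta v) (scal_sum (lc j)); apply: eq_bigr => i _.
by rewrite (scalZ (lc j)) mxE.
Qed.

Definition xf (P : patch T V) (e : T -> 'M[R]_3) (i : 'I_3) (y : V) : V :=
  tcoord M P (par P y) (xi (e (par P y)) i).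

Lemma Em_xf P e y : atlas M P -> dom P y -> e (par P y) \in unitmx ->
  (\matrix_i xf P e i y) *m Em P e y = 1%:M.
Proof.
move=> aP Py ue; apply/row_matrixP => i.
by rewrite row_mul rowK Em_mul// /xf (tcoordK cM)// /xi -row_mul mulVmx.
Qed.

Lemma Em_unit P e y : atlas M P -> dom P y -> e (par P y) \in unitmx -> Em P e y \in unitmx.
Proof. by move=> aP Py ue; have /mulmx1_unit [] := Em_xf aP Py ue. Qed.

Lemma Em_inv P e y : atlas M P -> dom P y -> e (par P y) \in unitmx ->
  invmx (Em P e y) = \matrix_i xf P e i y.
Proof.
move=> aP Py ue; have uE := Em_unit aP Py ue.
by apply: (can_inj (mulmxK uE)); rewrite mulVmx// Em_xf.
Qed.

(** The matrix relating two coframes at the same point does not depend on the chart, so it can be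
    computed from the smooth matrices [Em]. *)
Lemma Em_change P e e' y : atlas M P -> dom P y -> e (par P y) \in unitmx ->
  invmx (Em P e y) *m Em P e' y = invmx (e (par P y)) *m e' (par P y).
Proof.
move=> aP Py ue; rewrite Em_inv//; apply/row_matrixP => i.
by rewrite row_mul rowK Em_mul// /xf (tcoordK cM)// /xi -row_mul.
Qed.

Lemma sm_Em P e O y : mopen M O -> coframe_on M O e -> atlas M P -> dom P y -> O (par P y) ->
  sm (Em P e) y.
Proof.
move=> oO [_ fe] aP Py Oy; apply: sm_mx => i j.
have [+ _] := form1_smf cM oO (fe j) aP Py Oy; move=> /(_ (delta_mx 0 i)).
by apply: sm_ext; apply: near_all => z; rewrite mxE.
Qed.

Variables (A : normedModType R) (fA : findim A) (S : set A) (rho : A -> 'M[R]_3)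
  (r : {linear 'M[R]_3 -> A}) (Z : set (T * 'M[R]_3)).
Hypotheses (oS : open S) (cr : continuous r) (rK : forall s, S s -> r (rho s) = s)
  (sr : forall s, S s -> sm rho s)
  (ZM : forall p, Z p -> pts M p.1 /\ p.2 \in unitmx)
  (Zact : forall x u s, Z (x, u) -> S s -> Z (x, u *m rho s))
  (Ztor : forall x u u', Z (x, u) -> Z (x, u') -> exists s, S s /\ u' = u *m rho s).
Local Notation G := (Gstructure M S rho Z).

Definition gdata P (W : set V) (e : T -> 'M[R]_3) := [/\ atlas M P, open W /\ W `<=` dom P,
  coframe_on M (par P @` W) e & forall x, (par P @` W) x -> Z (x, e x)].
Definition gpatch (P : patch T V) (W : set V) (e : T -> 'M[R]_3) : patch (T * 'M[R]_3)%type (V * A)%type :=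
  Patch [set z : V * A | W z.1 /\ S z.2] (fun z => (par P z.1, e (par P z.1) *m rho z.2)).

Hypothesis Zcov : forall p, Z p -> exists P W e, gdata P W e /\ (par P @` W) p.1.

Lemma gatlas P W e : gdata P W e -> atlas G (gpatch P W e).
Proof. by move=> [? ? ? ?]; exists P, W, e. Qed.

Lemma gdata_mopen P W e : gdata P W e -> mopen M (par P @` W).
Proof. by move=> [aP [oW WP] _ _]; exact: mopen_par. Qed.

Lemma gcoord P W e p : gdata P W e -> Z p -> (par P @` W) p.1 ->
  rng (gpatch P W e) p /\ coord (gpatch P W e) p = (coord P p.1, r (invmx (e p.1) *m p.2)).
Proof.
move=> [aP [oW WP] [ue _] Ze] Zp; case: p Zp => x u /= Zp [y Wy xy].
have Wx : (par P @` W) x by exists y.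
have [s [Ss us]] := Ztor (Ze _ Wx) Zp.
have Rp : rng (gpatch P W e) (x, u) by exists (y, s) => //=; rewrite xy -us.
split=> //; have [[/= Wd Sd] Ed] := coord_rng Rp; move: Ed.
case: (coord (gpatch P W e) (x, u)) Wd Sd => z t /= Wz St [Ez Eu].
rewrite -Ez (coordK cM aP (WP _ Wz)); congr pair.
by rewrite -Eu Ez mulKmx ?rK//; exact: ue.
Qed.

Lemma gdata_Z P W e z : gdata P W e -> W z.1 -> S z.2 ->
  Z (par P z.1, e (par P z.1) *m rho z.2).
Proof. by move=> [_ _ _ Ze] Wz Sz; apply: Zact => //; apply: Ze; exists z.1. Qed.

Lemma gchart P W e : gdata P W e -> [/\ open (dom (gpatch P W e)),
  {in dom (gpatch P W e) &, injective (par (gpatch P W e))} & rng (gpatch P W e) `<=` Z].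
Proof.
move=> gd; have [aP [oW WP] [ue _] Ze] := gd; split.
- apply: openI.
    by apply: (open_comp (f := fst)) => // z _; exact: cvg_fst.
  by apply: (open_comp (f := snd)) => // z _; exact: cvg_snd.
- move=> [y s] [y' s']; rewrite !inE /= => -[Wy Ss] [Wy' Ss'] [Ey Es].
  have yy : y = y' by rewrite -(coordK cM aP (WP _ Wy)) Ey (coordK cM aP (WP _ Wy')).
  subst y'; congr pair; rewrite -(rK Ss) -(rK Ss'); congr (r _).
  have uy : e (par P y) \in unitmx by apply: ue; exists y.
  by apply: (can_inj (mulKmx uy)); rewrite /= Es.
- by move=> p [z [Wz Sz] <-]; exact: (gdata_Z gd).
Qed.

Lemma gtrans P W e P' W' e' (z : V * A) : gdata P W e -> gdata P' W' e' -> W z.1 -> S z.2 ->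
  (par P' @` W') (par P z.1) ->
  (\forall w \near z, [/\ W w.1, S w.2 & (par P' @` W') (par P w.1)]) /\
  sm (coord (gpatch P' W' e') \o par (gpatch P W e)) z.
Proof.
move=> gd gd' Wz Sz Pz; have [aP [oW WP] ce _] := gd; have [aP' [oW' WP'] ce' _] := gd'.
have s1 : sm (fst : V * A -> V) z by exact: sm_fst.
have n1 : \forall w \near z, W w.1 by exact: (sm_near_comp (P := W) s1 (near_open oW Wz)).
have n2 : \forall w \near z, S w.2.
  exact: (sm_near_comp (P := S) (sm_snd z) (near_open oS Sz)).
have n3 : \forall w \near z, (par P' @` W') (par P w.1).
  have := mopen_near (gdata_mopen gd') aP (WP _ Wz) Pz.
  move=> /(sm_near_comp (P := fun y => dom P y /\ (par P' @` W') (par P y)) s1).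
  by apply: filterS => w [].
have n := near_and3 n1 n2 n3; split=> //.
have Rz : rng P' (par P z.1) by have [y' Wy' <-] := Pz; apply/rng_par/WP'.
(* The new fibre coordinate is r of e'^-1 e rho(s), and [Em_change] writes e'^-1 e in terms of
   smooth matrices. *)
apply: (@sm_ext R (V * A)%type (V * A)%type (fun w => ((coord P' \o par P) w.1,
   r (invmx (Em P e' w.1) *m Em P e w.1 *m rho w.2)))).
  apply: filterS n => w [Ww Sw Pw] /=.
  have [_ ->] := gcoord gd' (gdata_Z gd Ww Sw) Pw.
  by rewrite Em_change ?mulmxA//; [exact: WP|case: ce' => + _; apply].
have Oz : (par P @` W) (par P z.1) by exists z.1.
apply: sm_pair; first by apply: (sm_comp (g := coord P' \o par P) s1); exact: (trans_sm cM aP aP' (WP _ Wz) Rz).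
apply: (sm_comp_linear (L := r)) => //; apply: sm_mulmx; last first.
  by apply: (sm_comp (g := rho) (sm_snd z)); exact: sr.
have sE' : sm (fun w : V * A => Em P e' w.1) z.
  by apply: (sm_comp (g := Em P e') s1); apply: (sm_Em (gdata_mopen gd')) => //; exact: WP.
have sE : sm (fun w : V * A => Em P e w.1) z.
  by apply: (sm_comp (g := Em P e) s1); apply: (sm_Em (gdata_mopen gd)) => //; exact: WP.
apply: sm_mulmx => //; apply: sm_invmx => //.
by apply: Em_unit => //; [exact: WP|case: ce' => + _; apply].
Qed.

Lemma gstruct_charted : charted G.
Proof.
split.
- by move=> Q [P [W [e [aP oW ce Ze ->]]]]; apply: (@gchart P W e).
- move=> p Zp; have [P [W [e [gd Wp]]]] := Zcov Zp.
  by exists (gpatch P W e); [exact: gatlas|have [] := gcoord gd Zp Wp].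
- move=> Q Q' [P [W [e [aP oW ce Ze ->]]]] [P' [W' [e' [aP' oW' ce' Ze' ->]]]].
  have gd : gdata P W e by []. have gd' : gdata P' W' e' by [].
  rewrite -!/(gpatch _ _ _).
  have H (z : V * A) : (dom (gpatch P W e) `&` par (gpatch P W e) @^-1` rng (gpatch P' W' e')) z ->
     [/\ W z.1, S z.2 & (par P' @` W') (par P z.1)].
    by move=> [[Wz Sz] [w [Ww _] [Ew _]]]; split=> //; exists w.1.
  split; last by apply: smooth_on_sm => z /H [Wz Sz Pz]; case: (gtrans gd gd' Wz Sz Pz).
  rewrite openE => z /H [Wz Sz Pz]; case: (gtrans gd gd' Wz Sz Pz) => + _.
  apply: filterS => w [Ww Sw Pw]; split=> //.
  by have [] := gcoord gd' (gdata_Z gd Ww Sw) Pw.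
Qed.

Lemma gstruct_fst P W e z : gdata P W e -> W z.1 -> S z.2 ->
  smooth_at G M fst (par (gpatch P W e) z).
Proof.
move=> gd Wz Sz; have [aP [oW WP] _ _] := gd.
exists (gpatch P W e), P, z; split=> //; first exact: gatlas.
have n1 : \forall w \near z, W w.1.
  exact: (sm_near_comp (P := W) (sm_fst z) (near_open oW Wz)).
split; first by apply: filterS n1 => w Ww; apply/rng_par/WP.
apply: (sm_ext _ (sm_fst z)); apply: filterS n1 => w Ww /=.
by rewrite (coordK cM aP)//; exact: WP.
Qed.

End Gstruct.

Section Restriction.
Context {R : realType} {T : Type} {E : normedModType R} {fE : findim E}.
Variables (N : premanifold T E).

Lemma smooth_on_sub (V W : normedModType R) (U U' : set V) (f : V -> W) :
  U' `<=` U -> smooth_on U f -> smooth_on U' f.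
Proof. by move=> s H k; exact: Ck_sub (H k). Qed.

Lemma smooth_field_sub (O O' : set T) X : O' `<=` O -> smooth_field N O X -> smooth_field N O' X.
Proof. by move=> s H P aP; apply: smooth_on_sub (H P aP) => z [Pz Oz]; split=> //; exact: s. Qed.

Lemma form1_sub (O O' : set T) a : O' `<=` O -> is_form1 N O a -> is_form1 N O' a.
Proof.
move=> s [l H]; split=> [p /s/l//|P aP v].
by apply: smooth_on_sub (H P aP v) => z [Pz Oz]; split=> //; exact: s.
Qed.

Lemma smooth_fun_sub (O O' : set T) f : O' `<=` O -> smooth_fun N O f -> smooth_fun N O' f.
Proof. by move=> s H P aP; apply: smooth_on_sub (H P aP) => z [Pz Oz]; split=> //; exact: s. Qed.

Lemma smf_cdl (b : E -> E -> R) (X : E -> E) y : smf b y -> sm X y ->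
  smf (fun z u => cd b z u (X z)) y.
Proof.
move=> sb sX; split=> [u|]; first by apply: sm_cd => //; exact: sm_cst.
by apply: filterS (smf_near sb) => z sz; exact: cd_linl.
Qed.

Lemma smf_cdr (b : E -> E -> R) (X : E -> E) y : smf b y -> sm X y ->
  smf (fun z u => cd b z (X z) u) y.
Proof.
move=> sb sX; split=> [u|]; first by apply: sm_cd => //; exact: sm_cst.
by apply: filterS (smf_near sb) => z sz; exact: cd_linr.
Qed.
End Restriction.

(* The index type bool * bool: four charts cover SD over a small open set of M. *)
Section FibredManifold.
Context {R : realType} {T X : Type} {E F : normedModType R} {fE : findim E} {fF : findim F}.
Variables (M : premanifold T E) (N : premanifold (T * X)%type F).
Hypotheses (mM : is_manifold M) (cN : charted N)
  (projN : forall O, mopen M O -> mopen N [set p | pts N p /\ O p.1])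
  (ptsN : forall p, pts N p -> pts M p.1)
  (fibN : forall p q, pts N p -> pts N q -> p.1 = q.1 -> p <> q ->
    exists O O' : set (T * X), [/\ mopen N O, mopen N O', O p, O' q & O `&` O' = set0])
  (locN : forall p, pts N p -> exists O, [/\ mopen M O, O p.1 &
    exists Q : bool * bool -> patch (T * X)%type F,
      forall q, pts N q -> O q.1 -> exists j, atlas N (Q j) /\ rng (Q j) q]).

(** Two points of one fibre are separated by [fibN], any others by preimages of open sets of M. For
    countability, each set of a countable base of M over which four charts suffice contributes such
    a quadruple. *)
Lemma fibred_manifold : is_manifold N.
Proof.
have [n1 n2 n3] := cN; have [_ _ _ sM [b [ob Hb]]] := mM.
split=> //.
  move=> p q Np Nq pq; have [e|ne] := pselect (p.1 = q.1); first exact: fibN.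
  have [A [A' [oA oA' Ap Aq AA]]] := sM _ _ (ptsN Np) (ptsN Nq) ne.
  exists [set p | pts N p /\ A p.1], [set p | pts N p /\ A' p.1]; split=> //; try exact: projN.
  apply/seteqP; split=> // r [[_ Or] [_ Or']].
  by have : (A `&` A') r.1 by []; rewrite AA.
(* [QQ] needs a point as the default value of a parametrisation, hence the separate case of an empty
   N. *)
have [[p0 Np0]|/forallNP noN] := pselect (exists p, pts N p); last first.
  exists (fun=> set0); split=> [_|O p [ON _] /ON /noN //].
  split=> // P aP; rewrite (_ : _ `&` _ = set0); first exact: open0.
  by apply/seteqP; split => z // [].
pose cov n (Q : bool * bool -> patch (T * X)%type F) :=
  forall q, pts N q -> b n q.1 -> exists j, atlas N (Q j) /\ rng (Q j) q.
pose QQ (i : nat * (bool * bool)) : patch (T * X)%type F :=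
  match pselect (exists Q, cov i.1 Q) with
  | left h => projT1 (cid h) i.2
  | right _ => Patch set0 (fun=> p0)
  end.
apply: (countable_base cN (Q := QQ)); first exact: findim_countable_base.
move=> p Np; have [A [oA Ap [Q HQ]]] := locN Np.
have [n [bn bA]] := Hb _ _ oA Ap.
have cn : exists Q, cov n Q by exists Q => q Nq /bA; exact: HQ.
have [j [aj rj]] : exists j, atlas N (QQ (n, j)) /\ rng (QQ (n, j)) p.
  rewrite /QQ /=; case: pselect => [h|//]; case: (cid h) => Q' /= cQ'; exact: cQ'.
by exists (n, j).
Qed.

End FibredManifold.

Lemma plucker_div {R : realType} (d k a b c e : R) : k != 0 -> d * k = a * b - c * e ->
  d = a * (k^-1 * b) - c * (k^-1 * e).
Proof. by move=> k0 H; apply: (mulIf k0); rewrite H; field. Qed.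

(** * Existence of local adapted coframes *)

Section LocalCoframe.
Context {R : realType} {T : Type}.
Local Notation V := 'rV[R]_3.
Variables (M : premanifold T V) (L1 L2 : T -> set V).
Hypothesis hM : path_geometry M L1 L2.
Let cM := cM hM.

Lemma local_frames (U : set T) x : mopen M U -> U x ->
  exists (P : patch T V) (W : set V) (X1 X2 : T -> V),
    [/\ [/\ atlas M P, open W, W `<=` dom P, (par P @` W) x & par P @` W `<=` U],
      smooth_field M (par P @` W) X1, smooth_field M (par P @` W) X2 &
      forall z, (par P @` W) z -> [/\ X1 z != 0, L1 z = [set c *: X1 z | c in setT],
         X2 z != 0 & L2 z = [set c *: X2 z | c in setT]]].
Proof.
move=> oU Ux; have Mx : pts M x by case: oU => + _; apply.
have [_ l1 l2 _ _] := hM.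
have [W1 [X1 [oW1 W1x s1 H1]]] := l1 _ Mx; have [W2 [X2 [oW2 W2x s2 H2]]] := l2 _ Mx.
have [aP rP] := patch_atP cM Mx; set P := patch_at M x in aP rP.
have [dP eP] := coord_rng rP.
pose W := dom P `&` par P @^-1` (U `&` (W1 `&` W2)).
have oW : open W by case: (mopenI oU (mopenI oW1 oW2)) => _; apply.
exists P, W, X1, X2; split.
- split=> //; first by move=> z [].
    by exists (coord P x) => //; split=> //; rewrite /= eP.
  by move=> z [y [_ [Uy _]] <-].
- by apply: smooth_field_sub s1 => z [y [_ [_ [? _]]] <-].
- by apply: smooth_field_sub s2 => z [y [_ [_ [_ ?]]] <-].
- by move=> z [y [_ [_ [/H1 [? ?] /H2 [? ?]]]] <-].
Qed.

Section Eta.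
Variables (U : set T) (eta : T -> V -> R).
Hypothesis ce : contact_form M L1 L2 U eta.

Lemma cmp_matrix (f : 'I_3 -> T -> V -> R) z : (forall j, scalar (f j z)) ->
  forall j v, cmp j (fun z => \matrix_(i, j) f j z (delta_mx 0 i)) z v = f j z v.
Proof.
move=> lf j v; rewrite /cmp mxE [in RHS](row_sum_delta v) (scal_sum (lf j)).
by apply: eq_bigr => i _; rewrite (scalZ (lf j)) mxE.
Qed.

Lemma local_adapted x : U x -> exists P W e,
  [/\ gdata M (Bset M L1 L2 U eta) P W e, (par P @` W) x & par P @` W `<=` U].
Proof.
move=> Ux; have [oU fe nd kD] := ce.
have [P [W [X1 [X2 [[aP oW WP Wx WU] s1 s2 H]]]]] := local_frames oU Ux.
pose c z := dform M eta z (X1 z) (X2 z).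
(* With c = d eta (X1, X2), nonzero by the contact condition, the forms d eta (., X2) and d eta (X1,
   .) / c vanish on X2 and X1 respectively, and by [alt2_plucker] their wedge product is d eta. *)
pose f (j : 'I_3) z v : R := if j == i1 then dform M eta z v (X2 z)
  else if j == i2 then (c z)^-1 * dform M eta z (X1 z) v else eta z v.
pose e z : 'M[R]_3 := \matrix_(i, j) f j z (delta_mx 0 i).
have oPW : mopen M (par P @` W) := mopen_par cM aP oW WP.
have ad z : (par P @` W) z -> alt2 (dform M eta z).
  by move=> /WU Uz; exact: (dform_alt2 hM oU fe Uz).
have lf z : (par P @` W) z -> forall j, scalar (f j z).
  move=> Wz; have lr := alt2r (ad _ Wz); have [ll _] := ad _ Wz.
  apply: ord3P; rewrite /f ?iE //.
    by move=> a u v; rewrite lr mulrDr mulrCA.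
  by case: fe => + _; apply; exact: WU.
have Ec z j v : (par P @` W) z -> cmp j e z v = f j z v.
  by move=> Wz; apply: (@cmp_matrix f z) => k; exact: lf.
have F1 z : f i1 z = fun v => dform M eta z v (X2 z) by rewrite /f iE.
have F2 z : f i2 z = fun v => (c z)^-1 * dform M eta z (X1 z) v by rewrite /f !iE.
have F3 z : f i3 z = eta z by rewrite /f !iE.
have nz z : (par P @` W) z -> c z != 0 /\ exists Z, eta z Z = 1 /\
  forall v, exists a b, v = eta z v *: Z + a *: X1 z + b *: X2 z.
  move=> Wz; have [n1 E1 n2 E2] := H _ Wz; have Uz := WU _ Wz.
  have Mz : pts M z by case: oU => + _; apply.
  by have [_ ED] := DP hM n1 n2 E1 E2 Mz; exact: (contact_nondeg hM ce Uz ED).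
have zero z : (par P @` W) z -> eta z (X1 z) = 0 /\ eta z (X2 z) = 0.
  move=> Wz; have [n1 E1 n2 E2] := H _ Wz; have Uz := WU _ Wz.
  split; apply/(kD _ Uz).
    by exists (X1 z), 0; split; rewrite ?addr0 ?E1 ?E2//; [exists 1; rewrite ?scale1r|exists 0; rewrite ?scale0r].
  by exists 0, (X2 z); split; rewrite ?add0r ?E1 ?E2//; [exists 0; rewrite ?scale0r|exists 1; rewrite ?scale1r].
have ue z : (par P @` W) z -> e z \in unitmx.
  move=> Wz; apply: ker_unitmx => v ve.
  have fv j : f j z v = 0 by rewrite -Ec// /cmp ve mxE.
  have [cz [Z [eZ HZ]]] := nz _ Wz; have [a [b Ev]] := HZ v.
  have [ll aa] := ad _ Wz; have lr := alt2r (ad _ Wz).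
  have e0 : eta z v = 0 by rewrite -(F3 z).
  rewrite e0 scale0r add0r in Ev.
  have := fv i1; rewrite F1 Ev (scalD (ll _)) !(scalZ (ll _)) (alt2_0 _ (ad _ Wz)) mulr0 addr0.
  move/eqP; rewrite mulf_eq0 (negPf cz) orbF => /eqP a0.
  have := fv i2; rewrite F2 Ev (scalD (lr _)) !(scalZ (lr _)) (alt2_0 _ (ad _ Wz)) mulr0 add0r.
  move/eqP; rewrite !mulf_eq0 (negPf cz) orbF invr_eq0 (negPf cz) => /eqP b0.
  by rewrite a0 b0 !scale0r addr0.
have near_W y : W y -> \forall z \near y, W z by move=> Wy; exact: near_open Wy.
have s_eta y : W y -> smf (rep1 M P eta) y.
  by move=> Wy; apply: (form1_smf cM oU fe aP (WP _ Wy)); apply: WU; exists y.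
have dE y v w : W y -> dform M eta (par P y) (dpatch M P y v) (dpatch M P y w) = cd (rep1 M P eta) y v w.
  by move=> Wy; apply: (dformE cM _ _ aP (WP _ Wy)); exact: s_eta.
pose t1 y := tcoord M P (par P y) (X1 (par P y)).
pose t2 y := tcoord M P (par P y) (X2 (par P y)).
have st1 y : W y -> sm t1 y.
  by move=> Wy; apply: (smooth_field_sm oPW s1 aP (WP _ Wy)); exists y.
have st2 y : W y -> sm t2 y.
  by move=> Wy; apply: (smooth_field_sm oPW s2 aP (WP _ Wy)); exists y.
have Et1 y : W y -> X1 (par P y) = dpatch M P y (t1 y) by move=> Wy; rewrite (tcoordK cM)//; exact: WP.
have Et2 y : W y -> X2 (par P y) = dpatch M P y (t2 y) by move=> Wy; rewrite (tcoordK cM)//; exact: WP.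
have Ecd y : W y -> c (par P y) = cd (rep1 M P eta) y (t1 y) (t2 y).
  move=> Wy; exact: (eq_trans (f_equal2 (dform M eta (par P y)) (Et1 y Wy) (Et2 y Wy)) (dE y _ _ Wy)).
have D1 y u : W y -> dform M eta (par P y) (X1 (par P y)) (dpatch M P y u) = cd (rep1 M P eta) y (t1 y) u.
  move=> Wy; exact: (eq_trans (f_equal2 (dform M eta (par P y)) (Et1 y Wy) erefl) (dE y _ _ Wy)).
have D2 y u : W y -> dform M eta (par P y) (dpatch M P y u) (X2 (par P y)) = cd (rep1 M P eta) y u (t2 y).
  move=> Wy; exact: (eq_trans (f_equal2 (dform M eta (par P y)) erefl (Et2 y Wy)) (dE y _ _ Wy)).
have fe1 j : is_form1 M (par P @` W) (cmp j e).
  apply: (form1_intro cM) => z [y Wy <-]; exists P, y; split=> //; first exact: WP.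
  have WW z' : W z' -> (par P @` W) (par P z') by exists z'.
  have sc : sm (fun z => (cd (rep1 M P eta) z (t1 z) (t2 z))^-1 : R^o) y.
    apply: sm_inv; last by apply: sm_cd; [exact: s_eta|exact: st1|exact: st2].
    have [n0 _] := nz _ (WW _ Wy); exact: (eq_ind _ (fun r => r != 0) n0 _ (Ecd _ Wy)).
  move: j; apply: ord3P.
  - apply: smf_ext (smf_cdl (s_eta _ Wy) (st2 _ Wy)).
    apply: filterS (near_W _ Wy) => z' Wz u.
    by rewrite /rep1 (Ec _ _ _ (WW _ Wz)) F1 (D2 _ _ Wz).
  - apply: smf_ext (smf_scale sc (smf_cdr (s_eta _ Wy) (st1 _ Wy))).
    apply: filterS (near_W _ Wy) => z' Wz u.
    by rewrite /rep1 (Ec _ _ _ (WW _ Wz)) F2 (Ecd _ Wz) (D1 _ _ Wz).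
  - apply: smf_ext (s_eta _ Wy).
    apply: filterS (near_W _ Wy) => z' Wz u.
    by rewrite /rep1 (Ec _ _ _ (WW _ Wz)) F3.
exists P, W, e; split=> //; split=> //.
move=> z Wz; have [cz [Z [eZ HZ]]] := nz _ Wz; have [z1 z2] := zero _ Wz.
have [n1 E1 n2 E2] := H _ Wz; have [ll aa] := ad _ Wz; have lr := alt2r (ad _ Wz).
split.
- by split; [exact: WU|exact: ue].
- by move=> v; rewrite -/(cmp i3 e z v) Ec// F3.
- move=> v w; rewrite -!/(cmp _ e z _) !Ec// !F1 !F2.
  have := alt2_plucker (ad _ Wz) HZ v w; rewrite -/(c z) => pl.
  exact: (plucker_div cz pl).
- move=> v; rewrite E2 => -[k _ <-].
  by rewrite -/(cmp i1 e z (k *: X2 z)) Ec// F1 (scalZ (ll _)) (alt2_0 _ (ad _ Wz)) mulr0.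
- move=> v; rewrite E1 => -[k _ <-].
  by rewrite -/(cmp i2 e z (k *: X1 z)) Ec// F2 (scalZ (lr _)) (alt2_0 _ (ad _ Wz)) !mulr0.
Qed.

End Eta.
End LocalCoframe.

Lemma near_unit {R : realType} (V : normedModType R) n (E : V -> 'M[R]_n.+1) y :
  sm E y -> E y \in unitmx -> \forall z \near y, E z \in unitmx.
Proof.
move=> sE uE; have sd : sm (fun y => \det (E y) : R^o) y by apply: sm_det => i j; exact: sm_entry.
have d0 : \det (E y) != 0 by rewrite -unitfE -unitmxE.
have := near_neq0 (f := fun y => \det (E y) : R^o) d0 (sm_cont sd).
by apply: filterS => z; rewrite unitmxE unitfE.
Qed.

(** * The reduction B and the coframe bundle as manifolds *)

Section Bundles.
Context {R : realType} {T : Type}.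
Local Notation V := 'rV[R]_3.
Variables (M : premanifold T V) (L1 L2 : T -> set V).
Hypothesis hM : path_geometry M L1 L2.
Let cM := cM hM.

Lemma sm_rho (s : R^o) : s != 0 -> sm (@rho R) s.
Proof.
move=> s0; apply: sm_mx => i j.
have H k : sm (fun s : R^o => [:: s^-1; s; 1]`_k : R^o) s.
  case: k => [|[|[|k]]] /=; [|exact: sm_id|exact: sm_cst|].
    by apply: (sm_inv (f := id)) => //; exact: sm_id.
  by rewrite (_ : (fun _ => _) = fun=> 0); [exact: sm_cst|apply/funext => t; rewrite nth_nil].
have [ij|ij] := eqVneq i j.
  apply: (sm_ext _ (H j)); apply: near_all => t; by rewrite /rho !mxE ij eqxx.
apply: (sm_ext _ (sm_cst 0 s)); apply: near_all => t.
by rewrite /rho !mxE (negPf ij).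
Qed.

Lemma rho_diag2 (s : R^o) : mxentry i2 i2 (rho s) = s.
Proof. by rewrite /mxentry /rho !mxE eqxx i2v. Qed.

Lemma coord_mx_cont : continuous (mxentry (R := R) i2 i2 : 'M[R]_3 -> R^o).
Proof. by move=> A; exact: coord_continuous. Qed.

Definition nz : set R^o := [set s | s != 0].
Lemma open_nz : open nz. Proof. exact: open_neq. Qed.

Definition umx : set 'M[R]_3 := [set A | A \in unitmx].
Lemma open_umx : open umx.
Proof.
rewrite openE => A uA; have := near_unit (sm_id A) uA.
exact.
Qed.

Section Eta.
Variables (U : set T) (eta : T -> V -> R).
Hypothesis ce : contact_form M L1 L2 U eta.
Local Notation Bs := (Bset M L1 L2 U eta).
Local Notation BU := (B M L1 L2 U eta).
Local Notation bdata := (gdata M Bs).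
Local Notation bpatch := (gpatch (nz : set R^o) (@rho R)).

Lemma Bs_M p : Bs p -> pts M p.1 /\ p.2 \in unitmx.
Proof. by case: p => x u Bp; have [[Ux uu] _ _ _ _] := BsetP Bp; split=> //; exact: (U_pts ce). Qed.

Lemma Bs_U p : Bs p -> U p.1.
Proof. by case: p => x u Bp; have [[Ux uu] _ _ _ _] := BsetP Bp. Qed.

Lemma Bs_act x u (s : R^o) : Bs (x, u) -> nz s -> Bs (x, u *m rho s).
Proof. by move=> Bu s0; exact: Bset_act. Qed.

Lemma Bs_tor x u u' : Bs (x, u) -> Bs (x, u') -> exists s : R^o, nz s /\ u' = u *m rho s.
Proof. exact: (Bset_torsor hM ce). Qed.

Lemma Bs_cov p : Bs p -> exists P W e, bdata P W e /\ (par P @` W) p.1.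
Proof.
by move=> /Bs_U /(local_adapted hM ce) [P [W [e [gd Wp _]]]]; exists P, W, e.
Qed.

Lemma B_charted : charted BU.
Proof.
exact: (gstruct_charted cM findim_R open_nz coord_mx_cont (fun s _ => rho_diag2 s) (fun s => @sm_rho s)
  Bs_act Bs_tor Bs_cov).
Qed.

Lemma B_atlas P W e : bdata P W e -> atlas BU (bpatch P W e).
Proof. exact: gatlas. Qed.

Lemma B_coord P W e p : bdata P W e -> Bs p -> (par P @` W) p.1 ->
  rng (bpatch P W e) p /\ coord (bpatch P W e) p = (coord P p.1, mxentry i2 i2 (invmx (e p.1) *m p.2)).
Proof.
exact: (gcoord cM (r := mxentry i2 i2) (fun s _ => rho_diag2 s) Bs_tor).
Qed.

Lemma bdata_Bs P W e (z : V * R^o) : bdata P W e -> W z.1 -> z.2 != 0 ->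
  Bs (par P z.1, e (par P z.1) *m rho z.2).
Proof. exact: (gdata_Z Bs_act). Qed.

Lemma B_proj A : mopen M A -> mopen BU [set p | Bs p /\ A p.1].
Proof.
move=> oA; apply: (mopen_intro B_charted); first by move=> p [].
move=> p [Bp Ap]; have [P [W [e [gd Wp]]]] := Bs_cov Bp.
have [rp cp] := B_coord gd Bp Wp; have [dp ep] := coord_rng rp.
exists (bpatch P W e), (coord (bpatch P W e) p); split=> //; first exact: B_atlas.
have aP : atlas M P by case: gd.
have [wp sp] := dp.
have WP : W `<=` dom P by case: gd => _ [].
have Ap' : A (par P (coord (bpatch P W e) p).1) by move: Ap; rewrite -{1}ep.
have n1 := mopen_near oA aP (WP _ wp) Ap'.
have n2 := sm_near_comp (P := fun y => dom P y /\ A (par P y)) (sm_fst _) n1.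
have oB : open (dom (bpatch P W e)) := chart_open B_charted (B_atlas gd).
have n3 := near_open oB dp.
apply: filterS2 n2 n3 => z [_ Az] [Wz Sz]; split=> //.
exact: (bdata_Bs gd).
Qed.

Lemma B_manifold : is_manifold BU.
Proof.
refine (fibred_manifold (M := M) _ B_charted _ _ _ _).
- by case: hM.
- exact: B_proj.
- by move=> p /Bs_M [].
- move=> p q Bp Bq e pq; have [P [W [f [gd Wp]]]] := Bs_cov Bp.
  have Wq : (par P @` W) q.1 by rewrite -e.
  apply: (separate_chart B_charted (B_atlas gd)) => //.
    by have [] := B_coord gd Bp Wp.
  by have [] := B_coord gd Bq Wq.
- move=> p Bp; have [P [W [f [gd Wp]]]] := Bs_cov Bp.
  exists (par P @` W); split=> //; first exact: (gdata_mopen cM gd).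
  (* A bundle chart contains the whole fibre over each of its base points, so the four charts may be
     taken equal. *)
  exists (fun=> bpatch P W f) => q Bq Wq; exists (true, true); split; first exact: B_atlas.
  by have [] := B_coord gd Bq Wq.
Qed.

Local Notation CB := (coframe_bundle M).

(** Charts of the coframe bundle need local sections; coframes adapted to local contact forms
    provide one near every point. *)
Lemma CB_charted : charted CB.
Proof.
apply: (gstruct_charted cM (findim_mx 2 2) open_umx (r := idfun)) => //.
- by move=> A; exact: cvg_id.
- by move=> A _; exact: sm_id.
- by move=> x u s [/= Mx uu] us; split=> //=; rewrite unitmx_mul uu.
- move=> x u u' [/= Mx uu] [/= _ uu']; exists (invmx u *m u'); split.
    by rewrite /umx /= unitmx_mul unitmx_inv uu.
  by rewrite mulKVmx.
- move=> p [Mp up]; have [_ _ _ _ /(_ _ Mp) [U' [eta' [Ux ce']]]] := hM.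
  have [P [W [e [[aP oW cf Ze] Wp WU]]]] := local_adapted hM ce' Ux.
  exists P, W, e; split=> //; split=> // x Wx.
  by have [[Ux' uu] _ _ _ _] := BsetP (Ze _ Wx); split=> //=; exact: (U_pts ce').
Qed.

Lemma CB_data P W e : bdata P W e -> gdata M [set p | pts M p.1 /\ p.2 \in unitmx] P W e.
Proof.
by move=> [aP oW cf Ze]; split=> // x Wx; exact: (Bs_M (Ze _ Wx)).
Qed.

Lemma CB_id p : Bs p -> smooth_at BU CB id p.
Proof.
move=> Bp; have [P [W [e [gd Wp]]]] := Bs_cov Bp.
have [rp cp] := B_coord gd Bp Wp; have [dp ep] := coord_rng rp.
have gd' := CB_data gd; have [aP [oW WP] [ue _] _] := gd.
rewrite -ep; exists (bpatch P W e), (gpatch umx id P W e), (coord (bpatch P W e) p).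
split=> //; [exact: B_atlas|exact: gatlas|].
have n := near_open (chart_open B_charted (B_atlas gd)) dp.
have n' : \forall z \near coord (bpatch P W e) p, rng (gpatch umx id P W e) (par (bpatch P W e) z) /\
    coord (gpatch umx id P W e) (par (bpatch P W e) z) = (z.1, rho z.2).
  apply: filterS n => z [Wz Sz].
  have r : rng (gpatch umx id P W e) (par (bpatch P W e) z).
    by exists (z.1, rho z.2) => //; split=> //; exact: rho_unit.
  split=> //; have E : par (bpatch P W e) z = par (gpatch umx id P W e) (z.1, rho z.2) by [].
  by rewrite E (coordK CB_charted (gatlas _ _ gd'))//; split=> //; exact: rho_unit.
split; first by apply: filterS n' => z [].
apply: (@sm_ext R (V * R^o)%type (V * 'M[R]_3)%type (fun z => (z.1, rho z.2))).
  by apply: filterS n' => z [_ <-].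
apply: sm_pair; first exact: sm_fst.
by apply: (sm_comp (g := @rho R) (sm_snd _)); apply: sm_rho; case: dp.
Qed.

Lemma B_reduction : is_reduction M U BU.
Proof.
split.
- split; first exact: B_manifold.
  apply: (smooth_map_intro B_charted CB_charted (mopen_pts B_charted)).
  exact: CB_id.
- by move=> p Bp; split; [exact: Bs_U|exact: Bs_M].
- by move=> s [x u] s0 Bp; exact: Bset_act.
- move=> [x u] [x' u'] Bp Bq /= e; subst x'.
  have [s [s0 es]] := Bs_tor Bp Bq; exists s; split; first by split=> //; rewrite es.
  move=> t [t0]; rewrite es => -[Et]; have [_ /= uu] := Bs_M Bp.
  by rewrite -(rho_diag2 s) -(rho_diag2 t) (can_inj (mulKmx uu) Et).
- move=> x Ux; have [P [W [e [gd Wx WU]]]] := local_adapted hM ce Ux.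
  exists (par P @` W), e; split=> //; first exact: (gdata_mopen cM gd).
    by case: gd.
  by move=> z Wz; case: gd => _ _ _; apply.
Qed.

(** [Bset] refers to d eta at a point, adaptedness to the exterior derivative of the third form of
    e. They agree because that form equals eta on the whole open set W. *)
Lemma B_sections W e : mopen M W -> W `<=` U -> coframe_on M W e ->
  (forall x, W x -> pts BU (x, e x)) <-> adapted_coframe M L1 L2 eta W e.
Proof.
move=> oW WU cf; split.
  move=> H.
  have E3 x : W x -> forall v, cmp i3 e x v = eta x v by move=> Wx; have [_ + _ _ _] := BsetP (H x Wx).
  split=> //.
  - move=> x Wx v w; have [_ _ Hd _ _] := BsetP (H x Wx).
    rewrite (dform_ext cM (a' := eta) v w oW Wx) ?Hd//.
    by move=> q Wq; apply/funext => u; exact: E3.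
  - by move=> x Wx; have [_ _ _ + _] := BsetP (H x Wx).
  - by move=> x Wx; have [_ _ _ _] := BsetP (H x Wx).
move=> [_ E3 Hd H1 H2] x Wx; split.
- by split; [exact: WU|case: cf => + _; apply].
- by move=> v; exact: E3.
- move=> v w; rewrite -(dform_ext cM (a := cmp i3 e) v w oW Wx) ?Hd//.
  by move=> q Wq; apply/funext => u; exact: E3.
- exact: H1.
- exact: H2.
Qed.

End Eta.
End Bundles.

(** * The metric on the reduction B *)

Section Signature22.
Context {R : realType} {F : lmodType R}.
Variables (g : F -> F -> R) (m1 m2 m3 m4 : F -> R) (f1 f2 f3 f4 : F).
Hypotheses (l1 : scalar m1) (l2 : scalar m2) (l3 : scalar m3) (l4 : scalar m4)
  (Hg : forall v w, g v w = (m1 v * m2 w + m2 v * m1 w) / 2 + (m3 v * m4 w + m4 v * m3 w) / 2)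
  (e1 : [/\ m1 f1 = 1, m2 f1 = 0, m3 f1 = 0 & m4 f1 = 0])
  (e2 : [/\ m1 f2 = 0, m2 f2 = 1, m3 f2 = 0 & m4 f2 = 0])
  (e3 : [/\ m1 f3 = 0, m2 f3 = 0, m3 f3 = 1 & m4 f3 = 0])
  (e4 : [/\ m1 f4 = 0, m2 f4 = 0, m3 f4 = 0 & m4 f4 = 1])
  (inj : forall v, m1 v = 0 -> m2 v = 0 -> m3 v = 0 -> m4 v = 0 -> v = 0).

Let q (k : nat) (x : 'rV[R]_4) : R := x 0 (inord k).
(** The vectors f1, ..., f4 are null and dual to the m's; m1 = q0 + q2 and m2 = q0 - q2 diagonalise
    m1 m2 as q0^2 - q2^2, and likewise m3 m4 as q1^2 - q3^2. *)
Let Lf (x : 'rV[R]_4) : F := (q 0 x + q 2 x) *: f1 + (q 0 x - q 2 x) *: f2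
  + (q 1 x + q 3 x) *: f3 + (q 1 x - q 3 x) *: f4.

Let q_lin k : scalar (q k).
Proof. by move=> a u v; rewrite /q !mxE. Qed.

Let Lf_lin : linear Lf.
Proof.
have T1 (p : 'rV[R]_4 -> R) (f : F) : scalar p -> linear (fun x => p x *: f).
  by move=> lp a u v; rewrite lp scalerDl scalerA.
have T2 (p p' : 'rV[R]_4 -> F) : linear p -> linear p' -> linear (fun x => p x + p' x).
  by move=> lp lp' a u v; rewrite lp lp' scalerDr addrACA.
refine (T2 _ _ (T2 _ _ (T2 _ _ (T1 (fun x => q 0 x + q 2 x) f1 _) (T1 (fun x => q 0 x - q 2 x) f2 _))
  (T1 (fun x => q 1 x + q 3 x) f3 _)) (T1 (fun x => q 1 x - q 3 x) f4 _)) => a u v; rewrite !q_lin;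
  move: (q 0 u) (q 1 u) (q 2 u) (q 3 u) (q 0 v) (q 1 v) (q 2 v) (q 3 v) => *; ring.
Qed.

HB.instance Definition _ := GRing.isLinear.Build R 'rV[R]_4 F *:%R Lf Lf_lin.

Let mL x : [/\ m1 (Lf x) = q 0 x + q 2 x, m2 (Lf x) = q 0 x - q 2 x,
  m3 (Lf x) = q 1 x + q 3 x & m4 (Lf x) = q 1 x - q 3 x].
Proof.
move: e1 e2 e3 e4 => [a1 a2 a3 a4] [b1 b2 b3 b4] [c1 c2 c3 c4] [d1 d2 d3 d4].
rewrite /Lf !(scalD l1) !(scalZ l1) !(scalD l2) !(scalZ l2) !(scalD l3) !(scalZ l3) !(scalD l4) !(scalZ l4).
rewrite a1 a2 a3 a4 b1 b2 b3 b4 c1 c2 c3 c4 d1 d2 d3 d4.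
by move: (q 0 x) (q 1 x) (q 2 x) (q 3 x) => *; split; ring.
Qed.

Let Li (v : F) : 'rV[R]_4 := \row_j [:: (m1 v + m2 v) / 2; (m3 v + m4 v) / 2;
   (m1 v - m2 v) / 2; (m3 v - m4 v) / 2]`_j.

Lemma signature22 : exists L : {linear 'rV[R]_4 -> F}, bijective L /\
  forall x y : 'rV[R]_4, g (L x) (L y) =
    x 0 (inord 0) * y 0 (inord 0) + x 0 (inord 1) * y 0 (inord 1)
    - x 0 (inord 2) * y 0 (inord 2) - x 0 (inord 3) * y 0 (inord 3).
Proof.
exists Lf; split; last first.
  move=> x y; rewrite Hg; have [-> -> -> ->] := mL x; have [-> -> -> ->] := mL y.
  rewrite -!/(q _ _); move: (q 0 x) (q 1 x) (q 2 x) (q 3 x) (q 0 y) (q 1 y) (q 2 y) (q 3 y) => *.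
  by field.
exists Li.
  move=> x; have [h1 h2 h3 h4] := mL x; apply/rowP => j; rewrite mxE h1 h2 h3 h4.
  have E k : (k < 4)%N -> nat_of_ord j = k -> x 0 j = q k x.
    by move=> k4 jk; rewrite /q; congr (x _ _); apply/val_inj; rewrite /= inordK.
  case: j E => -[|[|[|[|//]]]] Hj E /=.
  - by rewrite (E 0%N)//; field.
  - by rewrite (E 1%N)//; field.
  - by rewrite (E 2%N)//; field.
  - by rewrite (E 3%N)//; field.
move=> v; apply/eqP; rewrite -subr_eq0; apply/eqP.
have [h1 h2 h3 h4] := mL (Li v).
have Q k : (k < 4)%N -> q k (Li v) = [:: (m1 v + m2 v) / 2; (m3 v + m4 v) / 2;
   (m1 v - m2 v) / 2; (m3 v - m4 v) / 2]`_k by move=> k4; rewrite /q /Li mxE inordK.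
by apply: inj; rewrite ?(scalB l1) ?(scalB l2) ?(scalB l3) ?(scalB l4) ?h1 ?h2 ?h3 ?h4 !Q//=; field.
Qed.

End Signature22.

Section Metric22.
Context {R : realType} {T : Type} {V : normedModType R} {fV : findim V}.
Variables (N : premanifold T (V * R^o)%type) (cN : charted N).

Lemma sm_sg (c : 'I_3 -> V -> V -> R) x (th : V * R^o -> R^o) (z a : V * R^o) :
  gauge c x z.1 -> sm th z -> sm (fun w : V * R^o => sg c x w.1 (th w) a.1 : R^o) z.
Proof.
move=> g sth; have s1 := sm_fst z.
have sa : sm (fun w : V * R^o => alf c x w.1 a.1 : R^o) z.
  by apply: (sm_comp1 (g := fun y => alf c x y a.1 : R^o) s1); have [+ _] := smf_alf g; apply.
have sK : sm (fun w : V * R^o => Kf c x w.1 : R^o) z.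
  by apply: (sm_comp1 (g := Kf c x : V -> R^o) s1); exact: sm_Kf g.
have s3 : sm (fun w : V * R^o => c i3 w.1 a.1 : R^o) z.
  by apply: (sm_comp1 (g := fun y => c i3 y a.1 : R^o) s1); have [+ _] := gauge_smf g i3; apply.
apply: sm_add; first by apply: sm_mul; [exact: sm_cst|exact: sm_add].
by apply: sm_mul => //; apply: sm_mul => //; exact: sm_cst.
Qed.

Lemma sg_lin c x (y : V) : gauge c x y -> forall (k : R),
  scalar (fun a : V * R^o => sg c x y (k * a.2) a.1).
Proof.
move=> g k a u v; rewrite /sg /= (smf_lin (smf_alf g)) (smf_lin (gauge_smf g i3)) !scaleRo.
by move: (alf _ _ _ _) (alf _ _ _ _) (Kf _ _ _) (c _ _ _) (c _ _ _) u.2 v.2 => *; ring.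
Qed.

Lemma FeffC (c : 'I_3 -> V -> V -> R) x y v th w th' :
  Feff c x y v th w th' = Feff c x y w th' v th.
Proof.
by rewrite /Feff; move: (sg _ _ _ _ _) (sg _ _ _ _ _) (c i1 _ v) (c i1 _ w) (c i2 _ v)
  (c i2 _ w) (c i3 _ v) (c i3 _ w) => *; ring.
Qed.

Lemma Feff_lin c x (y : V) : gauge c x y -> forall (k : R) v th,
  scalar (fun a : V * R^o => Feff c x y v th a.1 (k * a.2)).
Proof.
move=> ga k v th a u1 u2.
have lc i := smf_lin (gauge_smf ga i) a u1.1 u2.1.
have ls := sg_lin ga k a u1 u2; rewrite /= in ls lc.
rewrite /Feff /= (lc i1) (lc i2) (lc i3) ls.
by move: (sg _ _ _ _ _) (sg _ _ _ _ _) (sg _ _ _ _ _) (c i1 y v) (c i2 y v) (c i3 y v)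
   (c i1 y u1.1) (c i1 y u2.1) (c i2 y u1.1) (c i2 y u2.1) (c i3 y u1.1) (c i3 y u2.1) => *; ring.
Qed.

(* Applied with k = 1/s on B and k = 1/(2t) on SD. *)
Lemma metric22_chart (O : set T) (g : T -> V * R^o -> V * R^o -> R) : mopen N O ->
  (forall p, O p -> exists Q z c x (k : V * R^o -> R^o),
    [/\ [/\ atlas N Q, dom Q z & par Q z = p], gauge c x z.1, sm k z, k z != 0 &
      \forall w \near z, forall a b, g (par Q w) (dpatch N Q w a) (dpatch N Q w b) =
        Feff c x w.1 a.1 (k w * a.2) b.1 (k w * b.2)]) ->
  is_metric22 N O g.
Proof.
move=> oO H.
have fst_lin (m : V -> R) : scalar m -> scalar (fun a : V * R^o => m a.1) by move=> lm a u v; exact: lm.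
have C1 p : O p -> (forall v, scalar (g p v)) /\ (forall v w, g p v w = g p w v).
  move=> Op; have [Q [z [c [x [k [[aQ Qz zp] ga sk k0 /nbhs_singleton Hz]]]]]] := H _ Op.
  have E v w : g p v w = Feff c x z.1 (tcoord N Q p v).1 (k z * (tcoord N Q p v).2)
      (tcoord N Q p w).1 (k z * (tcoord N Q p w).2).
    have dp u : dpatch N Q z (tcoord N Q p u) = u by rewrite -zp; exact: (tcoordK cN).
    refine (eq_trans _ (Hz (tcoord N Q p v) (tcoord N Q p w))).
    by rewrite zp; exact (f_equal2 (g p) (esym (dp v)) (esym (dp w))).
  have tl a u v : tcoord N Q p (a *: u + v) = a *: tcoord N Q p u + tcoord N Q p v.
    by rewrite -zp (tcoord_lin cN).
  split=> [v a u1 u2|v w]; last by rewrite E FeffC; exact: esym (E w v).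
  rewrite E tl; refine (eq_trans (Feff_lin ga _ _ _ _ _ _) _).
  exact (f_equal2 (fun r s => a * r + s) (esym (E v u1)) (esym (E v u2))).
split=> //.
  apply: (bilin_smooth_intro cN oO C1) => p Op.
  have [Q [z [c [x [k [[aQ Qz zp] ga sk k0 Hz]]]]]] := H _ Op.
  exists Q, z; split=> // u v.
  apply: (sm_ext (f := fun w : V * R^o => Feff c x w.1 u.1 (k w * u.2) v.1 (k w * v.2) : R^o)).
    by apply: filterS Hz => w Hw; exact: esym (Hw u v).
  have sc i a : sm (fun w : V * R^o => c i w.1 a : R^o) z.
    by apply: (sm_comp1 (g := fun y => c i y a : R^o) (sm_fst z)); have [+ _] := gauge_smf ga i; apply.
  have ss a : sm (fun w : V * R^o => sg c x w.1 (k w * a.2) a.1 : R^o) z.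
    apply: sm_sg => //; exact: sm_mul sk (sm_cst _ _).
  apply: sm_add; (apply: sm_mul; last exact: sm_cst); apply: sm_add; exact: sm_mul.
move=> p Op; have [Q [z [c [x [k [[aQ Qz zp] ga sk k0 /nbhs_singleton Hz]]]]]] := H _ Op.
have tl : linear (tcoord N Q p) by move=> a u v; rewrite -zp (tcoord_lin cN).
pose m i (v : V * R^o) : R := c i z.1 (tcoord N Q p v).1.
pose m4 (v : V * R^o) : R := sg c x z.1 (k z * (tcoord N Q p v).2) (tcoord N Q p v).1.
have lm i : scalar (m i) by move=> a u v; rewrite /m tl; exact: (smf_lin (gauge_smf ga i)).
have lm4 : scalar m4 by move=> a u v; rewrite /m4 tl (sg_lin ga).
have K a : tcoord N Q p (dpatch N Q z a) = a by rewrite -zp (dpatchK cN).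
have cx i j := gauge_dual ga i j.
(* The equation [sg] = n4 solved for the vertical component. This gives lifts of the frame vectors
   on which [sg] vanishes, and a vertical vector on which it is 1. *)
pose th4 (n3 n4 : R) (v : V) : R^o := (k z)^-1 * (- (3 / 2) * (n4 - 1 / 6 * Kf c x z.1 * n3) - alf c x z.1 v).
have sg4 n4 v : sg c x z.1 (k z * th4 (c i3 z.1 v) n4 v) v = n4.
  rewrite /sg /th4; move: (alf _ _ _ _) (Kf _ _ _) (c _ _ _) k0; move: (k z) => kk A B C k0.
  by field.
have mf i v th : m i (dpatch N Q z (v, th)) = c i z.1 v by rewrite /m K.
have m4f n4 v : m4 (dpatch N Q z (v, th4 (c i3 z.1 v) n4 v)) = n4 by rewrite /m4 K /= sg4.
have c0 i : c i z.1 0 = 0 by apply: scal0; exact: smf_lin (gauge_smf ga i).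
apply: (signature22 (m1 := m i1) (m2 := m i2) (m3 := m i3) (m4 := m4)
  (f1 := dpatch N Q z (x i1 z.1, th4 (c i3 z.1 (x i1 z.1)) 0 (x i1 z.1)))
  (f2 := dpatch N Q z (x i2 z.1, th4 (c i3 z.1 (x i2 z.1)) 0 (x i2 z.1)))
  (f3 := dpatch N Q z (x i3 z.1, th4 (c i3 z.1 (x i3 z.1)) 0 (x i3 z.1)))
  (f4 := dpatch N Q z (0, th4 (c i3 z.1 0) 1 0))) => //.
- move=> v w; have dp u : dpatch N Q z (tcoord N Q p u) = u by rewrite -zp; exact: (tcoordK cN).
  refine (eq_trans _ (Hz (tcoord N Q p v) (tcoord N Q p w))).
  by rewrite zp; exact (f_equal2 (g p) (esym (dp v)) (esym (dp w))).
- by rewrite !mf m4f !cx !iE.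
- by rewrite !mf m4f !cx !iE.
- by rewrite !mf m4f !cx !iE.
- by rewrite !mf m4f !c0.
move=> v h1 h2 h3 h4.
have t1 : (tcoord N Q p v).1 = 0.
  apply: (gauge_inj ga); apply: ord3P; rewrite c0; [exact: h1|exact: h2|exact: h3].
have t2 : (tcoord N Q p v).2 = 0.
  move: h4; rewrite /m4 t1 /sg c0 (scal0 (smf_lin (smf_alf ga))) mulr0 !addr0 => /eqP.
  rewrite mulf_eq0 oppr_eq0 mulf_eq0 pnatr_eq0 invr_eq0 pnatr_eq0 /= mulf_eq0 (negPf k0) /=.
  by move/eqP.
have : tcoord N Q p v = 0 by rewrite [LHS]surjective_pairing t1 t2.
move=> tv; rewrite -(tcoordK cN v aQ Qz) zp tv.
by apply: lin0 => a u u'; exact: (dpatch_lin cN).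
Qed.

End Metric22.

(** * Tautological and connection forms in a bundle chart *)

Section BundleForms.
Context {R : realType} {V : normedModType R} {fV : findim V}.
Variables (c : 'I_3 -> V -> V -> R) (x : 'I_3 -> V -> V).
Implicit Types z a b : V * R^o.

Definition bo (i : 'I_3) z a : R :=
  if i == i1 then z.2^-1 * c i1 z.1 a.1
  else if i == i2 then z.2 * c i2 z.1 a.1 else c i3 z.1 a.1.
Definition bal z a : R := a.2 / z.2 + alf c x z.1 a.1.

Lemma balE z a : bal z a = a.2 / z.2 + alf c x z.1 a.1. Proof. by []. Qed.
Lemma bo1E z a : bo i1 z a = z.2^-1 * c i1 z.1 a.1. Proof. by rewrite /bo iE. Qed.
Lemma bo2E z a : bo i2 z a = z.2 * c i2 z.1 a.1. Proof. by rewrite /bo !iE. Qed.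
Lemma bo3E z a : bo i3 z a = c i3 z.1 a.1. Proof. by rewrite /bo !iE. Qed.

Lemma smf_fst (m : V -> V -> R) z : smf m z.1 -> smf (fun w a : V * R^o => m w.1 a.1) z.
Proof.
move=> sm_; apply: (smf_ext _ (smf_pull (sm_fst z) sm_)).
by apply: near_all => w u; rewrite D_fst.
Qed.

Lemma cd_fst (m : V -> V -> R) z a b : smf m z.1 ->
  cd (fun w a : V * R^o => m w.1 a.1) z a b = cd m z.1 a.1 b.1.
Proof.
move=> sm_; rewrite -[in RHS](D_fst z a) -[in RHS](D_fst z b) -(cd_pull (sm_fst z) sm_).
by apply: cd_ext; apply: near_all => w u; rewrite D_fst.
Qed.

Variable z : V * R^o.
Hypotheses (g : gauge c x z.1) (z0 : z.2 != 0).

Lemma sm_sndV : sm (fun w : V * R^o => w.2^-1 : R^o) z.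
Proof. exact: sm_inv z0 (sm_snd z). Qed.

Lemma smf_bo i : smf (bo i) z.
Proof.
have s j := smf_fst (gauge_smf g j).
move: i; apply: ord3P; rewrite /bo !iE.
- exact: (smf_scale sm_sndV).
- exact: (smf_scale (sm_snd z)).
- exact: s.
Qed.

Lemma smf_dlog : smf (fun w a : V * R^o => a.2 / w.2) z.
Proof.
split=> [u|]; first by apply: sm_mul; [exact: sm_cst|exact: sm_sndV].
apply: near_all => w a u v; refine (eq_trans (mulrDl (a * u.2) v.2 w.2^-1) _).
exact (f_equal (fun r => r + v.2 / w.2) (esym (mulrA a u.2 w.2^-1))).
Qed.

(** The form is d log |s|. *)
Lemma cd_dlog a b : cd (fun w a : V * R^o => a.2 / w.2) z a b = 0.
Proof.
have E u : 'D_u (fun w : V * R^o => w.2^-1 : R^o) z = - u.2 / z.2 ^+ 2.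
  by rewrite (D_inv u (sm_snd z) z0) D_snd.
have H u v : 'D_u (fun w : V * R^o => v.2 / w.2 : R^o) z = - (v.2 * u.2 / z.2 ^+ 2).
  rewrite (D_mul u (sm_cst (v.2 : R^o) z) sm_sndV) D_cst E.
  by move: (z.2 ^+ 2)^-1 => *; ring.
by rewrite /cd !H; move: (z.2 ^+ 2)^-1 => *; ring.
Qed.

Lemma smf_bal : smf bal z.
Proof. exact: (smf_add smf_dlog (smf_fst (smf_alf g))). Qed.

Lemma cd_bal a b : cd bal z a b = cd (alf c x) z.1 a.1 b.1.
Proof.
by rewrite (cd_add a b smf_dlog (smf_fst (smf_alf g))) cd_dlog add0r cd_fst//; exact: smf_alf.
Qed.

Lemma cd_bo1 a b : cd (bo i1) z a b = - (bal z a * bo i1 z b - bal z b * bo i1 z a)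
  + str c x i1 i2 i3 z.1 / z.2 ^+ 2 * (bo i2 z a * bo i3 z b - bo i2 z b * bo i3 z a).
Proof.
rewrite [bo i1]/bo iE (cd_scale a b sm_sndV (smf_fst (gauge_smf g i1))).
rewrite (cd_fst a b (gauge_smf g i1)).
rewrite (gauge_structure g a.1 b.1).1 !(D_inv _ (sm_snd z) z0) !D_snd /bo !iE /bal.
move: (alf _ _ _ _) (alf _ _ _ _) (str _ _ _ _ _ _) (c i1 _ a.1) (c i1 _ b.1) (c i2 _ a.1) (c i2 _ b.1)
  (c i3 _ a.1) (c i3 _ b.1) z0; move: (a.2) (b.2) (z.2) => *; field.
by [].
Qed.

Lemma cd_bo2 a b : cd (bo i2) z a b = (bal z a * bo i2 z b - bal z b * bo i2 z a)
  + z.2 ^+ 2 * str c x i2 i3 i1 z.1 * (bo i3 z a * bo i1 z b - bo i3 z b * bo i1 z a).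
Proof.
rewrite [bo i2]/bo !iE (cd_scale a b (sm_snd z) (smf_fst (gauge_smf g i2))).
rewrite (cd_fst a b (gauge_smf g i2)).
rewrite (gauge_structure g a.1 b.1).2 !D_snd /bo !iE /bal.
move: (alf _ _ _ _) (alf _ _ _ _) (str _ _ _ _ _ _) (c i1 _ a.1) (c i1 _ b.1) (c i2 _ a.1) (c i2 _ b.1)
  (c i3 _ a.1) (c i3 _ b.1) z0; move: (a.2) (b.2) (z.2) => *; field.
by [].
Qed.

Lemma cd_bo3 a b : cd (bo i3) z a b = bo i1 z a * bo i2 z b - bo i1 z b * bo i2 z a.
Proof.
rewrite [bo i3]/bo !iE (cd_fst a b (gauge_smf g i3)).
rewrite (gauge_cd3 g a.1 b.1) /bo !iE.
move: (c i1 _ a.1) (c i1 _ b.1) (c i2 _ a.1) (c i2 _ b.1) z0; move: (z.2) => *; field.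
by [].
Qed.

Lemma cd_bal_expand a b : cd bal z a b =
  cd (alf c x) z.1 (x i2 z.1) (x i3 z.1) / z.2 * (bo i2 z a * bo i3 z b - bo i2 z b * bo i3 z a) +
  z.2 * cd (alf c x) z.1 (x i3 z.1) (x i1 z.1) * (bo i3 z a * bo i1 z b - bo i3 z b * bo i1 z a) +
  Kf c x z.1 * (bo i1 z a * bo i2 z b - bo i1 z b * bo i2 z a).
Proof.
rewrite cd_bal (cd_expand g a.1 b.1 (smf_alf g)) -/(Kf c x z.1) /bo !iE.
move: (Kf _ _ _) (cd _ _ _ _) (cd _ _ _ _) (c i1 _ a.1) (c i1 _ b.1) (c i2 _ a.1) (c i2 _ b.1)
  (c i3 _ a.1) (c i3 _ b.1) z0; move: (z.2) => *; field.
by [].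
Qed.

Definition bev (i : 'I_3) : V * R^o :=
  if i == i1 then (z.2 *: x i1 z.1, 0)
  else if i == i2 then (z.2^-1 *: x i2 z.1, 0) else (x i3 z.1, 0).

Lemma bo_bev i j : bo j z (bev i) = (i == j)%:R.
Proof.
have lc k := smf_lin (gauge_smf g k); have cx k l := gauge_dual g k l.
have z1 : z.2 * z.2^-1 = 1 by rewrite mulfV.
have z2 : z.2^-1 * z.2 = 1 by rewrite mulVf.
by move: i j; apply: ord3P; apply: ord3P; rewrite /bo /bev !iE /= ?(scalZ (lc _)) !cx !iE ?mulr0 ?mulr1.
Qed.

End BundleForms.

(** * The adapted connection and its curvature *)

Section Connection.
Context {R : realType} {T : Type}.
Local Notation V := 'rV[R]_3.
Variables (M : premanifold T V) (L1 L2 : T -> set V).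
Hypothesis hM : path_geometry M L1 L2.
Let cM := cM hM.
Variables (U : set T) (eta : T -> V -> R).
Hypothesis ce : contact_form M L1 L2 U eta.
Local Notation Bs := (Bset M L1 L2 U eta).
Local Notation BU := (B M L1 L2 U eta).
Local Notation bdata := (gdata M Bs).
Local Notation bpatch := (gpatch (nz : set R^o) (@rho R)).
Local Notation CB := (coframe_bundle M).
Local Notation om := (om M L1 L2 U eta).
Let cB := B_charted hM ce.
Let cCB := CB_charted hM.

Definition cf (P : patch T V) (e : T -> 'M[R]_3) (i : 'I_3) := rep1 M P (cmp i e).

Lemma cfE P e i y v : cf P e i y v = (dpatch M P y v *m e (par P y)) 0 i.
Proof. by []. Qed.

Lemma bdata_gauge P W e y : bdata P W e -> W y -> gauge (cf P e) (xf M P e) y.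
Proof.
move=> gd Wy; have [aP [oW WP] [ue fe] Ze] := gd; have oPW := gdata_mopen cM gd.
have nW := near_open oW Wy.
have smc i z : W z -> smf (cf P e i) z.
  by move=> Wz; apply: (form1_smf cM oPW (fe i) aP (WP _ Wz)); exists z.
have sE z : W z -> sm (Em M P e) z.
  by move=> Wz; apply: (sm_Em cM oPW (conj ue fe) aP (WP _ Wz)); exists z.
have uE z : W z -> e (par P z) \in unitmx by move=> Wz; apply: ue; exists z.
split.
- by move=> i; exact: smc.
- move=> i; apply: (sm_ext (f := fun z => row i (invmx (Em M P e z)))).
    apply: filterS nW => z Wz; rewrite (Em_inv cM aP (WP _ Wz) (uE _ Wz)).
    by rewrite rowK.
  have sI : sm (fun z => invmx (Em M P e z)) y.
    by apply: sm_invmx; [apply: (Em_unit cM aP (WP _ Wy) (uE _ Wy))|exact: sE].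
  apply: sm_mx => j k; apply: (sm_ext (f := fun z => invmx (Em M P e z) i k : R^o)).
    by apply: near_all => z; rewrite [RHS]mxE.
  exact: sm_entry.
- apply: filterS nW => z Wz; split=> [i j|v].
    by rewrite cfE /xf (tcoordK cM _ aP (WP _ Wz)); exact: cc_xi (uE _ Wz).
  have tl a u w := tcoord_lin cM a u w aP (WP _ Wz).
  refine (eq_trans (esym (dpatchK cM v aP (WP _ Wz))) _).
  rewrite {1}(xi_expand (dpatch M P z v) (uE _ Wz)).
  exact (linear_comb tl _ _).
- apply: filterS nW => z Wz v w; have Bz : Bs (par P z, e (par P z)) by apply: Ze; exists z.
  have Oz : (par P @` W) (par P z) by exists z.
  rewrite -(dformE cM v w aP (WP _ Wz) (smc i3 z Wz)) !cfE.
  have [_ _ Hd _ _] := BsetP Bz.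
  rewrite (dform_ext cM (a' := eta) _ _ oPW Oz) ?Hd//.
  move=> q Wq; apply/funext => u.
  by have [_ + _ _ _] := BsetP (Ze _ Wq); exact.
Qed.

(** In bundle charts the inclusion of B into the coframe bundle is (y, s) |-> (y, rho s). The
    projection to M discards the derivative of rho, and the coframe e rho(s) is applied to the base
    component a.1. *)
Lemma om_chart P W e (z : V * R^o) i a : bdata P W e -> W z.1 -> z.2 != 0 ->
  om i (par (bpatch P W e) z) (dpatch BU (bpatch P W e) z a) = bo (cf P e) i z a.
Proof.
move=> gd Wz z0; have [aP [oW WP] [ue fe] Ze] := gd.
set b := bpatch P W e; set Qc := gpatch umx id P W e.
have gd' := CB_data ce gd; have ab : atlas BU b := B_atlas gd.
have aQ : atlas CB Qc by exact: gatlas.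
have db : dom b z by [].
pose z' : V * 'M[R]_3 := (z.1, rho z.2).
have dQ : dom Qc z' by split=> //; exact: rho_unit.
have rQ : rng Qc (par b z) by exists z'.
have Bz : Bs (par b z) by exact: (bdata_Bs gd).
have cQ : coord Qc (par b z) = z' by exact: (coordK cCB aQ dQ).
have E1 : mdiff BU CB id (par b z) (dpatch BU b z a) =
    dpatch CB Qc z' (a.1, 'D_(a.2) (@rho R : R^o -> 'M[R]_3) z.2).
  rewrite (mdiffE cB cCB a ab aQ db rQ (CB_id hM ce Bz)) cQ; congr (dpatch _ _ _ _).
  transitivity ('D_a (fun w : V * R^o => (w.1, rho w.2) : V * 'M[R]_3) z).
    apply: D_ext; apply: filterS (near_open (chart_open cB ab) db) => w [Ww Sw] /=.
    have dw : dom Qc (w.1, rho w.2) by split=> //; exact: rho_unit.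
    exact: (coordK cCB aQ dw).
  rewrite D_pair ?D_fst; last 2 first.
  - exact: sm_fst.
  - by apply: (sm_comp (g := @rho R) (sm_snd z)); exact: sm_rho.
  have ED : 'D_a (fun y : V * R^o => rho y.2) z = 'D_(a.2) (@rho R : R^o -> 'M[R]_3) z.2.
    by have := D_comp a (sm_snd z) (sm_rho z0); rewrite D_snd.
  by rewrite ED.
have E2 a' : mdiff CB M fst (par Qc z') (dpatch CB Qc z' a') = dpatch M P z.1 a'.1.
  have rP : rng P (par Qc z').1 by apply: rng_par; exact: WP.
  have sf : smooth_at CB M fst (par Qc z') by exact: (gstruct_fst (z := z') cM _ gd' Wz (rho_unit z0)).
  rewrite (mdiffE cCB cM a' aQ aP dQ rP sf) (coordK cM aP (WP _ Wz)); congr (dpatch _ _ _ _).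
  transitivity ('D_a' (fun w : V * 'M[R]_3 => w.1) z'); last exact: D_fst.
  apply: D_ext; apply: filterS (near_open (chart_open cCB aQ) dQ) => w [Ww Sw] /=.
  by apply: (coordK cM aP); exact: WP.
have E3 : om i (par b z) (dpatch BU b z a) = (dpatch M P z.1 a.1 *m (e (par P z.1) *m rho z.2)) 0 i.
  by rewrite /om /pull1 /taut E1 (E2 (a.1, 'D_(a.2) _ z.2)).
rewrite E3 mulmxA; move: i {E1 E2 E3}; apply: ord3P; rewrite ?rho_e1 ?rho_e2 ?rho_e3 /bo !iE.
- by rewrite mulrC.
- by [].
- by [].
Qed.

#[local] Opaque Defs.om Defs.dform Defs.mdiff Defs.dpatch Defs.tcoord bo bal.

Definition Ev (i : 'I_3) (p : T * 'M[R]_3) : V * R^o :=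
  xget 0 [set v | forall j, om j p v = (i == j)%:R].

(* [connection_unique] evaluated on vectors dual to om1 and om2: the value does not
   depend on their vertical parts, so any choice in [Ev] will do. *)
Definition alB (p : T * 'M[R]_3) (v : V * R^o) : R :=
  - dform BU (om i1) p v (Ev i1 p) + dform BU (om i2) p (Ev i1 p) (Ev i2 p) * om i1 p v.

Lemma bdata_chart p : Bs p -> exists P W e z,
  [/\ bdata P W e, W z.1, z.2 != 0 & par (bpatch P W e) z = p].
Proof.
move=> Bp; have [P [W [e [gd Wp]]]] := Bs_cov hM ce Bp.
have [rp _] := B_coord hM ce gd Bp Wp; have [[dp1 dp2] ep] := coord_rng rp.
by exists P, W, e, (coord (bpatch P W e) p).
Qed.

Section Chart.
Variables (P : patch T V) (W : set V) (e : T -> 'M[R]_3).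
Hypothesis gd : bdata P W e.
Local Notation b := (bpatch P W e).
Local Notation c := (cf P e).
Local Notation x := (xf M P e).

Lemma dom_b (z : V * R^o) : W z.1 -> z.2 != 0 -> dom b z.
Proof. by []. Qed.

Lemma near_b (z : V * R^o) : W z.1 -> z.2 != 0 -> \forall w \near z, W w.1 /\ w.2 != 0.
Proof.
move=> Wz z0; apply: filterS (near_open (chart_open cB (B_atlas gd)) (dom_b Wz z0)) => w.
by case.
Qed.

Lemma rep_om z i : W z.1 -> z.2 != 0 ->
  \forall w \near z, forall a, bo c i w a = rep1 BU b (om i) w a.
Proof.
by move=> Wz z0; apply: filterS (near_b Wz z0) => w [Ww w0] a; rewrite /rep1 om_chart.
Qed.

Lemma smf_om z i : W z.1 -> z.2 != 0 -> smf (rep1 BU b (om i)) z.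
Proof. by move=> Wz z0; apply: smf_ext (rep_om i Wz z0) _; apply: smf_bo => //; exact: bdata_gauge gd Wz. Qed.

Lemma dform_om z i a a' : W z.1 -> z.2 != 0 ->
  dform BU (om i) (par b z) (dpatch BU b z a) (dpatch BU b z a') = cd (bo c i) z a a'.
Proof.
move=> Wz z0; rewrite (dformE cB a a' (B_atlas gd) (dom_b Wz z0) (smf_om i Wz z0)).
by symmetry; apply: cd_ext; exact: rep_om.
Qed.

Lemma Ev_spec z i j : W z.1 -> z.2 != 0 -> om j (par b z) (Ev i (par b z)) = (i == j)%:R.
Proof.
move=> Wz z0; rewrite /Ev; case: xgetP => [v _ ->//|/(_ (dpatch BU b z (bev x z i)))].
case=> k; rewrite om_chart//; apply: bo_bev => //; exact: bdata_gauge gd Wz.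
Qed.
End Chart.

Lemma EvE p i j : Bs p -> om j p (Ev i p) = (i == j)%:R.
Proof. by move=> /bdata_chart [P [W [e [z [gd Wz z0 <-]]]]]; exact: Ev_spec gd _ _ _ Wz z0. Qed.

Definition streq (be : V * R^o -> R) (s1 s2 : R) p := forall v w,
  [/\ dform BU (om i1) p v w = - (be v * om i1 p w - be w * om i1 p v)
        + s1 * wedge (om i2) (om i3) p v w,
      dform BU (om i2) p v w = (be v * om i2 p w - be w * om i2 p v)
        + s2 * wedge (om i3) (om i1) p v w &
      dform BU (om i3) p v w = wedge (om i1) (om i2) p v w].

Lemma streq_ext be be' s1 s2 p : (forall v, be v = be' v) -> streq be s1 s2 p -> streq be' s1 s2 p.
Proof. by move=> E H v w; rewrite -!E; exact: H. Qed.

(** Stated at one point and for arbitrary be, so as to apply both to a given connection and to the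
    chart formula of [streq_chart]; the chart-free [alB] is thereby equal to each of them. *)
Lemma streq_alB be s1 s2 p : Bs p -> streq be s1 s2 p ->
  [/\ forall v, be v = alB p v, s1 = dform BU (om i1) p (Ev i2 p) (Ev i3 p) &
    s2 = dform BU (om i2) p (Ev i3 p) (Ev i1 p)].
Proof.
move=> Bp H; have E i j := EvE i j Bp; split.
- move=> v; apply: (connection_unique (o1 := om i1 p) (o2 := om i2 p) (o3 := om i3 p)
    (a1 := s1) (a2 := s2) (O1 := dform BU (om i1) p) (O2 := dform BU (om i2) p) (be := be)
    (e1 := Ev i1 p) (e2 := Ev i2 p)); rewrite ?E ?iE //.
  + by move=> u w; have [-> _ _] := H u w.
  + by move=> u w; have [_ -> _] := H u w.
- by have [-> _ _] := H (Ev i2 p) (Ev i3 p); rewrite /wedge !E !iE; move: (be _) (be _) => r1 r2 /=; ring.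
- by have [_ -> _] := H (Ev i3 p) (Ev i1 p); rewrite /wedge !E !iE; move: (be _) (be _) => r1 r2 /=; ring.
Qed.

Lemma streq_chart P W e (z : V * R^o) : bdata P W e -> W z.1 -> z.2 != 0 ->
  streq (fun v => bal (cf P e) (xf M P e) z (tcoord BU (bpatch P W e) (par (bpatch P W e) z) v))
   (str (cf P e) (xf M P e) i1 i2 i3 z.1 / z.2 ^+ 2)
   (z.2 ^+ 2 * str (cf P e) (xf M P e) i2 i3 i1 z.1) (par (bpatch P W e) z).
Proof.
move=> gd Wz z0 v w; have g := bdata_gauge gd Wz.
have tK u := tcoordK cB u (B_atlas gd) (dom_b P e Wz z0).
move: (tK v) (tK w); move: (tcoord _ _ _ v) (tcoord _ _ _ w) => a a' <- <-.
have Dm i := dform_om gd i a a' Wz z0; have Om i u := om_chart i u gd Wz z0.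
have h1 := cd_bo1 g z0 a a'.
have h2 := cd_bo2 g z0 a a'.
have h3 := cd_bo3 g z0 a a'.
rewrite -(Dm i1) in h1.
rewrite -(Dm i2) in h2.
rewrite -(Dm i3) in h3.
rewrite -(Om i1 a) in h1.
rewrite -(Om i1 a') in h1.
rewrite -(Om i2 a) -(Om i2 a') -(Om i3 a) -(Om i3 a') in h1.
rewrite -(Om i1 a) -(Om i1 a') -(Om i2 a) -(Om i2 a') -(Om i3 a) -(Om i3 a') in h2.
rewrite -(Om i1 a) -(Om i1 a') -(Om i2 a) -(Om i2 a') in h3.
split; [exact (h1 _)|exact (h2 _)|exact (h3 _)].
Qed.

Lemma alB_chart P W e (z : V * R^o) a : bdata P W e -> W z.1 -> z.2 != 0 ->
  alB (par (bpatch P W e) z) (dpatch BU (bpatch P W e) z a) = bal (cf P e) (xf M P e) z a.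
Proof.
move=> gd Wz z0; have Bz : Bs (par (bpatch P W e) z) by exact: (bdata_Bs gd).
have [H _ _] := streq_alB Bz (streq_chart gd Wz z0); rewrite -H.
by rewrite (dpatchK cB a (B_atlas gd) (dom_b P e Wz z0)).
Qed.

Lemma adapted_streq al : adapted_connection M L1 L2 U eta al ->
  exists s1 s2 : T * 'M[R]_3 -> R, forall p, Bs p -> streq (al p) (s1 p) (s2 p) p.
Proof. by move=> [_ [s1 [s2 [_ _ H]]]]; exists s1, s2 => p Bp v w; exact: H. Qed.

Lemma connection_alB al : adapted_connection M L1 L2 U eta al ->
  forall p v, Bs p -> al p v = alB p v.
Proof. by move=> /adapted_streq [s1 [s2 H]] p v Bp; have [+ _ _] := streq_alB Bp (H p Bp); apply. Qed.

Lemma a1_chart P W e (z : V * R^o) : bdata P W e -> W z.1 -> z.2 != 0 ->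
  dform BU (om i1) (par (bpatch P W e) z) (Ev i2 (par (bpatch P W e) z)) (Ev i3 (par (bpatch P W e) z))
  = str (cf P e) (xf M P e) i1 i2 i3 z.1 / z.2 ^+ 2.
Proof.
move=> gd Wz z0; have Bz : Bs (par (bpatch P W e) z) := bdata_Bs gd Wz z0.
by have [_ H _] := streq_alB Bz (streq_chart gd Wz z0); exact: esym H.
Qed.

Lemma a2_chart P W e (z : V * R^o) : bdata P W e -> W z.1 -> z.2 != 0 ->
  dform BU (om i2) (par (bpatch P W e) z) (Ev i3 (par (bpatch P W e) z)) (Ev i1 (par (bpatch P W e) z))
  = z.2 ^+ 2 * str (cf P e) (xf M P e) i2 i3 i1 z.1.
Proof.
move=> gd Wz z0; have Bz : Bs (par (bpatch P W e) z) := bdata_Bs gd Wz z0.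
by have [_ _ H] := streq_alB Bz (streq_chart gd Wz z0); exact: esym H.
Qed.

Lemma B_smooth_fun (f : T * 'M[R]_3 -> R) : (forall P W e, bdata P W e ->
  exists k : V * R^o -> R^o, forall z, W z.1 -> z.2 != 0 -> sm k z /\ f (par (bpatch P W e) z) = k z) ->
  smooth_fun BU Bs f.
Proof.
move=> H; apply: (smooth_fun_intro cB) => p Bp.
have [P [W [e [z [gd Wz z0 zp]]]]] := bdata_chart Bp; have [k Hk] := H _ _ _ gd.
exists (bpatch P W e), z; split; [exact: B_atlas|exact: dom_b|exact: zp|].
apply: sm_ext (Hk z Wz z0).1; apply: filterS (near_b gd Wz z0) => w [Ww w0].
by have [_ E] := Hk w Ww w0; exact: esym E.
Qed.

Lemma sm_at_fst (k : V -> R^o) (z : V * R^o) : sm k z.1 -> sm (fun w : V * R^o => k w.1 : R^o) z.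
Proof. exact: (sm_comp1 (g := k) (sm_fst z)). Qed.

Lemma alB_rep P W e z : bdata P W e -> W z.1 -> z.2 != 0 ->
  \forall w \near z, forall a, bal (cf P e) (xf M P e) w a = rep1 BU (bpatch P W e) alB w a.
Proof.
by move=> gd Wz z0; apply: filterS (near_b gd Wz z0) => w [Ww w0] a; rewrite /rep1 alB_chart.
Qed.

Lemma smf_alB P W e z : bdata P W e -> W z.1 -> z.2 != 0 ->
  smf (rep1 BU (bpatch P W e) alB) z.
Proof.
move=> gd Wz z0; apply: smf_ext (alB_rep gd Wz z0) _.
exact: smf_bal (bdata_gauge gd Wz) z0.
Qed.

Lemma alB_form1 : is_form1 BU Bs alB.
Proof.
apply: (form1_intro cB) => p Bp; have [P [W [e [z [gd Wz z0 zp]]]]] := bdata_chart Bp.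
exists (bpatch P W e), z; split; [exact: B_atlas|exact: dom_b|exact: zp|].
exact: smf_alB.
Qed.

Lemma Bact_par (P : patch T V) W e (z : V * R^o) (s : R) :
  Bact s (par (bpatch P W e) z) = par (bpatch P W e) (z.1, z.2 * s).
Proof. by rewrite /Bact /= -mulmxA rho_mul. Qed.

Lemma alB_generator p : Bs p -> alB p (generator M L1 L2 U eta p) = 1.
Proof.
move=> Bp; have [aQ rQ] := patch_atP cB Bp; have [dQ eQ] := coord_rng rQ.
case: (aQ) => P [W [e [aP [oW WP] ce' Ze EQ]]].
have gd : bdata P W e by split.
have {}EQ : patch_at BU p = bpatch P W e by exact: EQ.
move: dQ eQ; rewrite EQ; set z := coord _ p; move=> [Wz z0] zp.
(* In a bundle chart the action multiplies the fibre coordinate z.2 by s, so the generating field is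
   z.2 d/ds, on which ds/s takes the value 1. *)
have E : generator M L1 L2 U eta p = (0, z.2).
  rewrite /generator EQ.
  transitivity ('D_1 (fun s : R^o => (z.1, z.2 * s) : V * R^o) 1).
    apply: D_ext; have n0 : \forall s \near (1 : R^o), s != 0.
      by apply: near_neq0; [exact: oner_neq0|exact: sm_cont (sm_id _)].
    apply: filterS n0 => s s0; rewrite -zp Bact_par (coordK cB (B_atlas gd))//.
    by split=> //=; rewrite /nz /= mulf_neq0.
  have s1 : sm (fun s : R^o => z.2 * s : R^o) 1 by apply: sm_mul; [exact: sm_cst|exact: sm_id].
  rewrite (D_pair _ (sm_cst z.1 _) s1) D_cst (D_mul _ (sm_cst (z.2 : R^o) _) (sm_id _)) D_cst D_id.
  by rewrite mulr1 mulr0 addr0.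
rewrite E -(dpatch_self cB (0, z.2) Bp) EQ -/z -zp (alB_chart _ gd Wz z0) balE /=.
rewrite divff// (scal0 (smf_lin (smf_alf (bdata_gauge gd Wz)))) addr0.
by [].
Qed.

Lemma Bact_smooth s p : s != 0 -> Bs p -> smooth_at BU BU (Bact s) p.
Proof.
move=> s0 Bp; have [P [W [e [z [gd Wz z0 <-]]]]] := bdata_chart Bp.
have n : \forall w \near z, rng (bpatch P W e) (Bact s (par (bpatch P W e) w)) /\
   coord (bpatch P W e) (Bact s (par (bpatch P W e) w)) = (w.1, w.2 * s).
  apply: filterS (near_b gd Wz z0) => w [Ww w0].
  have dw : dom (bpatch P W e) (w.1, w.2 * s) by split=> //=; rewrite /nz /= mulf_neq0.
  by rewrite Bact_par (coordK cB (B_atlas gd) dw); split=> //; exact: rng_par.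
exists (bpatch P W e), (bpatch P W e), z; split=> //; [exact: B_atlas|exact: B_atlas|].
split; first by apply: filterS n => w [].
apply: (sm_ext (f := fun w : V * R^o => (w.1, w.2 * s) : V * R^o)).
  by apply: filterS n => w [_ <-].
by apply: sm_pair; [exact: sm_fst|apply: sm_mul; [exact: sm_snd|exact: sm_cst]].
Qed.

Lemma alB_invariant s p v : s != 0 -> Bs p -> pull1 BU BU (Bact s) alB p v = alB p v.
Proof.
move=> s0 Bp; have [P [W [e [z [gd Wz z0 zp]]]]] := bdata_chart Bp; subst p.
rewrite -(tcoordK cB v (B_atlas gd) (dom_b P e Wz z0)); move: (tcoord _ _ _ v) => a.
set b := bpatch P W e.
have dw w : W w.1 -> w.2 != 0 -> dom b (w.1, w.2 * s).
  by move=> Ww w0; split=> //=; rewrite /nz /= mulf_neq0.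
have cw w : W w.1 -> w.2 != 0 -> coord b (Bact s (par b w)) = (w.1, w.2 * s).
  by move=> Ww w0; rewrite Bact_par (coordK cB (B_atlas gd) (dw w Ww w0)).
have rz : rng b (Bact s (par b z)) by rewrite Bact_par; apply: rng_par; exact: dw.
rewrite /pull1 (mdiffE cB cB a (B_atlas gd) (B_atlas gd) (dom_b P e Wz z0) rz (Bact_smooth s0 Bp)).
rewrite (cw z Wz z0).
have -> : 'D_a (coord b \o Bact s \o par b) z = (a.1, a.2 * s).
  transitivity ('D_a (fun w : V * R^o => (w.1, w.2 * s) : V * R^o) z).
    by apply: D_ext; apply: filterS (near_b gd Wz z0) => w [Ww w0]; exact: cw.
  have s1 : sm (fun w : V * R^o => w.2 * s : R^o) z by apply: sm_mul; [exact: sm_snd|exact: sm_cst].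
  rewrite (D_pair _ (sm_fst z) s1) D_fst (D_mul _ (sm_snd z) (sm_cst (s : R^o) z)) D_cst D_snd.
  by rewrite mulr0 add0r mulrC.
rewrite Bact_par (alB_chart _ gd (z := (z.1, z.2 * s)))//=; last by rewrite mulf_neq0.
by rewrite (alB_chart _ gd Wz z0) !balE /= -mulf_div divff// mulr1.
Qed.

Lemma alB_adapted : adapted_connection M L1 L2 U eta alB.
Proof.
split.
  split; [exact: alB_form1|exact: alB_generator|exact: alB_invariant].
exists (fun p => dform BU (om i1) p (Ev i2 p) (Ev i3 p)), (fun p => dform BU (om i2) p (Ev i3 p) (Ev i1 p)).
have iv (z : V * R^o) : z.2 != 0 -> sm (fun w : V * R^o => w.2 ^+ 2 : R^o) z.
  by move=> z0; apply: sm_mul; exact: sm_snd.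
split.
- apply: B_smooth_fun => P W e gd.
  exists (fun z => str (cf P e) (xf M P e) i1 i2 i3 z.1 / z.2 ^+ 2) => z Wz z0.
  split; last exact: a1_chart gd Wz z0.
  apply: sm_mul.
    exact: (sm_at_fst (k := str _ _ i1 i2 i3) (sm_str (bdata_gauge gd Wz) i1 i2 i3)).
  by apply: sm_inv (iv z z0); rewrite expf_neq0.
- apply: B_smooth_fun => P W e gd.
  exists (fun z => z.2 ^+ 2 * str (cf P e) (xf M P e) i2 i3 i1 z.1) => z Wz z0.
  split; last exact: a2_chart gd Wz z0.
  apply: sm_mul; first exact: iv.
  exact: (sm_at_fst (k := str _ _ i2 i3 i1) (sm_str (bdata_gauge gd Wz) i2 i3 i1)).
- move=> p v w Bp; have [P [W [e [z [gd Wz z0 zp]]]]] := bdata_chart Bp.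
  rewrite -zp (a1_chart gd Wz z0) (a2_chart gd Wz z0).
  have Bz : Bs (par (bpatch P W e) z) := bdata_Bs gd Wz z0.
  have [E _ _] := streq_alB Bz (streq_chart gd Wz z0).
  exact: (streq_ext E (streq_chart gd Wz z0)).
Qed.

Lemma dform_alB P W e (z : V * R^o) a a' : bdata P W e -> W z.1 -> z.2 != 0 ->
  dform BU alB (par (bpatch P W e) z) (dpatch BU (bpatch P W e) z a) (dpatch BU (bpatch P W e) z a')
  = cd (bal (cf P e) (xf M P e)) z a a'.
Proof.
move=> gd Wz z0; rewrite (dformE cB a a' (B_atlas gd) (dom_b P e Wz z0) (smf_alB gd Wz z0)).
by symmetry; apply: cd_ext; exact: alB_rep.
Qed.

Definition dal (p : T * 'M[R]_3) i j := dform BU alB p (Ev i p) (Ev j p).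

Definition curveq (k1 k2 k3 : R) p := forall v w, dform BU alB p v w =
  k1 * wedge (om i2) (om i3) p v w + k2 * wedge (om i3) (om i1) p v w
  + k3 * wedge (om i1) (om i2) p v w.

Lemma curveq_unique k1 k2 k3 p : Bs p -> curveq k1 k2 k3 p ->
  [/\ k1 = dal p i2 i3, k2 = dal p i3 i1 & k3 = dal p i1 i2].
Proof.
move=> Bp H; have E i j := EvE i j Bp.
by rewrite /dal !H /wedge !E !iE /=; split; ring.
Qed.

Lemma curveq_chart P W e (z : V * R^o) : bdata P W e -> W z.1 -> z.2 != 0 ->
  curveq (cd (alf (cf P e) (xf M P e)) z.1 (xf M P e i2 z.1) (xf M P e i3 z.1) / z.2)
   (z.2 * cd (alf (cf P e) (xf M P e)) z.1 (xf M P e i3 z.1) (xf M P e i1 z.1))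
   (Kf (cf P e) (xf M P e) z.1) (par (bpatch P W e) z).
Proof.
move=> gd Wz z0 v w; have g := bdata_gauge gd Wz.
have tK u := tcoordK cB u (B_atlas gd) (dom_b P e Wz z0).
move: (tK v) (tK w); move: (tcoord _ _ _ v) (tcoord _ _ _ w) => a a' <- <-.
have Om i u := om_chart i u gd Wz z0.
have h := cd_bal_expand g z0 a a'.
rewrite -(dform_alB a a' gd Wz z0) in h.
rewrite -(Om i1 a) -(Om i1 a') -(Om i2 a) -(Om i2 a') -(Om i3 a) -(Om i3 a') in h.
by rewrite /wedge; exact (h _).
Qed.

Lemma dal_chart P W e (z : V * R^o) : bdata P W e -> W z.1 -> z.2 != 0 ->
  [/\ dal (par (bpatch P W e) z) i2 i3 =
        cd (alf (cf P e) (xf M P e)) z.1 (xf M P e i2 z.1) (xf M P e i3 z.1) / z.2,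
    dal (par (bpatch P W e) z) i3 i1 =
        z.2 * cd (alf (cf P e) (xf M P e)) z.1 (xf M P e i3 z.1) (xf M P e i1 z.1) &
    dal (par (bpatch P W e) z) i1 i2 = Kf (cf P e) (xf M P e) z.1].
Proof.
move=> gd Wz z0; have Bz : Bs (par (bpatch P W e) z) := bdata_Bs gd Wz z0.
by have [H1 H2 H3] := curveq_unique Bz (curveq_chart gd Wz z0); rewrite -H1 -H2 -H3.
Qed.

Lemma dform_connection al p v w : adapted_connection M L1 L2 U eta al -> Bs p ->
  dform BU al p v w = dform BU alB p v w.
Proof.
move=> aal Bp; apply: (dform_ext cB v w (mopen_pts cB) Bp) => q Bq.
by apply/funext => u; exact: (connection_alB aal).
Qed.

Lemma curvature_unique al K : adapted_connection M L1 L2 U eta al ->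
  curvature_fun M L1 L2 U eta al K -> forall p, Bs p -> K p = dal p i1 i2.
Proof.
move=> aal [b1 [b2 [_ _ _ H]]] p Bp.
have H' : curveq (b1 p) (b2 p) (K p) p.
  by move=> v w; rewrite -(dform_connection v w aal Bp); exact: H.
by have [] := curveq_unique Bp H'.
Qed.

Lemma curvature_exists al : adapted_connection M L1 L2 U eta al ->
  curvature_fun M L1 L2 U eta al (fun p => dal p i1 i2).
Proof.
move=> aal; exists (fun p => dal p i2 i3), (fun p => dal p i3 i1); split.
- apply: B_smooth_fun => P W e gd.
  exists (fun z => cd (alf (cf P e) (xf M P e)) z.1 (xf M P e i2 z.1) (xf M P e i3 z.1) / z.2) => z Wz z0.
  have g := bdata_gauge gd Wz; split; last by have [] := dal_chart gd Wz z0.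
  apply: sm_mul; last exact: sm_sndV.
  exact: (sm_at_fst (sm_cd (smf_alf g) (gauge_sm g i2) (gauge_sm g i3))).
- apply: B_smooth_fun => P W e gd.
  exists (fun z => z.2 * cd (alf (cf P e) (xf M P e)) z.1 (xf M P e i3 z.1) (xf M P e i1 z.1)) => z Wz z0.
  have g := bdata_gauge gd Wz; split; last by have [] := dal_chart gd Wz z0.
  apply: sm_mul; first exact: sm_snd.
  exact: (sm_at_fst (sm_cd (smf_alf g) (gauge_sm g i3) (gauge_sm g i1))).
- apply: B_smooth_fun => P W e gd.
  exists (fun z => Kf (cf P e) (xf M P e) z.1) => z Wz z0.
  have g := bdata_gauge gd Wz; split; last by have [] := dal_chart gd Wz z0.
  exact: (sm_at_fst (sm_Kf g)).
- move=> p v w Bp; rewrite (dform_connection v w aal Bp).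
  have [P [W [e [z [gd Wz z0 zp]]]]] := bdata_chart Bp.
  by have [E1 E2 E3] := dal_chart gd Wz z0; rewrite -zp E1 E2 E3; exact: curveq_chart.
Qed.

(** In om1 . om2 the factors 1/s and s cancel; the fibre coordinate enters only through ds/s. *)
Lemma gB_chart al K P W e (z : V * R^o) a b : adapted_connection M L1 L2 U eta al ->
  curvature_fun M L1 L2 U eta al K -> bdata P W e -> W z.1 -> z.2 != 0 ->
  gB M L1 L2 U eta al K (par (bpatch P W e) z) (dpatch BU (bpatch P W e) z a) (dpatch BU (bpatch P W e) z b)
  = Feff (cf P e) (xf M P e) z.1 a.1 (z.2^-1 * a.2) b.1 (z.2^-1 * b.2).
Proof.
move=> aal cK gd Wz z0; have Bz : Bs (par (bpatch P W e) z) := bdata_Bs gd Wz z0.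
have Om i u := om_chart i u gd Wz z0.
have A u : al (par (bpatch P W e) z) (dpatch BU (bpatch P W e) z u) = z.2^-1 * u.2 + alf (cf P e) (xf M P e) z.1 u.1.
  by rewrite (connection_alB aal _ Bz) (alB_chart _ gd Wz z0) balE mulrC.
have EK : K (par (bpatch P W e) z) = Kf (cf P e) (xf M P e) z.1.
  by rewrite (curvature_unique aal cK Bz); have [] := dal_chart gd Wz z0.
move: (A a) (A b) (Om i1 a) (Om i1 b) (Om i2 a) (Om i2 b) (Om i3 a) (Om i3 b) EK; clear A Om Bz.
move: (par _ z) (dpatch BU _ z a) (dpatch BU _ z b) => p va vb E1 E2 E3 E4 E5 E6 E7 E8 E9.
rewrite /gB /symprod /sigma E1 E2 E3 E4 E5 E6 E7 E8 E9 !bo1E !bo2E !bo3E /Feff /sg.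
move: (alf _ _ _ _) (alf _ _ _ _) (Kf _ _ _) (cf P e i1 _ a.1) (cf P e i1 _ b.1) (cf P e i2 _ a.1) (cf P e i2 _ b.1)
  (cf P e i3 _ a.1) (cf P e i3 _ b.1) z0; move: (z.2) (a.2) (b.2) => *; field.
by [].
Qed.

Lemma gB_metric al K : adapted_connection M L1 L2 U eta al ->
  curvature_fun M L1 L2 U eta al K -> is_metric22 BU Bs (gB M L1 L2 U eta al K).
Proof.
move=> aal cK; apply: (metric22_chart cB (mopen_pts cB)) => p Bp.
have [P [W [e [z [gd Wz z0 zp]]]]] := bdata_chart Bp.
exists (bpatch P W e), z, (cf P e), (xf M P e), (fun z => z.2^-1); split.
- by split; [exact: B_atlas|exact: dom_b|exact: zp].
- exact: bdata_gauge gd Wz.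
- exact: sm_sndV.
- by rewrite invr_neq0.
- by apply: filterS (near_b gd Wz z0) => w [Ww w0] a b; exact: gB_chart.
Qed.

End Connection.

#[local] Opaque Defs.om Defs.dform Defs.mdiff Defs.dpatch Defs.tcoord.

(** * The manifold SD *)

Section Rays.
Context {R : realType}.
Local Notation V := 'rV[R]_3.
Implicit Types (X Y : V).

Lemma ray_self X : ray X X.
Proof. by exists 1; rewrite ?scale1r. Qed.

Lemma ray_scale (t : R) X : 0 < t -> ray (t *: X) = ray X.
Proof.
move=> t0; apply/seteqP; split=> Y [s s0 ->].
  by exists (s * t); rewrite ?mulr_gt0// scalerA.
by exists (s / t); rewrite ?divr_gt0// scalerA divfK// gt_eqF.
Qed.

Lemma ray_eq X Y : ray X = ray Y -> exists2 t, 0 < t & Y = t *: X.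
Proof. by move=> E; have := ray_self Y; rewrite -E. Qed.

Definition indep (X Y : V) := forall a b : R, a *: X + b *: Y = 0 -> a = 0 /\ b = 0.

Lemma indep_eq X Y (a b c d : R) : indep X Y ->
  a *: X + b *: Y = c *: X + d *: Y -> a = c /\ b = d.
Proof.
move=> H E; have [] := H (a - c) (b - d).
  by rewrite !scalerBl addrACA -opprD E subrr.
by move=> /eqP; rewrite subr_eq0 => /eqP -> /eqP; rewrite subr_eq0 => /eqP ->.
Qed.

Lemma indep_neq0 X Y (a b : R) : indep X Y -> (a != 0) || (b != 0) -> a *: X + b *: Y != 0.
Proof. by move=> H n; apply/eqP => /H [a0 b0]; move: n; rewrite a0 b0 eqxx. Qed.

Lemma comb_scale (c a b : R) X Y : c *: (a *: X + b *: Y) = (c * a) *: X + (c * b) *: Y.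
Proof. by rewrite scalerDr !scalerA. Qed.

Lemma ray_comb X Y (a b c d : R) : indep X Y ->
  ray (a *: X + b *: Y) = ray (c *: X + d *: Y) -> exists2 t, 0 < t & c = t * a /\ d = t * b.
Proof. by move=> H /ray_eq [t t0]; rewrite comb_scale => /(indep_eq H); exists t. Qed.

End Rays.

Section SDmanifold.
Context {R : realType} {T : Type}.
Local Notation V := 'rV[R]_3.
Variables (M : premanifold T V) (L1 L2 : T -> set V).
Hypothesis hM : path_geometry M L1 L2.
Let cM := cM hM.
Local Notation SDM := (SD M L1 L2).
Local Notation D := (D L1 L2).

Definition sdpatch (P : patch T V) (W : set V) (Y1 Y2 : T -> V) : patch (T * set V)%type (V * R^o)%type :=
  Patch [set z : V * R^o | W z.1]
    (fun z => (par P z.1, ray (z.2 *: Y1 (par P z.1) + Y2 (par P z.1)))).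

Definition sddata P W Y1 Y2 := [/\ atlas M P, open W, W `<=` dom P &
  frame_on M L1 L2 (par P @` W) Y1 Y2].

Lemma sd_atlas P W Y1 Y2 : sddata P W Y1 Y2 -> atlas SDM (sdpatch P W Y1 Y2).
Proof. by move=> [aP oW WP fr]; exists P, W, Y1, Y2. Qed.

Lemma sd_indep P W Y1 Y2 y : sddata P W Y1 Y2 -> W y -> indep (Y1 (par P y)) (Y2 (par P y)).
Proof. by move=> [_ _ _ [_ _ fr]] Wy; apply: (fr (par P y) _).1; exists y. Qed.

Lemma sd_D P W Y1 Y2 y : sddata P W Y1 Y2 -> W y ->
  D (par P y) = [set v | exists a b : R, v = a *: Y1 (par P y) + b *: Y2 (par P y)].
Proof. by move=> [_ _ _ [_ _ fr]] Wy; apply: (fr (par P y) _).2; exists y. Qed.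

Lemma sd_dom P W Y1 Y2 y : sddata P W Y1 Y2 -> W y -> dom P y.
Proof. by move=> [_ _ WP _]; exact: WP. Qed.

Lemma sd_aP P W Y1 Y2 : sddata P W Y1 Y2 -> atlas M P. Proof. by case. Qed.

Lemma sd_pts P W Y1 Y2 y (a b : R) : sddata P W Y1 Y2 -> W y -> (a != 0) || (b != 0) ->
  pts SDM (par P y, ray (a *: Y1 (par P y) + b *: Y2 (par P y))).
Proof.
move=> sd Wy ab; split; first exact: (chart_pts cM (sd_aP sd) (sd_dom sd Wy)).
exists (a *: Y1 (par P y) + b *: Y2 (par P y)); split=> //.
  by rewrite (sd_D sd Wy); exists a, b.
by apply: indep_neq0 => //; exact: sd_indep sd Wy.
Qed.

Lemma sd_par P W Y1 Y2 y (a b : R) : 0 < b ->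
  (par P y, ray (a *: Y1 (par P y) + b *: Y2 (par P y))) = par (sdpatch P W Y1 Y2) (y, a / b).
Proof.
move=> b0; congr pair; rewrite -[in RHS](ray_scale _ b0) scalerDr scalerA mulrC divfK//.
by rewrite gt_eqF.
Qed.

Lemma sd_inj P W Y1 Y2 : sddata P W Y1 Y2 ->
  {in dom (sdpatch P W Y1 Y2) &, injective (par (sdpatch P W Y1 Y2))}.
Proof.
move=> sd [y t] [y' t']; rewrite !inE /= => Wy Wy' [Ey].
have {}Ey : y = y'.
  rewrite -(coordK cM (sd_aP sd) (sd_dom sd Wy)) Ey.
  exact: (coordK cM (sd_aP sd) (sd_dom sd Wy')).
subst y'; rewrite -[Y2 _ in LHS]scale1r -[Y2 _ in RHS]scale1r.
move=> /(ray_comb (sd_indep sd Wy)) [c c0 [Et Ec]].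
by move: Et; rewrite -[c]mulr1 -Ec mul1r => ->.
Qed.

Lemma sd_coordK P W Y1 Y2 z : sddata P W Y1 Y2 -> W z.1 ->
  coord (sdpatch P W Y1 Y2) (par (sdpatch P W Y1 Y2) z) = z.
Proof.
move=> sd Wz; have dz : dom (sdpatch P W Y1 Y2) z by [].
by have [d e] := coord_rng (rng_par dz); apply: (sd_inj sd) => //; rewrite inE.
Qed.

Lemma sd_coord P W Y1 Y2 y (a b : R) : sddata P W Y1 Y2 -> W y -> 0 < b ->
  let p := (par P y, ray (a *: Y1 (par P y) + b *: Y2 (par P y))) in
  rng (sdpatch P W Y1 Y2) p /\ coord (sdpatch P W Y1 Y2) p = (y, a / b).
Proof.
move=> sd Wy b0 p; have E : p = par (sdpatch P W Y1 Y2) (y, a / b) := sd_par P W _ _ _ _ b0.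
by rewrite E; split; [apply: rng_par|exact: sd_coordK].
Qed.

Lemma sm_dform_fields U eta O F G P y : contact_form M L1 L2 U eta -> mopen M O ->
  smooth_field M O F -> smooth_field M O G -> atlas M P -> dom P y -> U (par P y) -> O (par P y) ->
  sm (fun z => dform M eta (par P z) (F (par P z)) (G (par P z)) : R^o) y.
Proof.
move=> [oU fe _ _] oO sF sG aP Py Uy Oy.
apply: (sm_ext (f := fun z => cd (rep1 M P eta) z (tcoord M P (par P z) (F (par P z)))
    (tcoord M P (par P z) (G (par P z))) : R^o)); last first.
  apply: sm_cd; first exact: (form1_smf cM oU fe).
    exact: (smooth_field_sm oO sF).
  exact: (smooth_field_sm oO sG).
apply: filterS (mopen_near oU aP Py Uy) => z [Pz Uz].
rewrite -(dformE cM _ _ aP Pz (form1_smf cM oU fe aP Pz Uz)).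
exact: (f_equal2 (dform M eta (par P z)) (tcoordK cM _ aP Pz) (tcoordK cM _ aP Pz)).
Qed.

(* [d eta] restricts to an area form on D, so it computes the components of a vector of D
   in a frame; this makes the transition functions of SD smooth. *)
Lemma coef_dform U eta x (Y1 Y2 Z1 Z2 : V) (t a b : R) : contact_form M L1 L2 U eta -> U x ->
  D x = [set v | exists a b : R, v = a *: Y1 + b *: Y2] ->
  t *: Z1 + Z2 = a *: Y1 + b *: Y2 ->
  [/\ dform M eta x Y1 Y2 != 0,
    t * dform M eta x Z1 Y2 + dform M eta x Z2 Y2 = a * dform M eta x Y1 Y2 &
    t * dform M eta x Y1 Z1 + dform M eta x Y1 Z2 = b * dform M eta x Y1 Y2].
Proof.
move=> ce Ux eD E; have [oU fe _ _] := ce.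
have al := dform_alt2 hM oU fe Ux.
have [d0 _] := contact_nondeg hM ce Ux eD; split; first exact: d0.
  transitivity (dform M eta x (t *: Z1 + Z2) Y2); first by rewrite (scalD (al.1 _)) (scalZ (al.1 _)).
  by rewrite E (scalD (al.1 _)) !(scalZ (al.1 _)) (alt2_0 _ al) mulr0 addr0.
transitivity (dform M eta x Y1 (t *: Z1 + Z2)); first by rewrite (scalD (alt2r al _)) (scalZ (alt2r al _)).
by rewrite E (scalD (alt2r al _)) !(scalZ (alt2r al _)) (alt2_0 _ al) mulr0 add0r.
Qed.

Lemma sd_mopen P W Y1 Y2 : sddata P W Y1 Y2 -> mopen M (par P @` W).
Proof. by move=> [aP oW WP _]; exact: mopen_par. Qed.

Lemma sd_trans P W Y1 Y2 P' W' Y1' Y2' (z : V * R^o) : sddata P W Y1 Y2 -> sddata P' W' Y1' Y2' ->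
  W z.1 -> rng (sdpatch P' W' Y1' Y2') (par (sdpatch P W Y1 Y2) z) ->
  (\forall w \near z, W w.1 /\ rng (sdpatch P' W' Y1' Y2') (par (sdpatch P W Y1 Y2) w)) /\
  sm (coord (sdpatch P' W' Y1' Y2') \o par (sdpatch P W Y1 Y2)) z.
Proof.
move=> sd sd' Wz [[y' t'] /= Wy' [Ex Er]].
have [aP oW WP [s1 s2 _]] := sd; have [aP' oW' WP' [s1' s2' _]] := sd'.
have oO : mopen M (par P @` W `&` par P' @` W') by exact: (mopenI (sd_mopen sd) (sd_mopen sd')).
have Mx := chart_pts cM aP (WP _ Wz).
have [_ _ _ _ /(_ _ Mx) [U [eta [Ux ce]]]] := hM; have [oU _ _ _] := ce.
have Oz : (par P @` W `&` par P' @` W') (par P z.1) by split; [exists z.1|exists y'].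
have f1 : smooth_field M (par P @` W `&` par P' @` W') Y1 by apply: smooth_field_sub s1 => ? [].
have f2 : smooth_field M (par P @` W `&` par P' @` W') Y2 by apply: smooth_field_sub s2 => ? [].
have f1' : smooth_field M (par P @` W `&` par P' @` W') Y1' by apply: smooth_field_sub s1' => ? [].
have f2' : smooth_field M (par P @` W `&` par P' @` W') Y2' by apply: smooth_field_sub s2' => ? [].
pose de F G (w : V * R^o) : R^o := dform M eta (par P w.1) (F (par P w.1)) (G (par P w.1)).
have sde F G : smooth_field M (par P @` W `&` par P' @` W') F ->
    smooth_field M (par P @` W `&` par P' @` W') G -> sm (de F G) z.
  move=> sF sG; apply: (sm_comp1 (g := fun y => dform M eta (par P y) (F (par P y)) (G (par P y)) : R^o) (sm_fst z)).
  exact: (sm_dform_fields ce oO sF sG aP (WP _ Wz) Ux Oz).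
pose n1 (w : V * R^o) : R^o := w.2 * de Y1 Y2' w + de Y2 Y2' w.
pose n2 (w : V * R^o) : R^o := w.2 * de Y1' Y1 w + de Y1' Y2 w.
pose a (w : V * R^o) : R^o := n1 w / de Y1' Y2' w.
pose b (w : V * R^o) : R^o := n2 w / de Y1' Y2' w.
have key w : W w.1 -> (par P' @` W') (par P w.1) -> U (par P w.1) ->
    [/\ de Y1' Y2' w != 0 & w.2 *: Y1 (par P w.1) + Y2 (par P w.1) =
      (a w : R) *: Y1' (par P w.1) + (b w : R) *: Y2' (par P w.1)].
  move=> Ww [v Wv Ev] Uw; have eD := sd_D sd' Wv; rewrite Ev in eD.
  have : D (par P w.1) (w.2 *: Y1 (par P w.1) + Y2 (par P w.1)).
    by rewrite (sd_D sd Ww); exists w.2, 1; rewrite scale1r.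
  rewrite eD => -[c [d E]].
  have [d0 Ea Eb] := coef_dform ce Uw eD E.
  split; first exact: d0.
  have -> : a w = c by refine (eq_trans (f_equal (fun r => r / _) Ea) _); exact: (mulfK d0).
  have -> : b w = d by refine (eq_trans (f_equal (fun r => r / _) Eb) _); exact: (mulfK d0).
  exact: E.
have [d0 Ez] := key z Wz Oz.2 Ux.
have sn1 : sm n1 z by apply: sm_add; [apply: sm_mul; [exact: sm_snd|exact: sde]|exact: sde].
have sn2 : sm n2 z by apply: sm_add; [apply: sm_mul; [exact: sm_snd|exact: sde]|exact: sde].
have sdv : sm (fun w => (de Y1' Y2' w)^-1 : R^o) z by apply: sm_inv => //; exact: sde.
have sa : sm a z by exact: sm_mul.
have sb : sm b z by exact: sm_mul.
(* The target chart consists of the rays with positive Y2'-component b, an open condition; its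
   coordinate there is a / b. *)
have bz : 0 < b z.
  move: Er; rewrite Ez Ex -[Y2' _ in LHS]scale1r => /(ray_comb _) [].
    by have := sd_indep sd' Wy'; rewrite Ex.
  by move=> c c0 [_ ->]; rewrite mulr1.
have nn : \forall w \near z, [/\ W w.1, (par P' @` W') (par P w.1) & U (par P w.1)].
  have h := mopen_near (mopenI oO oU) aP (WP _ Wz) (conj Oz Ux).
  have h2 := sm_near_comp (P := fun y => dom P y /\ ((par P @` W `&` par P' @` W') `&` U) (par P y)) (sm_fst z) h.
  have h3 := sm_near_comp (P := W) (sm_fst z) (near_open oW Wz).
  by apply: filterS2 h2 h3 => w [_ [[_ ?] ?]].
have nb : \forall w \near z, 0 < b w by apply: near_gt0 => //; exact: sm_cont sb.
have H : \forall w \near z, [/\ W w.1, rng (sdpatch P' W' Y1' Y2') (par (sdpatch P W Y1 Y2) w) &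
    coord (sdpatch P' W' Y1' Y2') (par (sdpatch P W Y1 Y2) w) = ((coord P' \o par P) w.1, a w / b w)].
  apply: filterS2 nn nb => w [Ww [v Wv Ev] Uw] bw.
  have Hw : (par P' @` W') (par P w.1) by exists v.
  have [_ Ew] := key w Ww Hw Uw.
  have cv : (coord P' \o par P) w.1 = v by rewrite /= -Ev (coordK cM aP' (WP' _ Wv)).
  have -> : par (sdpatch P W Y1 Y2) w = (par P' v, ray ((a w : R) *: Y1' (par P' v) + (b w : R) *: Y2' (par P' v))).
    by rewrite Ev -Ew.
  by have [r c] := sd_coord (a w) sd' Wv bw; rewrite cv; split.
split; first by apply: filterS H => w [].
apply: (sm_ext (f := fun w => ((coord P' \o par P) w.1, a w / b w) : V * R^o)).
  by apply: filterS H => w [_ _ <-].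
apply: sm_pair.
  apply: (sm_comp (g := coord P' \o par P) (sm_fst z)).
  by apply: (trans_sm cM) => //; [exact: WP|rewrite -Ex; apply/rng_par/WP'].
by apply: sm_mul => //; apply: sm_inv => //; rewrite gt_eqF.
Qed.

Lemma field_scale (k : R) O X : mopen M O -> smooth_field M O X -> smooth_field M O (fun x => k *: X x).
Proof.
move=> oO sX; apply: (smooth_field_intro cM) => p Op.
have [P aP rP] : exists2 P, atlas M P & rng P p.
  by case: cM => _ + _; apply; case: oO => + _; apply.
have [d e] := coord_rng rP; exists P, (coord P p); split=> //.
have Oy : O (par P (coord P p)) by rewrite e.
apply: (sm_ext (f := fun z => k *: tcoord M P (par P z) (X (par P z)))).
  apply: filterS (near_dom cM aP d) => z Pz.
  have tl a u v := tcoord_lin cM a u v aP Pz.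
  exact: (esym (linZ (f := tcoord M P (par P z)) tl k (X (par P z)))).
by apply: sm_scalel; exact: (smooth_field_sm oO sX aP d Oy).
Qed.

Lemma field_add O X Y : mopen M O -> smooth_field M O X -> smooth_field M O Y ->
  smooth_field M O (fun x => X x + Y x).
Proof.
move=> oO sX sY; apply: (smooth_field_intro cM) => p Op.
have [P aP rP] : exists2 P, atlas M P & rng P p.
  by case: cM => _ + _; apply; case: oO => + _; apply.
have [d e] := coord_rng rP; exists P, (coord P p); split=> //.
have Oy : O (par P (coord P p)) by rewrite e.
apply: (sm_ext (f := fun z => tcoord M P (par P z) (X (par P z)) + tcoord M P (par P z) (Y (par P z)))).
  apply: filterS (near_dom cM aP d) => z Pz.
  by have := tcoord_lin cM 1 (X (par P z)) (Y (par P z)) aP Pz; rewrite !scale1r.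
by apply: sm_add; [exact: (smooth_field_sm oO sX aP d Oy)|exact: (smooth_field_sm oO sY aP d Oy)].
Qed.

Lemma sd_comb P W Y1 Y2 (a b c d : R) : sddata P W Y1 Y2 -> a * d - b * c != 0 ->
  sddata P W (fun x => a *: Y1 x + b *: Y2 x) (fun x => c *: Y1 x + d *: Y2 x).
Proof.
move=> sd n; have [aP oW WP [s1 s2 fr]] := sd; have oO := sd_mopen sd.
split; [exact: aP|exact: oW|exact: WP|split].
- exact: (field_add oO (field_scale a oO s1) (field_scale b oO s2)).
- exact: (field_add oO (field_scale c oO s1) (field_scale d oO s2)).
move=> x Wx; have [ind eD] := fr x Wx; split.
  move=> k l; rewrite !comb_scale addrACA -!scalerDl => /ind [E1 E2].
  have K0 : k * (a * d - b * c) = 0.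
    by rewrite (_ : _ * _ = d * (k * a + l * c) - c * (k * b + l * d)); [rewrite E1 E2 !mulr0 subrr|ring].
  have L0 : l * (a * d - b * c) = 0.
    by rewrite (_ : _ * _ = a * (k * b + l * d) - b * (k * a + l * c)); [rewrite E1 E2 !mulr0 subrr|ring].
  by move/eqP: K0; move/eqP: L0; rewrite !mulf_eq0 (negPf n) !orbF => /eqP -> /eqP.
rewrite eD; apply/seteqP; split=> v /= [k [l ->]].
  exists ((k * d - l * c) / (a * d - b * c)), ((l * a - k * b) / (a * d - b * c)).
  rewrite !comb_scale addrACA -!scalerDl; congr (_ *: _ + _ *: _); field; exact: n.
exists (k * a + l * c), (k * b + l * d).
by rewrite !comb_scale addrACA -!scalerDl.
Qed.

Lemma sd_local O x : mopen M O -> O x -> exists P W Y1 Y2,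
  [/\ sddata P W Y1 Y2, (par P @` W) x, par P @` W `<=` O &
   forall z, (par P @` W) z -> L1 z = [set c *: Y1 z | c in setT] /\ L2 z = [set c *: Y2 z | c in setT]].
Proof.
move=> oO Ox; have [P [W [Y1 [Y2 [[aP oW WP Wx WO] s1 s2 fr]]]]] := local_frames hM oO Ox.
exists P, W, Y1, Y2; split; [|exact: Wx|exact: WO|].
  split; [exact: aP|exact: oW|exact: WP|split; [exact: s1|exact: s2|]] => z Wz; have [n1 e1 n2 e2] := fr z Wz.
  by apply: (DP hM n1 n2 e1 e2); case: oO => + _; apply; exact: WO.
by move=> z Wz; have [_ ? _ ?] := fr z Wz.
Qed.

Lemma sd_cover p : pts SDM p -> exists P W Y1 Y2 z,
  [/\ sddata P W Y1 Y2, W z.1 & par (sdpatch P W Y1 Y2) z = p].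
Proof.
case: p => x r /= [Mx [X [DX X0 ->]]].
have [P [W [Y1 [Y2 [sd [y Wy Ey] _ _]]]]] := sd_local (mopen_pts cM) Mx.
move: DX; rewrite -Ey (sd_D sd Wy) => -[a [b E]].
(* X = a Y1 + b Y2 is taken as second frame vector and completed by - b Y1 + a Y2. The determinant
   is - (a^2 + b^2), and the ray of X gets the coordinate 0. *)
have ab : (- b) * b - a * a != 0.
  rewrite mulNr -opprD oppr_eq0 -!expr2 paddr_eq0 ?sqr_ge0// !sqrf_eq0.
  apply/negP => /andP[/eqP b0 /eqP a0]; move/eqP: X0; apply.
  by rewrite E a0 b0 !scale0r addr0.
exists P, W, (fun x => (- b) *: Y1 x + a *: Y2 x), (fun x => a *: Y1 x + b *: Y2 x), (y, 0).
split; [exact: sd_comb|exact: Wy|].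
by rewrite /= scale0r add0r E.
Qed.

Lemma SD_charted : charted SDM.
Proof.
split.
- move=> Q [P [W [Y1 [Y2 [aP oW WP fr ->]]]]].
  have sd : sddata P W Y1 Y2 by [].
  split; [|exact: sd_inj|].
    by apply: (open_comp (f := fst)) => // z _; exact: cvg_fst.
  move=> p [[y t] Wy <-]; have h : (t != 0) || ((1 : R) != 0) by rewrite oner_neq0 orbT.
  by have := sd_pts sd Wy h; rewrite scale1r.
- move=> p /sd_cover [P [W [Y1 [Y2 [z [sd Wz <-]]]]]].
  by exists (sdpatch P W Y1 Y2); [exact: sd_atlas|apply: rng_par].
- move=> Q Q' [P [W [Y1 [Y2 [aP oW WP fr ->]]]]] [P' [W' [Y1' [Y2' [aP' oW' WP' fr' ->]]]]].
  have sd : sddata P W Y1 Y2 by split.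
  have sd' : sddata P' W' Y1' Y2' by split.
  move=> A; split.
    rewrite openE => z [Wz rz]; have [n _] := sd_trans sd sd' Wz rz.
    exact: n.
  by apply: smooth_on_sm => z [Wz rz]; have [_] := sd_trans sd sd' Wz rz.
Qed.
Let cS := SD_charted.

Lemma sd_proj A : mopen M A -> mopen SDM [set p | pts SDM p /\ A p.1].
Proof.
move=> oA; apply: (mopen_intro cS); first by move=> p [].
move=> p [Sp Ap]; have [P [W [Y1 [Y2 [z [sd Wz zp]]]]]] := sd_cover Sp.
exists (sdpatch P W Y1 Y2), z; split; [exact: sd_atlas|exact: Wz|exact: zp|].
have Az : A (par P z.1) by move: Ap; rewrite -zp.
have n1 := mopen_near oA (sd_aP sd) (sd_dom sd Wz) Az.
have n2 := sm_near_comp (P := fun y => dom P y /\ A (par P y)) (sm_fst z) n1.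
have n3 := near_dom cS (sd_atlas sd) (Wz : dom (sdpatch P W Y1 Y2) z).
by apply: filterS2 n2 n3 => w [_ Aw] Ww; split=> //; exact: (chart_pts cS (sd_atlas sd)).
Qed.

Lemma sd_neg P W Y1 Y2 : sddata P W Y1 Y2 -> sddata P W Y1 (fun x => - Y2 x).
Proof.
move=> sd; have n : (1 : R) * (- 1) - 0 * 0 != 0 by rewrite mul0r subr0 mul1r oppr_eq0 oner_neq0.
have E1 : (fun x => 1 *: Y1 x + 0 *: Y2 x) = Y1.
  by apply/funext => x; rewrite scale1r scale0r addr0.
have E2 : (fun x => 0 *: Y1 x + (- 1) *: Y2 x) = (fun x => - Y2 x).
  by apply/funext => x; rewrite scale0r add0r scaleN1r.
by have := sd_comb sd n; rewrite E1 E2.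
Qed.

Lemma sd_opposite P W Y1 Y2 z z' : sddata P W Y1 Y2 -> W z.1 -> W z'.1 ->
  par (sdpatch P W Y1 Y2) z <> par (sdpatch P W Y1 (fun x => - Y2 x)) z'.
Proof.
move=> sd; case: z z' => y t [y' t'] /= Wy Wy' [Ey].
have {}Ey : y = y'.
  rewrite -(coordK cM (sd_aP sd) (sd_dom sd Wy)) Ey.
  exact: (coordK cM (sd_aP sd) (sd_dom sd Wy')).
subst y'; rewrite -[Y2 _ in LHS]scale1r -scaleN1r.
move=> /(ray_comb (sd_indep sd Wy)) [c c0 [_]]; rewrite mulr1 => E.
by move: c0; rewrite -E oppr_gt0 ltr10.
Qed.

(* Rays that are not opposite both lie in the chart of the frame (X - X', X + X'); opposite
   rays lie in the disjoint charts of the frames (Y1, Y2) and (Y1, - Y2). *)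
Lemma sd_separate p q : pts SDM p -> pts SDM q -> p.1 = q.1 -> p <> q ->
  exists O O' : set (T * set V), [/\ mopen SDM O, mopen SDM O', O p, O' q & O `&` O' = set0].
Proof.
case: p q => x r [x' r'] /= [Mx [X [DX X0 rX]]] [_ [X' [DX' X0' rX']]] /= e; subst x' r r' => pq.
have [P [W [Y1 [Y2 [sd [y Wy Ey] _ _]]]]] := sd_local (mopen_pts cM) Mx.
move: DX DX'; rewrite -Ey (sd_D sd Wy) => -[a [b E]] [a' [b' E']].
have I := sd_indep sd Wy.
have [d0|d0] := eqVneq (a * b' - a' * b) 0.
  have ab : (- b) * b - a * a != 0.
    rewrite mulNr -opprD oppr_eq0 -!expr2 paddr_eq0 ?sqr_ge0// !sqrf_eq0.
    apply/negP => /andP[/eqP b0 /eqP a0]; move/eqP: X0; apply.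
    by rewrite E a0 b0 !scale0r addr0.
  have sd' := sd_comb sd ab; have sn := sd_neg sd'.
  (* Vanishing determinant makes X' = k X, with k the projection coefficient; k < 0 because the rays
     differ. *)
  pose k := (a * a' + b * b') / (a ^+ 2 + b ^+ 2).
  have n2 : a ^+ 2 + b ^+ 2 != 0.
    by move: ab; rewrite mulNr -opprD oppr_eq0 -!expr2 addrC.
  have Ek : a' = k * a /\ b' = k * b.
    split; apply: (mulIf n2); rewrite /k mulrAC divfK//.
      rewrite -[LHS]addr0 -[in LHS](mulr0 b) -d0; ring.
    rewrite -[LHS]subr0 -[in LHS](mulr0 a) -d0; ring.
  have X'k : X' = k *: X by rewrite E E' comb_scale -Ek.1 -Ek.2.
  have k0 : k < 0.
    rewrite lt_neqAle; apply/andP; split.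
      by apply/eqP => k0; move/eqP: X0'; apply; rewrite X'k k0 scale0r.
    rewrite leNgt; apply/negP => kp; apply: pq.
    by rewrite X'k ray_scale.
  set d1 := sdpatch P W (fun x => (- b) *: Y1 x + a *: Y2 x) (fun x => a *: Y1 x + b *: Y2 x).
  set d2 := sdpatch P W (fun x => (- b) *: Y1 x + a *: Y2 x) (fun x => - (a *: Y1 x + b *: Y2 x)).
  exists (rng d1), (rng d2); split.
  - exact: (mopen_rng cS (sd_atlas sd')).
  - exact: (mopen_rng cS (sd_atlas sn)).
  - by exists (y, 0) => //=; rewrite scale0r add0r E.
  - exists (y, 0) => //=; rewrite scale0r add0r -E X'k.
    by rewrite -(@ray_scale _ (- k^-1) (k *: X)) ?oppr_gt0 ?invr_lt0// scalerA mulNr mulVf ?lt_eqF// scaleN1r.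
  - by apply/seteqP; split=> // s [[z Wz <-] [z' Wz' /esym]]; exact: (sd_opposite sd').
have ab : (a - a') * (b + b') - (b - b') * (a + a') != 0.
  rewrite (_ : _ - _ = 2 * (a * b' - a' * b)); last by ring.
  by rewrite mulf_neq0// pnatr_eq0.
have sd' := sd_comb sd ab.
apply: (separate_chart cS (sd_atlas sd')); last by rewrite Ey.
  exists (y, 1) => //=; rewrite scale1r addrACA -!scalerDl.
  rewrite (_ : a - a' + (a + a') = 2 * a); last by ring.
  rewrite (_ : b - b' + (b + b') = 2 * b); last by ring.
  by rewrite -comb_scale ray_scale ?ltr0n// -E.
exists (y, -1) => //=; rewrite comb_scale addrACA -!scalerDl.
rewrite (_ : -1 * (a - a') + (a + a') = 2 * a'); last by ring.
rewrite (_ : -1 * (b - b') + (b + b') = 2 * b'); last by ring.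
by rewrite -comb_scale ray_scale ?ltr0n// -E'.
Qed.

Definition sgnb (c : bool) : R := if c then 1 else -1.

Lemma SD_manifold : is_manifold SDM.
Proof.
refine (fibred_manifold (M := M) _ cS sd_proj _ sd_separate _).
- by case: hM.
- by move=> p [].
move=> p [Mp _]; have [P [W [Y1 [Y2 [sd Wp _ _]]]]] := sd_local (mopen_pts cM) Mp.
exists (par P @` W); split; [exact: (sd_mopen sd)|exact: Wp|].
have n1 (c : bool) : (1 : R) * sgnb c - 0 * 0 != 0.
  by rewrite mul1r mul0r subr0 /sgnb; case: c; rewrite ?oppr_eq0 oner_neq0.
have n2 (c : bool) : (0 : R) * 0 - 1 * sgnb c != 0.
  by rewrite mul1r mul0r sub0r oppr_eq0 /sgnb; case: c; rewrite ?oppr_eq0 oner_neq0.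
(* A ray with nonzero Y2-component lies in the chart of (Y1, Y2) or (Y1, - Y2) according to the
   sign; a ray along Y1 is caught after exchanging the two vectors, again with two signs. *)
exists (fun i => if i.1 then
    sdpatch P W (fun x => 1 *: Y1 x + 0 *: Y2 x) (fun x => 0 *: Y1 x + sgnb i.2 *: Y2 x)
  else sdpatch P W (fun x => 0 *: Y1 x + 1 *: Y2 x) (fun x => sgnb i.2 *: Y1 x + 0 *: Y2 x)).
case=> x r [/= _ [X [DX X0 ->]]] [y Wy Ey]; subst x.
move: DX; rewrite (sd_D sd Wy) => -[a [b E]].
have aux (c : R) : c != 0 -> exists i, 0 < c * sgnb i.
  move=> c0; have [cp|cn|/eqP] := ltgtP 0 c; last by rewrite eq_sym (negPf c0).
    by exists true; rewrite mulr1.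
  by exists false; rewrite mulrN1 oppr_gt0.
have ss i : sgnb i * sgnb i = 1 by rewrite /sgnb; case: i; rewrite ?mulrNN mulr1.
have [b0|b0] := eqVneq b 0.
  have a0 : a != 0 by apply: contra_neq X0 => a0; rewrite E a0 b0 !scale0r addr0.
  have [i ai] := aux a a0; exists (false, i) => /=.
  have sd' := sd_comb sd (n2 i); split; first exact: sd_atlas.
  exists (y, 0) => //=; rewrite !scale0r add0r addr0 E b0 scale0r addr0; congr pair.
  by rewrite -(ray_scale (sgnb i *: _) ai) scalerA -mulrA ss mulr1.
have [i bi] := aux b b0; exists (true, i) => /=.
have sd' := sd_comb sd (n1 i); split; first exact: sd_atlas.
exists (y, a / (b * sgnb i)) => //=; rewrite !scale0r addr0 add0r scale1r E; congr pair.
rewrite -(ray_scale (_ + _) bi) comb_scale mulrC divfK ?gt_eqF//.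
by rewrite -mulrA ss mulr1.
Qed.

End SDmanifold.

(** * The open subset of rays outside the two lines *)

Section Star.
Context {R : realType} {T : Type}.
Local Notation V := 'rV[R]_3.
Variables (M : premanifold T V) (L1 L2 : T -> set V).
Hypothesis hM : path_geometry M L1 L2.
Let cM := cM hM.
Local Notation SDM := (SD M L1 L2).
Local Notation star := (SDstar M L1 L2).
Let cS := SD_charted hM.

Definition lines x (X1 X2 : V) := [/\ indep X1 X2, L1 x = [set c *: X1 | c in setT],
  L2 x = [set c *: X2 | c in setT] &
  D L1 L2 x = [set v | exists a b : R, v = a *: X1 + b *: X2]].

Lemma SDstar_ray x X1 X2 (a b : R) : pts M x -> lines x X1 X2 ->
  star (x, ray (a *: X1 + b *: X2)) <-> a != 0 /\ b != 0.
Proof.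
move=> Mx [I E1 E2 ED]; split=> [[_ /= n]|[a0 b0]].
  split; apply/eqP => z0; apply: n => v [t t0 ->].
    by right; rewrite E2 z0 scale0r add0r scalerA; exists (t * b).
  by left; rewrite E1 z0 scale0r addr0 scalerA; exists (t * a).
split=> /=.
  split=> //; exists (a *: X1 + b *: X2); split=> //; first by rewrite ED; exists a, b.
  by apply: indep_neq0; rewrite // a0.
move=> /(_ _ (ray_self _)) [].
  rewrite E1 => -[c _ E]; have [] := indep_eq (a := c) (b := 0) (c := a) (d := b) I _.
    by rewrite scale0r addr0.
  by move=> _ /eqP; rewrite eq_sym (negPf b0).
rewrite E2 => -[c _ E]; have [] := indep_eq (a := 0) (b := c) (c := a) (d := b) I _.
  by rewrite scale0r add0r.
by move=> /eqP; rewrite eq_sym (negPf a0).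
Qed.

Lemma SDact_ray x X1 X2 (a b k l : R) : lines x X1 X2 ->
  SDact L1 L2 k l (x, ray (a *: X1 + b *: X2)) = (x, ray ((k * a) *: X1 + (l * b) *: X2)).
Proof.
move=> [I E1 E2 _]; rewrite /SDact /=; congr pair; apply/seteqP; split=> Y /=.
  move=> [Z1 [Z2 []]]; rewrite E1 E2 => -[c _ <-] [d _ <-] [t t0]; rewrite comb_scale.
  move=> /(indep_eq I) [-> ->] ->; exists t => //.
  by rewrite comb_scale !scalerA; congr (_ *: _ + _ *: _); ring.
move=> [t t0 ->]; exists ((t * a) *: X1), ((t * b) *: X2); rewrite E1 E2; split.
- by exists (t * a).
- by exists (t * b).
- by exists t => //; rewrite comb_scale.
- by rewrite comb_scale !scalerA; congr (_ *: _ + _ *: _); ring.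
Qed.

Lemma SDstar_open : mopen SDM star.
Proof.
apply: (mopen_intro cS); first by move=> p [].
case=> x r sp; have [[/= Mx [X [DX X0 rX]]] _] := sp.
have [P [W [Y1 [Y2 [sd [y Wy Ey] _ LL]]]]] := sd_local hM (mopen_pts cM) Mx.
have li w : W w -> lines (par P w) (Y1 (par P w)) (Y2 (par P w)).
  move=> Ww; have Ow : (par P @` W) (par P w) by exists w.
  have [E1 E2] := LL _ Ow; split; [exact: sd_indep sd Ww|exact: E1|exact: E2|exact: sd_D sd Ww].
subst x r; move: DX; rewrite (sd_D sd Wy) => -[a [b E]].
move: sp; rewrite E => /(SDstar_ray _ _ Mx (li y Wy)) [a0 b0].
(* Replacing Y2 by b Y2 places the ray at t = a whatever the sign of b; in that chart the rays
   outside L1 and L2 are those with t != 0. *)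
have n : (1 : R) * b - 0 * 0 != 0 by rewrite mul1r mul0r subr0.
have sd' := sd_comb hM sd n.
exists (sdpatch P W (fun x => 1 *: Y1 x + 0 *: Y2 x) (fun x => 0 *: Y1 x + b *: Y2 x)), (y, a).
split; [exact: sd_atlas sd'|exact: Wy|by rewrite /= !scale1r !scale0r addr0 add0r|].
pose Q := sdpatch P W (fun x => 1 *: Y1 x + 0 *: Y2 x) (fun x => 0 *: Y1 x + b *: Y2 x).
have n1 := near_dom cS (sd_atlas sd') (Wy : dom Q (y, a)).
have n2 : \forall w \near (y, a : R^o), w.2 != 0.
  by apply: (near_neq0 (f := fun w : V * R^o => w.2)); [exact: a0|exact: sm_cont (sm_snd _)].
apply: filterS2 n1 n2 => w Ww w0 /=.
rewrite !scale1r !scale0r addr0 add0r.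
have Mw := chart_pts cM (sd_aP sd) (sd_dom sd Ww).
by apply/(SDstar_ray _ _ Mw (li _ Ww)).
Qed.

Lemma star_over_open U : mopen M U -> mopen SDM (SDstar_over M L1 L2 U).
Proof.
move=> oU; have := mopenI SDstar_open (sd_proj hM oU).
congr (mopen _ _); apply/seteqP; split=> p; first by move=> [? [_ ?]].
by move=> [sp Up]; split=> //; split=> //; case: sp.
Qed.

End Star.

(** * The maps h and J o h *)

Section Fefferman.
Context {R : realType} {T : Type}.
Local Notation V := 'rV[R]_3.
Variables (M : premanifold T V) (L1 L2 : T -> set V).
Hypothesis hM : path_geometry M L1 L2.
Let cM := cM hM.
Local Notation SDM := (SD M L1 L2).
Let cS := SD_charted hM.
Variables (U : set T) (eta : T -> V -> R).
Hypothesis ce : contact_form M L1 L2 U eta.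
Local Notation Bs := (Bset M L1 L2 U eta).
Local Notation BU := (B M L1 L2 U eta).
Local Notation bdata := (gdata M Bs).
Local Notation bpatch := (gpatch (nz : set R^o) (@rho R)).
Local Notation sign := (fun d => SDsign M L1 L2 d U eta).
Let cB := B_charted hM ce.

Lemma Bs_lines x u : Bs (x, u) -> lines L1 L2 x (xi u i1) (xi u i2).
Proof.
move=> Bu; have [I ED] := Bset_D hM ce Bu; have [E1 E2] := Bset_lines hM ce Bu.
by split.
Qed.

Lemma xi_rho (u : 'M[R]_3) (s : R) : u \in unitmx -> s != 0 ->
  xi (u *m rho s) i1 = s *: xi u i1 /\ xi (u *m rho s) i2 = s^-1 *: xi u i2.
Proof.
move=> uu s0.
have E : invmx (u *m rho s) = rho s^-1 *m invmx u.
  have uE : u *m rho s \in unitmx by rewrite unitmx_mul uu rho_unit.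
  apply: (can_inj (mulmxK uE)); rewrite mulVmx// mulmxA mulmxKV//.
  by rewrite -[in rho s](invrK s) rhoV// invr_neq0.
rewrite /xi E; split; rewrite row_mul.
  rewrite (_ : row i1 (rho s^-1) = s *: delta_mx 0 i1) -?scalemxAl -?rowE//.
  apply/rowP; apply: ord3P; rewrite !mxE !iE ?mulr0 ?mulr1 ?mulr0n//.
  by rewrite i1v /= invrK.
rewrite (_ : row i2 (rho s^-1) = s^-1 *: delta_mx 0 i2) -?scalemxAl -?rowE//.
apply/rowP; apply: ord3P; rewrite !mxE !iE ?mulr0 ?mulr1 ?mulr0n//.
by rewrite i2v.
Qed.

(* d = 1 gives h and d = -1 gives J o h. *)
Definition kmap (d : R) (p : T * 'M[R]_3) : T * set V := (p.1, ray (xi p.2 i1 + d *: xi p.2 i2)).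

Lemma kmap1 p : h p = kmap 1 p.
Proof.
rewrite /h /kmap scale1r; congr (_, ray _).
rewrite mulmx_sum_row sum3 !mxE i1v i2v i3v /=.
by rewrite !scale1r scale0r addr0.
Qed.

Lemma kmapN1 p : Bs p -> SDJ L1 L2 (h p) = kmap (-1) p.
Proof.
case: p => x u Bp; rewrite kmap1 /kmap /= scale1r -[xi u i1]scale1r -[xi u i2]scale1r.
rewrite [SDJ _ _ _](SDact_ray _ _ _ _ (Bs_lines Bp)) !mulr1 !scale1r.
by [].
Qed.

Lemma h_equivariant s p : s != 0 -> Bs p -> h (Bact s p) = SDscale L1 L2 s (h p) /\
  SDJ L1 L2 (h (Bact s p)) = SDscale L1 L2 s (SDJ L1 L2 (h p)).
Proof.
case: p => x u s0 Bp; have [_ /= uu] := Bs_M ce Bp; have [e1 e2] := xi_rho uu s0.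
have Bp' : Bs (Bact s (x, u)) by exact: Bset_act.
have li := Bs_lines Bp.
rewrite (kmapN1 Bp') (kmapN1 Bp) !kmap1 /kmap /= e1 e2.
rewrite -[xi u i1 in RHS]scale1r -[xi u i1 in X in _ /\ _ = X]scale1r.
by rewrite /SDscale !(SDact_ray _ _ _ _ li) !mulr1 mulrN1 !scale1r !scaleN1r scaleNr.
Qed.

(** For X = a X1 + b X2 in the frame dual to an adapted coframe, d eta (JX, X) = 2 a b. So the two
    parts of the decomposition are given by the sign of a b. *)
Lemma sign_ray x u (a b d : R) : Bs (x, u) -> sign d (x, ray (a *: xi u i1 + b *: xi u i2)) <->
  0 < d * (a * b).
Proof.
move=> Bu; have li := Bs_lines Bu; have [I E1 E2 ED] := li.
have [[Ux uu] _ _ _ _] := BsetP Bu; have Mx := U_pts ce Ux.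
have [oU fe _ _] := ce.
have al := dform_alt2 hM oU fe Ux; have [_ _ _ _ d12] := Bset_xi hM ce Bu.
have Q (k l : R) : dform M eta x (k *: xi u i1 - l *: xi u i2) (k *: xi u i1 + l *: xi u i2) = 2 * (k * l).
  rewrite (scalD (alt2r al _)) !(scalZ (alt2r al _)) !(scalB (al.1 _)) !(scalZ (al.1 _)).
  rewrite !(alt2_0 _ al) d12 (al.2 (xi u i2)) d12; ring.
split.
  move=> [_ [Z1 [Z2 [/= LZ1 LZ2 rZ]]]].
  move: LZ1 LZ2 rZ; rewrite E1 E2 => -[k _ <-] [l _ <-] [t t0]; rewrite comb_scale.
  move=> /(indep_eq I) [-> ->]; rewrite Q.
  rewrite (_ : d * _ = (2 * t * t) * (d * (a * b))); last by ring.
  by rewrite pmulr_rgt0// !mulr_gt0.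
move=> H; have [a0 b0] : a != 0 /\ b != 0.
  by split; apply/eqP => z0; move: H; rewrite z0 ?mul0r ?mulr0 ltxx.
split; first by split; [apply/(SDstar_ray _ _ Mx li)|].
exists (a *: xi u i1), (b *: xi u i2); split=> /=.
- by rewrite E1; exists a.
- by rewrite E2; exists b.
- exact: ray_self.
- by rewrite Q mulrCA mulr_gt0.
Qed.

Lemma over_ray p u : SDstar_over M L1 L2 U p -> Bs (p.1, u) -> exists a b : R,
  [/\ a != 0, b != 0 & p = (p.1, ray (a *: xi u i1 + b *: xi u i2))].
Proof.
case: p => x r [sp Ux] Bu; have li := Bs_lines Bu; have [I E1 E2 ED] := li.
have Mx := U_pts ce Ux; have [[/= _ [X [DX X0 rX]]] _] := sp.
move: DX; rewrite ED => -[a [b E]]; exists a, b; rewrite -E -rX.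
by move: sp; rewrite rX E => /(SDstar_ray _ _ Mx li) [].
Qed.

Lemma U_Bs x : U x -> exists u, Bs (x, u).
Proof.
move=> Ux; have [P [W [e [gd Wx _]]]] := local_adapted hM ce Ux.
by exists (e x); case: gd => _ _ _; apply.
Qed.

Lemma sign_cover : SDstar_over M L1 L2 U = SDplus M L1 L2 U eta `|` SDminus M L1 L2 U eta.
Proof.
apply/seteqP; split=> p; last by move=> [] [].
move=> sp; have [u Bu] := U_Bs sp.2; have [a [b [a0 b0 ->]]] := over_ray sp Bu.
have [ab|ab|/esym/eqP] := ltgtP 0 (a * b); last by rewrite mulf_eq0 (negPf a0) (negPf b0).
  by left; apply/(sign_ray _ _ _ Bu); rewrite mul1r.
by right; apply/(sign_ray _ _ _ Bu); rewrite mulN1r oppr_gt0.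
Qed.

Lemma sign_disjoint : SDplus M L1 L2 U eta `&` SDminus M L1 L2 U eta = set0.
Proof.
apply/seteqP; split=> // p [sp sm]; have [sp' _] := sp.
have [u Bu] := U_Bs sp'.2; have [a [b [a0 b0 E]]] := over_ray sp' Bu.
move: sp sm; rewrite E => /(sign_ray _ _ _ Bu) h1 /(sign_ray _ _ _ Bu) h2.
by move: h1 h2; rewrite mul1r mulN1r oppr_gt0 => /lt_trans H /H; rewrite ltxx.
Qed.

(* Over the coframe e . rho(s), [kmap d] is the ray of s^2 (k X1) + k d X2, where k is the sign
   of s: in the chart with (e1, e2) = (k, k d) it is (y, s) |-> (y, s^2). *)
Definition kchart (P : patch T V) W (e : T -> 'M[R]_3) (e1 e2 : R) :=
  sdpatch P W (fun x => e1 *: xi (e x) i1) (fun x => e2 *: xi (e x) i2).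

Lemma sd_bdata P W e (e1 e2 : R) : bdata P W e -> e1 != 0 -> e2 != 0 ->
  sddata M L1 L2 P W (fun x => e1 *: xi (e x) i1) (fun x => e2 *: xi (e x) i2).
Proof.
move=> gd n1 n2; have [aP [oW WP] _ Ze] := gd; have oO := gdata_mopen cM gd.
have sf i : smooth_field M (par P @` W) (fun x => xi (e x) i).
  apply: (smooth_field_intro cM) => p [y Wy <-]; exists P, y.
  have sx := gauge_sm (bdata_gauge hM gd Wy) i.
  by split; [exact: aP|exact: WP|by []|exact: sx].
have sd : sddata M L1 L2 P W (fun x => xi (e x) i1) (fun x => xi (e x) i2).
  split; [exact: aP|exact: oW|exact: WP|split; [exact: sf|exact: sf|]] => x Wx.
  exact: (Bset_D hM ce (Ze _ Wx)).
have n : e1 * e2 - 0 * 0 != 0 by rewrite mul0r subr0 mulf_neq0.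
have E1 : (fun x => e1 *: xi (e x) i1 + 0 *: xi (e x) i2) = (fun x => e1 *: xi (e x) i1).
  by apply/funext => x; rewrite scale0r addr0.
have E2 : (fun x => 0 *: xi (e x) i1 + e2 *: xi (e x) i2) = (fun x => e2 *: xi (e x) i2).
  by apply/funext => x; rewrite scale0r add0r.
by have := sd_comb hM sd n; rewrite E1 E2.
Qed.

Lemma sq1_neq0 (k : R) : k * k = 1 -> k != 0.
Proof. by move=> E; apply/eqP => k0; move/eqP: E; rewrite k0 mul0r eq_sym oner_eq0. Qed.

Lemma sq1_mul (k l : R) : k * k = 1 -> l * l = 1 -> (k * l) * (k * l) = 1.
Proof. by move=> E F; rewrite mulrACA E F mulr1. Qed.

Lemma sg_sq1 (s : R) : s != 0 -> exists k, k * k = 1 /\ 0 < k * s.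
Proof.
move=> s0; have [sp|sn|/eqP] := ltgtP 0 s; last by rewrite eq_sym (negPf s0).
  by exists 1; rewrite !mul1r.
by exists (-1); rewrite mulrNN mulr1 mulN1r oppr_gt0.
Qed.

Section Delta.
Variable d : R.
Hypothesis dd : d * d = 1.

Lemma kmap_par P W e (k : R) (z : V * R^o) : bdata P W e -> W z.1 -> k * k = 1 -> 0 < k * z.2 ->
  kmap d (par (bpatch P W e) z) = par (kchart P W e k (k * d)) (z.1, z.2 * z.2).
Proof.
move=> gd Wz kk kz; have z0 : z.2 != 0 by apply: contraTN kz => /eqP ->; rewrite mulr0 ltxx.
have uu : e (par P z.1) \in unitmx by case: gd => _ _ [+ _] _; apply; exists z.1.
have [E1 E2] := xi_rho uu z0.
rewrite /kmap /= E1 E2; congr pair.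
rewrite -(ray_scale (_ + _) kz) scalerA comb_scale scalerA; congr (ray (_ *: _ + _ *: _)).
  by rewrite mulrC mulrA mulrAC.
by rewrite -mulrA [z.2 * _]mulrC divfK.
Qed.

(** Coframes u and u rho(s) with the same image give s = c and 1/s = c for some c > 0, whence s^2 =
    1 and s > 0. *)
Lemma kmap_inj p q : Bs p -> Bs q -> kmap d p = kmap d q -> p = q.
Proof.
case: p q => x u [x' u'] Bp Bq [/= e]; subst x'.
have [s [s0 ->]] := Bs_tor hM ce Bp Bq; have [_ /= uu] := Bs_M ce Bp.
have [-> ->] := xi_rho uu s0; have [I _ _ _] := Bs_lines Bp.
rewrite scalerA -[xi u i1 in LHS]scale1r => /(ray_comb I) [c c0 [E1 E2]].
have Es : s^-1 = s.
  move: E1 E2; rewrite mulr1 => <-; rewrite [d * _]mulrC => /(mulIf (sq1_neq0 dd)).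
  by [].
have ss : s * s = 1 by rewrite -{1}Es mulVf.
have s1 : s = 1.
  have /eqP : (s - 1) * (s + 1) = 0 by rewrite -subr_sqr expr1n expr2 ss subrr.
  rewrite mulf_eq0 subr_eq0 addr_eq0 => /orP[/eqP ->//|/eqP sN].
  by move: c0; rewrite -[c]mulr1 -E1 sN ltr0N1.
by rewrite s1 rho1 mulmx1.
Qed.

Lemma near_kb P W e (k : R) (z : V * R^o) : bdata P W e -> W z.1 -> 0 < k * z.2 ->
  \forall w \near z, W w.1 /\ 0 < k * w.2.
Proof.
move=> gd Wz kz; have oW : open W by case: gd => _ [].
have n1 := sm_near_comp (P := W) (sm_fst z) (near_open oW Wz).
have s2 : sm (fun w : V * R^o => k * w.2 : R^o) z by apply: sm_mul; [exact: sm_cst|exact: sm_snd].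
have n2 := near_gt0 (f := fun w : V * R^o => k * w.2 : R^o) kz (sm_cont s2).
by apply: filterS2 n1 n2.
Qed.

Lemma kd_data P W e k : bdata P W e -> k * k = 1 ->
  sddata M L1 L2 P W (fun x => k *: xi (e x) i1) (fun x => (k * d) *: xi (e x) i2).
Proof. by move=> gd kk; apply: (sd_bdata gd); [|apply: mulf_neq0]; exact: sq1_neq0. Qed.

Lemma kmap_coord P W e (k : R) (z : V * R^o) : bdata P W e -> W z.1 -> k * k = 1 -> 0 < k * z.2 ->
  rng (kchart P W e k (k * d)) (kmap d (par (bpatch P W e) z)) /\
  coord (kchart P W e k (k * d)) (kmap d (par (bpatch P W e) z)) = (z.1, z.2 * z.2).
Proof.
move=> gd Wz kk kz; rewrite (kmap_par gd Wz kk kz); split; first by apply: rng_par.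
by apply: (sd_coordK hM (kd_data gd kk)).
Qed.

Lemma sm_sq (z : V * R^o) : sm (fun w : V * R^o => w.2 * w.2 : R^o) z.
Proof. by apply: sm_mul; exact: sm_snd. Qed.

Lemma k_neq0 k (s : R) : 0 < k * s -> s != 0.
Proof. by move=> H; apply: contraTN H => /eqP ->; rewrite mulr0 ltxx. Qed.

Lemma kmap_smooth_par P W e (k : R) (z : V * R^o) : bdata P W e -> W z.1 -> k * k = 1 -> 0 < k * z.2 ->
  smooth_at BU SDM (kmap d) (par (bpatch P W e) z).
Proof.
move=> gd Wz kk kz; have z0 := k_neq0 kz.
exists (bpatch P W e), (kchart P W e k (k * d)), z; split.
- exact: (B_atlas gd).
- exact: (sd_atlas (kd_data gd kk)).
- exact: (dom_b P e Wz z0).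
- by [].
have n := near_kb gd Wz kz; split.
  by apply: filterS n => w [Ww kw]; have [] := kmap_coord gd Ww kk kw.
apply: (sm_ext (f := fun w : V * R^o => (w.1, w.2 * w.2) : V * R^o)).
  by apply: filterS n => w [Ww kw]; have [_ <-] := kmap_coord gd Ww kk kw.
by apply: sm_pair; [exact: sm_fst|exact: sm_sq].
Qed.

Lemma B_kchart p : Bs p -> exists P W e k z,
  [/\ bdata P W e, W z.1, k * k = 1, 0 < k * z.2 & par (bpatch P W e) z = p].
Proof.
move=> Bp; have [P [W [e [z [gd Wz z0 zp]]]]] := bdata_chart hM ce Bp.
by have [k [kk kz]] := sg_sq1 z0; exists P, W, e, k, z.
Qed.

Lemma kmap_smooth p : Bs p -> smooth_at BU SDM (kmap d) p.
Proof.
move=> Bp; have [P [W [e [k [z [gd Wz kk kz <-]]]]]] := B_kchart Bp.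
exact: (kmap_smooth_par gd Wz kk kz).
Qed.

Lemma mdiff_kmap P W e (k : R) (z a : V * R^o) : bdata P W e -> W z.1 -> k * k = 1 -> 0 < k * z.2 ->
  mdiff BU SDM (kmap d) (par (bpatch P W e) z) (dpatch BU (bpatch P W e) z a) =
  dpatch SDM (kchart P W e k (k * d)) (z.1, z.2 * z.2) (a.1, 2 * z.2 * a.2).
Proof.
move=> gd Wz kk kz; have z0 := k_neq0 kz.
have [r c] := kmap_coord gd Wz kk kz.
rewrite (mdiffE cB cS a (B_atlas gd) (sd_atlas (kd_data gd kk)) (dom_b P e Wz z0) r (kmap_smooth_par gd Wz kk kz)).
rewrite c; congr (dpatch _ _ _ _).
transitivity ('D_a (fun w : V * R^o => (w.1, w.2 * w.2) : V * R^o) z).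
  by apply: D_ext; apply: filterS (near_kb gd Wz kz) => w [Ww kw]; have [_] := kmap_coord gd Ww kk kw.
rewrite (D_pair a (sm_fst z) (sm_sq z)) D_fst (D_mul a (sm_snd z) (sm_snd z)) D_snd.
congr pair; move: (z.2) (a.2) => s t; ring.
Qed.

Lemma kmap_sign p : Bs p -> sign d (kmap d p).
Proof.
case: p => x u Bp; rewrite /kmap /= -[xi u i1]scale1r.
by apply/(sign_ray _ _ _ Bp); rewrite mul1r dd.
Qed.

Lemma sign_kchart q : sign d q -> exists P W e k z,
  [/\ bdata P W e, W z.1, k * k = 1, 0 < z.2 & par (kchart P W e k (k * d)) z = q].
Proof.
move=> sq; have [so _] := sq; have [_ Ux] := so.
have [P [W [e [gd [y Wy Ey] _]]]] := local_adapted hM ce Ux.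
have Bx : Bs (q.1, e q.1) by case: gd => _ _ _; apply; exists y.
have [a [b [a0 b0 Eq]]] := over_ray so Bx.
move: sq; rewrite Eq => /(sign_ray _ _ _ Bx) dab.
have [k [kk ka]] := sg_sq1 a0.
have kdb : 0 < k * d * b.
  rewrite -(pmulr_lgt0 _ ka).
  have -> : k * d * b * (k * a) = (k * k) * (d * (a * b)) by ring.
  by rewrite kk mul1r.
exists P, W, e, k, (y, (k * a) / (k * d * b)); split.
- exact: gd.
- exact: Wy.
- exact: kk.
- exact: divr_gt0.
rewrite /= Ey; congr pair.
rewrite -(ray_scale (_ + _) kdb) scalerA comb_scale; congr (ray (_ *: _ + _ *: _)).
  by rewrite mulrA [_ * (_ / _)]mulrC divfK ?gt_eqF// mulrAC kk mul1r.
by rewrite mulrAC sq1_mul// mul1r.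
Qed.

Lemma kchart_sign P W e k (z : V * R^o) : bdata P W e -> W z.1 -> k * k = 1 -> 0 < z.2 ->
  sign d (par (kchart P W e k (k * d)) z).
Proof.
move=> gd Wz kk z0; have Bx : Bs (par P z.1, e (par P z.1)) by case: gd => _ _ _; apply; exists z.1.
rewrite /= scalerA; apply/(sign_ray _ _ _ Bx).
rewrite (_ : d * _ = (k * k) * (d * d) * z.2); last by ring.
by rewrite kk dd !mul1r.
Qed.

Lemma sqrt_kz k (t : R) : k * k = 1 -> 0 < t ->
  0 < k * (k * Num.sqrt t) /\ (k * Num.sqrt t) * (k * Num.sqrt t) = t.
Proof.
move=> kk t0; split; first by rewrite mulrA kk mul1r sqrtr_gt0.
by rewrite mulrACA kk mul1r -expr2 sqr_sqrtr// ltW.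
Qed.

Lemma kmap_sqrt P W e k (z : V * R^o) : bdata P W e -> W z.1 -> k * k = 1 -> 0 < z.2 ->
  kmap d (par (bpatch P W e) (z.1, k * Num.sqrt z.2)) = par (kchart P W e k (k * d)) z.
Proof.
move=> gd Wz kk z0; have [h1 h2] := sqrt_kz kk z0.
rewrite (kmap_par (z := (z.1, k * Num.sqrt z.2)) gd Wz kk h1) /= h2.
by [].
Qed.

Lemma near_pos2 P W e (z : V * R^o) : bdata P W e -> W z.1 -> 0 < z.2 ->
  \forall w \near z, W w.1 /\ 0 < w.2.
Proof.
move=> gd Wz z0; have z1 : 0 < 1 * z.2 by rewrite mul1r.
by apply: filterS (near_kb gd Wz z1) => w []; rewrite mul1r.
Qed.

Lemma sign_open : mopen SDM (sign d).
Proof.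
apply: (mopen_intro cS); first by move=> q [] [] [].
move=> q /sign_kchart [P [W [e [k [z [gd Wz kk z0 zq]]]]]].
exists (kchart P W e k (k * d)), z; split.
- exact: (sd_atlas (kd_data gd kk)).
- exact: Wz.
- exact: zq.
by apply: filterS (near_pos2 gd Wz z0) => w [Ww w0]; exact: (kchart_sign gd Ww kk w0).
Qed.

(** The preimage is chosen pointwise; its smoothness is read off from [ginv_chart], which shows it
    to be (y, t) |-> (y, k sqrt t) in charts. *)
Definition ginv (q : T * set V) : T * 'M[R]_3 :=
  match pselect (exists p, Bs p /\ kmap d p = q) with
  | left h => projT1 (cid h)
  | right _ => (q.1, 0)
  end.

Lemma ginvK p : Bs p -> ginv (kmap d p) = p.
Proof.
move=> Bp; rewrite /ginv; case: pselect => [h|[]]; last by exists p.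
by case: (cid h) => q [Bq E] /=; exact: kmap_inj.
Qed.

Lemma ginv_chart P W e k (z : V * R^o) : bdata P W e -> W z.1 -> k * k = 1 -> 0 < z.2 ->
  ginv (par (kchart P W e k (k * d)) z) = par (bpatch P W e) (z.1, k * Num.sqrt z.2).
Proof.
move=> gd Wz kk z0; rewrite -(kmap_sqrt gd Wz kk z0) ginvK//.
have [h1 _] := sqrt_kz kk z0.
exact: (bdata_Bs gd (z := (z.1, k * Num.sqrt z.2)) Wz (k_neq0 h1)).
Qed.

Lemma ginv_smooth q : sign d q -> smooth_at SDM BU ginv q.
Proof.
move=> /sign_kchart [P [W [e [k [z [gd Wz kk z0 <-]]]]]].
exists (kchart P W e k (k * d)), (bpatch P W e), z; split.
- exact: (sd_atlas (kd_data gd kk)).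
- exact: (B_atlas gd).
- exact: Wz.
- by [].
have n : \forall w \near z, rng (bpatch P W e) (ginv (par (kchart P W e k (k * d)) w)) /\
    coord (bpatch P W e) (ginv (par (kchart P W e k (k * d)) w)) = (w.1, k * Num.sqrt w.2).
  apply: filterS (near_pos2 gd Wz z0) => w [Ww w0]; rewrite (ginv_chart gd Ww kk w0).
  have [h1 _] := sqrt_kz kk w0.
  have dw : dom (bpatch P W e) (w.1, k * Num.sqrt w.2) := dom_b P e (z := (w.1, k * Num.sqrt w.2)) Ww (k_neq0 h1).
  by split; [exact: rng_par|exact: (coordK cB (B_atlas gd) dw)].
split; first by apply: filterS n => w [].
apply: (sm_ext (f := fun w : V * R^o => (w.1, k * Num.sqrt w.2) : V * R^o)).
  by apply: filterS n => w [_ <-].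
apply: sm_pair; first exact: sm_fst.
apply: sm_mul; first exact: sm_cst.
by apply: (sm_sqrt (f := fun w : V * R^o => w.2)) => //; exact: sm_snd.
Qed.

Lemma kmap_image : kmap d @` Bs = sign d.
Proof.
apply/seteqP; split=> q; first by move=> [p Bp <-]; exact: kmap_sign.
move=> /sign_kchart [P [W [e [k [z [gd Wz kk z0 <-]]]]]].
exists (par (bpatch P W e) (z.1, k * Num.sqrt z.2)); last exact: kmap_sqrt.
have [h1 _] := sqrt_kz kk z0.
exact: (bdata_Bs gd (z := (z.1, k * Num.sqrt z.2)) Wz (k_neq0 h1)).
Qed.

Lemma kmap_diffeo : diffeo BU Bs SDM (sign d) (kmap d).
Proof.
split.
- exact: (mopen_pts cB).
- exact: sign_open.
- exact: kmap_image.
- exact: (smooth_map_intro cB cS (mopen_pts cB) kmap_smooth).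
exists ginv; split; last exact: ginvK.
exact: (smooth_map_intro cS cB sign_open ginv_smooth).
Qed.

End Delta.

Lemma opp_sq1 : (-1 : R) * (-1) = 1. Proof. by rewrite mulrNN mulr1. Qed.

Lemma one_sq1 : (1 : R) * 1 = 1. Proof. by rewrite mulr1. Qed.

(* Inverting the differential of [kmap d] by choice avoids differentiating the square root. *)
Definition dinv (d : R) p (v : V * R^o) : V * R^o :=
  xget 0 [set v' | mdiff BU SDM (kmap d) p v' = v].

(** In charts the differential is (a, b) |-> (a, 2 s b), and s is nonzero. *)
Lemma mdiff_kmap_inj d p v v' : d * d = 1 -> Bs p ->
  mdiff BU SDM (kmap d) p v = mdiff BU SDM (kmap d) p v' -> v = v'.
Proof.
move=> dd Bp; have [P [W [e [k [z [gd Wz kk kz zp]]]]]] := B_kchart Bp; subst p.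
have z0 := k_neq0 kz; have db := dom_b P e Wz z0.
rewrite -(tcoordK cB v (B_atlas gd) db) -(tcoordK cB v' (B_atlas gd) db).
move: (tcoord _ _ _ v) (tcoord _ _ _ v') => a a'.
move=> EE.
have {}EE := eq_trans (esym (mdiff_kmap dd a gd Wz kk kz)) (eq_trans EE (mdiff_kmap dd a' gd Wz kk kz)).
move: EE; have dk : dom (kchart P W e k (k * d)) (z.1, z.2 * z.2) by [].
have aK := sd_atlas (kd_data dd gd kk).
move=> /(f_equal (tcoord SDM (kchart P W e k (k * d)) (par (kchart P W e k (k * d)) (z.1, z.2 * z.2)))).
move=> EE; have [E1 E2] := eq_trans (esym (dpatchK cS _ aK dk)) (eq_trans EE (dpatchK cS _ aK dk)).
have E3 : a.2 = a'.2.
  by apply: (mulfI _ E2); rewrite mulf_neq0// pnatr_eq0.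
by congr (dpatch _ _ _ _); rewrite [LHS]surjective_pairing [RHS]surjective_pairing E1 E3.
Qed.

Lemma dinvK d p v : d * d = 1 -> Bs p -> dinv d p (mdiff BU SDM (kmap d) p v) = v.
Proof.
move=> dd Bp; rewrite /dinv; case: xgetP => [v' _ /= E|/(_ v)/=]; last by case.
exact: mdiff_kmap_inj dd Bp E.
Qed.

(** * The induced metric on the rays *)

Definition sgn (q : T * set V) : R := if `[< sign 1 q >] then 1 else -1.

Definition feff al K (q : T * set V) (v w : V * R^o) : R :=
  let p := ginv (sgn q) q in gB M L1 L2 U eta al K p (dinv (sgn q) p v) (dinv (sgn q) p w).

Lemma sgn_kmap d p : d * d = 1 -> Bs p -> (d = 1 \/ d = -1) -> sgn (kmap d p) = d.
Proof.
move=> dd Bp [->|dN]; rewrite /sgn; case: asboolP => //.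
  by case; exact: (kmap_sign one_sq1).
move=> s1; have s2 := kmap_sign dd Bp; rewrite dN in s1 s2.
have : (SDplus M L1 L2 U eta `&` SDminus M L1 L2 U eta) (kmap (-1) p) by [].
by rewrite sign_disjoint.
Qed.

Lemma pull_feff al K d p v w : (d = 1 \/ d = -1) -> Bs p ->
  pull2 BU SDM (kmap d) (feff al K) p v w = gB M L1 L2 U eta al K p v w.
Proof.
move=> dE Bp; have dd : d * d = 1 by case: dE => ->; [exact: one_sq1|exact: opp_sq1].
rewrite /pull2 /feff (sgn_kmap dd Bp dE) (ginvK dd Bp).
exact (f_equal2 (gB M L1 L2 U eta al K p) (dinvK v dd Bp) (dinvK w dd Bp)).
Qed.

Lemma pull2_h G p v w : pull2 BU SDM h G p v w = pull2 BU SDM (kmap 1) G p v w.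
Proof. by have -> : h = kmap 1 by apply/funext => q; exact: kmap1. Qed.

Lemma pull2_Jh G p v w : Bs p ->
  pull2 BU SDM (SDJ L1 L2 \o h) G p v w = pull2 BU SDM (kmap (-1)) G p v w.
Proof.
move=> Bp; have E q : Bs q -> (SDJ L1 L2 \o h) q = kmap (-1) q by move=> Bq; exact: kmapN1.
rewrite /pull2.
exact (f_equal3 G (E p Bp) (mdiff_ext SDM cB v (mopen_pts cB) Bp E) (mdiff_ext SDM cB w (mopen_pts cB) Bp E)).
Qed.

Lemma feff_exists : exists G, fefferman_metric M L1 L2 U eta G.
Proof.
have aal := alB_adapted hM ce; have cK := curvature_exists hM ce aal.
exists (feff (alB M L1 L2 U eta) (fun p => dal M L1 L2 U eta p i1 i2)).
exists (alB M L1 L2 U eta), (fun p => dal M L1 L2 U eta p i1 i2); split=> // p v w Bp.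
by rewrite pull2_h (pull2_Jh _ _ _ Bp); split; apply: pull_feff; rewrite //; [left|right].
Qed.

(** [fefferman_metric] prescribes G through its two pullbacks. The point z is the image of (z.1, k
    sqrt z.2), and each tangent vector there is the image of one on B with the vertical part divided
    by 2 s. The signs k and d leave no trace in the result. *)
Lemma feff_chart G P W e k d (z a b : V * R^o) : fefferman_metric M L1 L2 U eta G ->
  (d = 1 \/ d = -1) -> bdata P W e -> W z.1 -> k * k = 1 -> 0 < z.2 ->
  G (par (kchart P W e k (k * d)) z) (dpatch SDM (kchart P W e k (k * d)) z a)
    (dpatch SDM (kchart P W e k (k * d)) z b) =
  Feff (cf M P e) (xf M P e) z.1 a.1 ((2 * z.2)^-1 * a.2) b.1 ((2 * z.2)^-1 * b.2).
Proof.
move=> [al [K [aal cK H]]] dE gd Wz kk z0.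
have dd : d * d = 1 by case: dE => ->; [exact: one_sq1|exact: opp_sq1].
have [s1 s2] := sqrt_kz kk z0; set s := k * Num.sqrt z.2 in s1 s2.
have s0 : s != 0 := k_neq0 s1.
pose z' : V * R^o := (z.1, s).
have Bz : Bs (par (bpatch P W e) z') := bdata_Bs gd (z := z') Wz s0.
have Ez : z = (z.1, s * s) by rewrite s2; exact: surjective_pairing.
have Ea (c : V * R^o) : dpatch SDM (kchart P W e k (k * d)) z c =
    mdiff BU SDM (kmap d) (par (bpatch P W e) z') (dpatch BU (bpatch P W e) z' (c.1, (2 * s)^-1 * c.2)).
  rewrite (mdiff_kmap dd _ gd (z := z') Wz kk s1) /= -Ez.
  by rewrite mulrA mulfV ?mul1r -?surjective_pairing// mulf_neq0// pnatr_eq0.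
have Ep : par (kchart P W e k (k * d)) z = kmap d (par (bpatch P W e) z').
  rewrite (kmap_par d gd (z := z') Wz kk s1).
  exact: (f_equal (par (kchart P W e k (k * d))) Ez).
rewrite (Ea a) (Ea b) Ep.
have HH v w : pull2 BU SDM (kmap d) G (par (bpatch P W e) z') v w = gB M L1 L2 U eta al K (par (bpatch P W e) z') v w.
  have [h1 h2] := H _ v w Bz; case: dE => ->; first by rewrite -h1 pull2_h.
  by rewrite -h2 (pull2_Jh _ _ _ Bz).
rewrite -[LHS]/(pull2 BU SDM (kmap d) G _ _ _) HH (gB_chart hM ce _ _ aal cK gd (z := z') Wz s0) /=.
have E c : s^-1 * ((2 * s)^-1 * c) = (2 * z.2)^-1 * c.
  by rewrite -s2 mulrA -invfM; congr (_^-1 * _); ring.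
by rewrite !E.
Qed.

Lemma over_kchart p : SDstar_over M L1 L2 U p -> exists P W e k d z,
  [/\ bdata P W e, W z.1, k * k = 1, 0 < z.2 & (d = 1 \/ d = -1) /\ par (kchart P W e k (k * d)) z = p].
Proof.
rewrite sign_cover => -[/(sign_kchart one_sq1)|/(sign_kchart opp_sq1)] [P [W [e [k [z [gd Wz kk z0 zp]]]]]].
  by exists P, W, e, k, 1, z; split=> //; split=> //; left.
by exists P, W, e, k, (-1), z; split=> //; split=> //; right.
Qed.

Lemma feff_metric G : fefferman_metric M L1 L2 U eta G ->
  is_metric22 SDM (SDstar_over M L1 L2 U) G.
Proof.
move=> fG; have [oU _ _ _] := ce.
apply: (metric22_chart cS (star_over_open hM oU)) => p /over_kchart [P [W [e [k [d [z [gd Wz kk z0 [dE zp]]]]]]]].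
have dd : d * d = 1 by case: dE => ->; [exact: one_sq1|exact: opp_sq1].
have z2 : 2 * z.2 != 0 by rewrite mulf_neq0// ?pnatr_eq0// gt_eqF.
exists (kchart P W e k (k * d)), z, (cf M P e), (xf M P e), (fun w => (2 * w.2)^-1); split.
- by split; [exact: (sd_atlas (kd_data dd gd kk))|exact: Wz|exact: zp].
- exact: (bdata_gauge hM gd Wz).
- apply: (sm_inv (f := fun w : V * R^o => 2 * w.2 : R^o)) => //.
  by apply: sm_mul; [exact: sm_cst|exact: sm_snd].
- by rewrite invr_neq0.
by apply: filterS (near_pos2 gd Wz z0) => w [Ww w0] a b; exact: feff_chart.
Qed.

End Fefferman.

(** * Rescaling the contact form *)

Section FeffLocal.
Context {R : realType} {V : normedModType R} {fV : findim V}.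
Variables (c c' : 'I_3 -> V -> V -> R) (x x' : 'I_3 -> V -> V) (W : set V).
Hypotheses (oW : open W) (ec : forall i z v, W z -> c i z v = c' i z v)
  (ex : forall i z, W z -> x i z = x' i z).

Lemma cd_local (b b' : V -> V -> R) y v w : W y -> (forall z u, W z -> b z u = b' z u) ->
  cd b y v w = cd b' y v w.
Proof. by move=> Wy H; apply: cd_ext; apply: filterS (near_open oW Wy) => z Wz u; exact: H. Qed.

Lemma str_local k i j y : W y -> str c x k i j y = str c' x' k i j y.
Proof. by move=> Wy; rewrite /str (ex i Wy) (ex j Wy); apply: cd_local => // z u Wz; exact: ec. Qed.

Lemma alf_local y v : W y -> alf c x y v = alf c' x' y v.
Proof.
move=> Wy; rewrite /alf (str_local i2 i1 i2 Wy) (str_local i1 i1 i2 Wy) (str_local i1 i3 i1 Wy).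
by rewrite (ec i1 v Wy) (ec i2 v Wy) (ec i3 v Wy).
Qed.

Lemma Kf_local y : W y -> Kf c x y = Kf c' x' y.
Proof. by move=> Wy; rewrite /Kf (ex i1 Wy) (ex i2 Wy); apply: cd_local => // z u; exact: alf_local. Qed.

Lemma sg_local y th v : W y -> sg c x y th v = sg c' x' y th v.
Proof. by move=> Wy; rewrite /sg (alf_local v Wy) (Kf_local Wy) (ec i3 v Wy). Qed.

(** [alf] contains first derivatives of the coframe and [Kf] derivatives of [alf], so agreement is
    assumed on an open set and not only at y. *)
Lemma Feff_local y v th w th' : W y -> Feff c x y v th w th' = Feff c' x' y v th w th'.
Proof.
move=> Wy; rewrite /Feff (sg_local th v Wy) (sg_local th' w Wy).
by rewrite (ec i1 v Wy) (ec i1 w Wy) (ec i2 v Wy) (ec i2 w Wy) (ec i3 v Wy) (ec i3 w Wy).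
Qed.

End FeffLocal.

Section RescaledCoframe.
Context {R : realType} {T : Type}.
Local Notation V := 'rV[R]_3.
Variables (M : premanifold T V) (L1 L2 : T -> set V).
Hypothesis hM : path_geometry M L1 L2.
Let cM := cM hM.
Local Notation SDM := (SD M L1 L2).
Let cS := SD_charted hM.
Variables (U U' : set T) (eta eta' : T -> V -> R) (f : T -> R).
Hypotheses (ce : contact_form M L1 L2 U eta) (ce' : contact_form M L1 L2 U' eta').
Variables (P : patch T V) (W : set V) (e : T -> 'M[R]_3).
Hypothesis gd : gdata M (Bset M L1 L2 U eta) P W e.
Hypotheses (WU' : par P @` W `<=` U') (sf : smooth_fun M (par P @` W) f)
  (f0 : forall x, (par P @` W) x -> f x != 0)
  (ff : forall x, (par P @` W) x -> forall v, eta' x v = f x * eta x v).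

Local Notation c := (cf M P e).
Local Notation x := (xf M P e).
Let F : V -> R^o := f \o par P.

(* The columns are chosen so that the components of [rcoframe] are the forms [rc]. *)
Definition rmat (y : V) : 'M[R]_3 := \matrix_(i, j) rc c x F j y (x i y).
Definition rcoframe (p : T) : 'M[R]_3 := e p *m rmat (coord P p).

Let aP : atlas M P. Proof. by case: gd. Qed.
Let WP : W `<=` dom P. Proof. by case: gd => _ []. Qed.
Let oW : open W. Proof. by case: gd => _ []. Qed.
Let oPW : mopen M (par P @` W). Proof. exact: (gdata_mopen cM gd). Qed.

Lemma rg y : W y -> [/\ gauge c x y, sm F y & F y != 0].
Proof.
move=> Wy; have Oy : (par P @` W) (par P y) by exists y.
split; [exact: (bdata_gauge hM gd Wy)|exact: (smooth_fun_sm oPW sf aP (WP Wy) Oy)|exact: f0].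
Qed.

Lemma rcf y j v : W y -> cf M P rcoframe j y v = rc c x F j y v.
Proof.
move=> Wy; have [g sF F0] := rg Wy.
rewrite cfE /rcoframe (coordK cM aP (WP Wy)) mulmxA [in RHS](gauge_expand g v).
rewrite (scal_sum (smf_lin (smf_rc g sF F0 j))) mxE; apply: eq_bigr => i _.
by rewrite (scalZ (smf_lin (smf_rc g sF F0 j))) [rmat y i j]mxE -cfE.
Qed.

Lemma rcoframe_unit y : W y -> rcoframe (par P y) \in unitmx.
Proof.
move=> Wy; have [g sF F0] := rg Wy; have [rd _] := rdual g F0.
suff /mulmx1_unit [] : (\matrix_i dpatch M P y (rx x F i y)) *m rcoframe (par P y) = 1%:M by [].
apply/row_matrixP => i; rewrite row_mul rowK; apply/rowP => j.
by rewrite -(cfE M P rcoframe j y) (rcf _ _ Wy) rd row1 !mxE eqxx andTb eq_sym.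
Qed.

Lemma smf_rcf y j : W y -> smf (cf M P rcoframe j) y.
Proof.
move=> Wy; have [g sF F0] := rg Wy; apply: smf_ext (smf_rc g sF F0 j).
by apply: filterS (near_open oW Wy) => z Wz u; rewrite rcf.
Qed.

Lemma rcoframe_form j : is_form1 M (par P @` W) (cmp j rcoframe).
Proof.
apply: (form1_intro cM) => p [y Wy <-]; exists P, y.
by split; [exact: aP|exact: WP|by []|exact: (smf_rcf j Wy)].
Qed.

(** The components of [rcoframe] are the forms [rc]: [rstruct] gives the exterior derivative of the
    third, and the corrections to the first two are multiples of eta, which vanishes on both
    lines. *)
Lemma rcoframe_data : gdata M (Bset M L1 L2 U' eta') P W rcoframe.
Proof.
have E3 y v : W y -> cmp i3 rcoframe (par P y) v = eta' (par P y) v.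
  move=> Wy; have Oy : (par P @` W) (par P y) by exists y.
  have [g sF F0] := rg Wy; have [_ _ _ Ze] := gd; have [_ H3 _ _ _] := BsetP (Ze _ Oy).
  rewrite -(tcoordK cM v aP (WP Wy)) (ff Oy) -H3.
  refine (eq_trans (rcf i3 (tcoord M P (par P y) v) Wy) _).
  exact (rc3 _ _ _ _ _).
have R1 y v : W y -> ((v *m rcoframe (par P y)) 0 i1 =
    F y * cc (e (par P y)) i1 v + (- fd x F i2 y) * cc (e (par P y)) i3 v) /\
    ((v *m rcoframe (par P y)) 0 i2 =
    cc (e (par P y)) i2 v + (fd x F i1 y / F y) * cc (e (par P y)) i3 v).
  move=> Wy; rewrite -(tcoordK cM v aP (WP Wy)); move: (tcoord _ _ _ v) => u.
  by have := rcf i1 u Wy; have := rcf i2 u Wy; rewrite rc1 rc2.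
split; [exact: aP|by split|split|].
- by move=> p [y Wy <-]; exact: rcoframe_unit.
- exact: rcoframe_form.
move=> p [y Wy <-]; have Oy : (par P @` W) (par P y) by exists y.
have [g sF F0] := rg Wy; have [_ _ _ /(_ _ Oy) Be] := gd.
have [[Ux ux] H3 Hd H1 H2] := BsetP Be; have [e1 e2 n1 n2 _] := Bset_xi hM ce Be.
have [E1 E2] := Bset_lines hM ce Be.
have le : scalar (eta (par P y)).
  by have [_ [+ _] _ _] := ce; apply.
split.
- by split; [exact: WU'|exact: rcoframe_unit].
- by move=> v; exact: E3.
- move=> v w; rewrite -(dform_ext cM (a := cmp i3 rcoframe) v w oPW Oy); last first.
    by move=> q [z Wz <-]; apply/funext => u; exact: E3.
  rewrite -(tcoordK cM v aP (WP Wy)) -(tcoordK cM w aP (WP Wy)).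
  move: (tcoord _ _ _ v) (tcoord _ _ _ w) => u u'.
  rewrite (dformE cM u u' aP (WP Wy) (smf_rcf i3 Wy)).
  rewrite (cd_local oW (b' := rc c x F i3)) //; last by move=> z t Wz; exact: rcf.
  rewrite (rstruct g sF F0) -!rcf//.
- move=> v; rewrite E2 => -[k _ <-]; rewrite (R1 y _ Wy).1.
  have -> : cc (e (par P y)) i1 (k *: xi (e (par P y)) i2) = 0.
    by apply: H1; rewrite E2; exists k.
  by rewrite H3 (scalZ le) n2 !mulr0 addr0.
- move=> v; rewrite E1 => -[k _ <-]; rewrite (R1 y _ Wy).2.
  have -> : cc (e (par P y)) i2 (k *: xi (e (par P y)) i1) = 0.
    by apply: H2; rewrite E1; exists k.
  by rewrite H3 (scalZ le) n1 !mulr0 addr0.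
Qed.

Lemma rxf y i : W y -> xf M P rcoframe i y = rx x F i y.
Proof.
move=> Wy; have [g sF F0] := rg Wy; have [rd _] := rdual g F0.
apply: (gauge_inj (rgauge g sF F0)) => j; rewrite rd -rcf//.
exact: (gauge_dual (bdata_gauge hM rcoframe_data Wy)).
Qed.

Lemma rxi y : W y -> xi (rcoframe (par P y)) i1 = (F y)^-1 *: xi (e (par P y)) i1 /\
  xi (rcoframe (par P y)) i2 = xi (e (par P y)) i2.
Proof.
move=> Wy; have [g sF F0] := rg Wy.
have D i : xi (rcoframe (par P y)) i = dpatch M P y (rx x F i y).
  by rewrite -rxf// (tcoordK cM _ aP (WP Wy)).
have De i : xi (e (par P y)) i = dpatch M P y (x i y) by rewrite (tcoordK cM _ aP (WP Wy)).
rewrite !D !De rx1 rx2; split=> //.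
have tl a u v := dpatch_lin cM a u v aP (WP Wy).
exact: (linZ (f := dpatch M P y) tl (F y)^-1 (x i1 y)).
Qed.

Lemma rFeff_coframe y v th w th' : W y ->
  Feff (cf M P rcoframe) (xf M P rcoframe) y v th w th' =
  F y * Feff c x y v (th - 'D_v F y / (2 * F y)) w (th' - 'D_w F y / (2 * F y)).
Proof.
move=> Wy; have [g sF F0] := rg Wy; rewrite -(rFeff g sF F0).
by apply: (Feff_local oW) => // [i z u Wz|i z Wz]; [exact: rcf|exact: rxf].
Qed.

(** The same point of SD is described by the chart of e, for eta, and by the chart of [rcoframe],
    for f * eta. Comparing the two coordinate formulas through the transition map reduces the claim
    to [rFeff_coframe]. *)
Lemma rescale_chart G G' k d (z a b : V * R^o) : fefferman_metric M L1 L2 U eta G ->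
  fefferman_metric M L1 L2 U' eta' G' -> (d = 1 \/ d = -1) -> W z.1 -> k * k = 1 -> 0 < z.2 ->
  let K := kchart P W e k (k * d) in
  G' (par K z) (dpatch SDM K z a) (dpatch SDM K z b) =
  f (par P z.1) * G (par K z) (dpatch SDM K z a) (dpatch SDM K z b).
Proof.
move=> fG fG' dE Wz kk z0 K; have [g sF F0] := rg Wz.
rewrite (feff_chart hM ce a b fG dE gd Wz kk z0).
(* p is the sign of f. A negative f exchanges SD^+ and SD^-, so d becomes d p; since the first frame
   vector is divided by f, the chart adapted to f * eta uses the sign k p and the coordinate |f|
   t. *)
have [p [pp pf]] := sg_sq1 F0.
have dd : d * d = 1 by case: dE => ->; rewrite ?mulrNN mulr1.
have kp : (k * p) * (k * p) = 1 := sq1_mul kk pp.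
have dE' : d * p = 1 \/ d * p = -1.
  have p1 : p = 1 \/ p = -1.
    have /eqP : (p - 1) * (p + 1) = 0 by rewrite -subr_sqr expr1n expr2 pp subrr.
    by rewrite mulf_eq0 subr_eq0 addr_eq0 => /orP[/eqP|/eqP]; [left|right].
  by case: dE p1 => -> [] ->; rewrite ?mulrNN ?mulr1 ?mul1r; [left|right|right|left].
pose K' := kchart P W rcoframe (k * p) (k * p * (d * p)).
have gd' := rcoframe_data.
have dd' : (d * p) * (d * p) = 1 := sq1_mul dd pp.
have sd := kd_data hM ce dd gd kk; have sd' := kd_data hM ce' dd' gd' kp.
have aK : atlas SDM K := sd_atlas sd; have aK' : atlas SDM K' := sd_atlas sd'.
have EK (w : V * R^o) : W w.1 -> par K w = par K' (w.1, p * F w.1 * w.2).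
  move=> Ww; have [X1 X2] := rxi Ww; have [_ _ Fw] := rg Ww.
  rewrite /= X1 X2; congr (_, ray (_ + _)); rewrite ?scalerA; congr (_ *: _).
    rewrite (_ : p * F w.1 * w.2 * (k * p) = (p * p) * (k * w.2) * F w.1).
      by rewrite pp mul1r mulfK// mulrC.
    by move: (F w.1) (w.2) => r s; ring.
  rewrite (_ : k * p * (d * p) = (p * p) * (k * d)); last by ring.
  by rewrite pp mul1r.
have dK' (w : V * R^o) : W w.1 -> dom K' (w.1, p * F w.1 * w.2) by [].
have cK w : W w.1 -> coord K' (par K w) = (w.1, p * F w.1 * w.2).
  by move=> Ww; rewrite (EK w Ww); exact: (coordK cS aK' (dK' w Ww)).
have rK : rng K' (par K z) by rewrite (EK z Wz); apply: rng_par; exact: dK'.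
have dKz : dom K z by [].
have sp : sm (fun w : V * R^o => p * F w.1 : R^o) z.
  by apply: sm_mul; [exact: sm_cst|exact: (sm_at_fst (k := F) sF)].
have Dp u : 'D_u (fun w : V * R^o => p * F w.1 : R^o) z = p * 'D_(u.1) F z.1.
  rewrite (D_mul u (sm_cst (p : R^o) z) (sm_at_fst (k := F) sF)) D_cst mulr0 addr0.
  by have := D_comp u (sm_fst z) sF; rewrite D_fst => <-.
have DK u : 'D_u (coord K' \o par K) z = (u.1, p * F z.1 * u.2 + z.2 * (p * 'D_(u.1) F z.1)).
  transitivity ('D_u (fun w : V * R^o => (w.1, p * F w.1 * w.2) : V * R^o) z).
    apply: D_ext; have n := sm_near_comp (P := W) (sm_fst z) (near_open oW Wz).
    by apply: filterS n => w Ww; exact: cK.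
  have s2 : sm (fun w : V * R^o => p * F w.1 * w.2 : R^o) z by apply: sm_mul => //; exact: sm_snd.
  by rewrite (D_pair u (sm_fst z) s2) D_fst (D_mul u sp (sm_snd z)) D_snd Dp.
have Ev u : dpatch SDM K z u = dpatch SDM K' (z.1, p * F z.1 * z.2)
    (u.1, p * F z.1 * u.2 + z.2 * (p * 'D_(u.1) F z.1)).
  by rewrite -(dpatch_change cS u aK aK' dKz rK) DK (cK z Wz).
rewrite (Ev a) (Ev b) (EK z Wz).
have z0' : 0 < p * F z.1 * z.2 by rewrite mulr_gt0.
rewrite (feff_chart hM ce' _ _ fG' dE' gd' (z := (z.1, p * F z.1 * z.2)) Wz kp z0') /=.
rewrite rFeff_coframe//.
(* The coordinate |f| t contributes dt/(2t) + df/(2f); the shift in [rFeff_coframe] removes the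
   second term. *)
have A u (t : R) : (2 * (p * F z.1 * z.2))^-1 * (p * F z.1 * t + z.2 * (p * 'D_u F z.1)) - 'D_u F z.1 / (2 * F z.1)
    = (2 * z.2)^-1 * t.
  have p0 := sq1_neq0 pp; have z20 : z.2 != 0 by rewrite gt_eqF.
  move: F0 z20 p0; move: ('D_u F z.1) (F z.1) (z.2) => r s q s0 q0 p0; field.
  by rewrite s0 q0 p0.
by rewrite !A.
Qed.

End RescaledCoframe.

Lemma transport_df {R : realType} (B : Type) (b d : B -> B -> R) (e : B -> R) r s k u u' v w :
  b u u' = r * e u' - s * e u + k * d u u' -> u = v -> u' = w ->
  b v w = r * e w - s * e v + k * d v w.
Proof. by move=> H <- <-. Qed.

Lemma transport_ratio {R : realType} (A B : Type) (g g' : A -> B -> B -> R) s s' x x' u u' v w :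
  g' x u u' = s * g x u u' -> s = s' -> x = x' -> u = v -> u' = w -> g' x' v w = s' * g x' v w.
Proof. by move=> H <- <- <- <-. Qed.

(** * Proportionality of contact forms *)

Section ContactForms.
Context {R : realType} {T : Type}.
Local Notation V := 'rV[R]_3.
Variables (M : premanifold T V) (L1 L2 : T -> set V).
Hypothesis hM : path_geometry M L1 L2.
Let cM := cM hM.

Lemma contact_neq0 U eta x : contact_form M L1 L2 U eta -> U x -> exists v, eta x v != 0.
Proof.
move=> [_ _ nd _] Ux; apply: contrapT => H.
have e0 v : eta x v = 0 by apply: contrapT => /eqP n; apply: H; exists v.
have [v1 [v2 [v3]]] := nd _ Ux.
move: (dform M eta x v2 v3) (dform M eta x v3 v1) (dform M eta x v1 v2) (e0 v1) (e0 v2) (e0 v3).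
move: (eta x v1) (eta x v2) (eta x v3) => a b c r s t -> -> ->.
by rewrite !mul0r !addr0 eqxx.
Qed.

Lemma dform_scale U eta (f : T -> R) x : mopen M U -> is_form1 M U eta -> smooth_fun M U f -> U x ->
  exists df : V -> R, forall v w, dform M (fun x v => f x * eta x v) x v w =
    df v * eta x w - df w * eta x v + f x * dform M eta x v w.
Proof.
move=> oU fe sf Ux; have Mx : pts M x by case: oU => + _; apply.
have [aP rP] := patch_atP cM Mx; have [d E] := coord_rng rP.
set P := patch_at M x in aP rP d E; set y := coord P x in d E.
have Uy : U (par P y) by rewrite E.
have sF := smooth_fun_sm oU sf aP d Uy; have se := form1_smf cM oU fe aP d Uy.
exists (fun v => 'D_(tcoord M P x v) (f \o par P : V -> R^o) y) => v w.
have tK u : dpatch M P y (tcoord M P x u) = u by rewrite -E; exact: tcoordK.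
have key u u' : dform M (fun x v => f x * eta x v) (par P y) (dpatch M P y u) (dpatch M P y u') =
    'D_u (f \o par P : V -> R^o) y * eta (par P y) (dpatch M P y u') -
    'D_u' (f \o par P : V -> R^o) y * eta (par P y) (dpatch M P y u) +
    f (par P y) * dform M eta (par P y) (dpatch M P y u) (dpatch M P y u').
  rewrite (dformE cM _ _ aP d (smf_scale sF se)) (dformE cM _ _ aP d se).
  exact: cd_scale.
have K := key (tcoord M P x v) (tcoord M P x w); rewrite E in K.
exact (transport_df K (tK v) (tK w)).
Qed.

(** (f eta) /\ d (f eta) = f^2 eta /\ d eta, since the terms in df cancel in the cyclic sum. *)
Lemma contact_rescale U eta f : contact_form M L1 L2 U eta -> smooth_fun M U f ->
  (forall x, U x -> f x != 0) -> contact_form M L1 L2 U (fun x v => f x * eta x v).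
Proof.
move=> [oU fe nd ke] sf f0; split.
- exact: oU.
- apply: (form1_intro cM) => p Up.
  have Mp : pts M p by case: oU => + _; apply.
  have [aP rP] := patch_atP cM Mp; have [d E] := coord_rng rP.
  exists (patch_at M p), (coord (patch_at M p) p); split; [exact: aP|exact: d|exact: E|].
  have Uy : U (par (patch_at M p) (coord (patch_at M p) p)) by rewrite E.
  exact: (smf_scale (smooth_fun_sm oU sf aP d Uy) (form1_smf cM oU fe aP d Uy)).
- move=> x Ux; have [v1 [v2 [v3 n]]] := nd _ Ux; exists v1, v2, v3.
  have [df H] := dform_scale oU fe sf Ux; rewrite !H.
  have -> : f x * eta x v1 * (df v2 * eta x v3 - df v3 * eta x v2 + f x * dform M eta x v2 v3) +
    f x * eta x v2 * (df v3 * eta x v1 - df v1 * eta x v3 + f x * dform M eta x v3 v1) +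
    f x * eta x v3 * (df v1 * eta x v2 - df v2 * eta x v1 + f x * dform M eta x v1 v2) =
    (f x * f x) * (eta x v1 * dform M eta x v2 v3 + eta x v2 * dform M eta x v3 v1 + eta x v3 * dform M eta x v1 v2).
    move: (dform M eta x v2 v3) (dform M eta x v3 v1) (dform M eta x v1 v2) (eta x v1) (eta x v2) (eta x v3)
      (df v1) (df v2) (df v3) => *; ring.
  by rewrite !mulf_neq0// f0.
- move=> x Ux v; rewrite -(ke x Ux v); split=> [/eqP|->]; last by rewrite mulr0.
  by rewrite mulf_eq0 (negPf (f0 x Ux)) => /eqP.
Qed.

Variables (U U' : set T) (eta eta' : T -> V -> R).
Hypotheses (ce : contact_form M L1 L2 U eta) (ce' : contact_form M L1 L2 U' eta').

Definition cratio (x : T) : R := xget 0 [set r | forall v, eta' x v = r * eta x v].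

(** Both forms have kernel D, so v minus the multiple of v0 that brings it into ker eta is killed by
    eta' as well. The explicit quotient also gives smoothness of the pointwise chosen ratio, v0
    being kept constant in a chart. *)
Lemma cratio_eq x v0 : (U `&` U') x -> eta x v0 != 0 ->
  cratio x = eta' x v0 / eta x v0 /\ forall v, eta' x v = cratio x * eta x v.
Proof.
move=> [Ux Ux'] n0; have [_ fe _ ke] := ce; have [_ fe' _ ke'] := ce'.
have le : scalar (eta x) by case: fe => + _; apply.
have le' : scalar (eta' x) by case: fe' => + _; apply.
have H v : eta' x v = eta' x v0 / eta x v0 * eta x v.
  have : eta x (v - (eta x v / eta x v0) *: v0) = 0.
    by rewrite (scalB le) (scalZ le) divfK// subrr.
  move=> /(ke x Ux) /(ke' x Ux'); rewrite (scalB le') (scalZ le') => /eqP.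
  rewrite subr_eq0 => /eqP ->; move: n0; move: (eta x v) (eta x v0) (eta' x v0) => a b c b0.
  by field.
have E : cratio x = eta' x v0 / eta x v0.
  rewrite /cratio; case: xgetP => [r _ /= Hr|/(_ (eta' x v0 / eta x v0)) []//].
  by rewrite (Hr v0) mulfK.
by split=> // v; rewrite E.
Qed.

Lemma cratio_spec x : (U `&` U') x -> cratio x != 0 /\ forall v, eta' x v = cratio x * eta x v.
Proof.
move=> Ux; have [v0 n0] := contact_neq0 ce Ux.1; have [_ H] := cratio_eq Ux n0; split=> //.
have [v1 n1] := contact_neq0 ce' Ux.2; apply: contra_neq n1 => c0.
by rewrite H c0 mul0r.
Qed.

Lemma cratio_smooth : smooth_fun M (U `&` U') cratio.
Proof.
have [oU fe _ _] := ce; have [oU' fe' _ _] := ce'.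
apply: (smooth_fun_intro cM) => p Up; have Mp := U_pts ce Up.1.
have [aP rP] := patch_atP cM Mp; have [d E] := coord_rng rP.
set P := patch_at M p in aP rP d E *; set y := coord P p in d E.
exists P, y; split; [exact: aP|exact: d|exact: E|].
have [v0 n0] := contact_neq0 ce Up.1.
pose u0 := tcoord M P p v0.
have Ev : dpatch M P y u0 = v0 by rewrite /u0 -E; exact: tcoordK.
have Uy : (U `&` U') (par P y) by rewrite E.
have se := form1_smf cM oU fe aP d Uy.1; have se' := form1_smf cM oU' fe' aP d Uy.2.
have n : rep1 M P eta y u0 != 0 by rewrite /rep1 Ev E.
have nn := near_neq0 (f := fun z => rep1 M P eta z u0 : R^o) n (sm_cont (se.1 u0)).
apply: (sm_ext (f := fun z => rep1 M P eta' z u0 / rep1 M P eta z u0 : R^o)).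
  apply: filterS2 (mopen_near (mopenI oU oU') aP d Uy) nn => z [_ Uz] nz.
  by have [h _] := cratio_eq Uz nz; exact: esym h.
by apply: sm_mul; [exact: se'.1|apply: sm_inv => //; exact: se.1].
Qed.

End ContactForms.

(** * Conformal classes *)

Section Conformal.
Context {R : realType} {T : Type} {E : normedModType R} {fE : findim E}.
Variables (N : premanifold T E) (cN : charted N).

Lemma metric_nondeg O (g : T -> E -> E -> R) p : is_metric22 N O g -> O p -> exists v w, g p v w != 0.
Proof.
move=> [_ _ H] Op; have [L [_ HL]] := H p Op.
pose d : 'rV[R]_4 := \row_j (j == inord 0)%:R.
have e (k : nat) : (k < 4)%N -> d 0 (inord k) = (k == 0%N)%:R.
  by move=> k4; rewrite mxE -val_eqE /= !inordK.
exists (L d), (L d); rewrite HL !e//= !mulr0 !subr0 addr0 mulr1.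
Qed.

(** The factor is chosen pointwise. It is unique because a metric of signature (2,2) is nonzero at
    every point of its domain. *)
Definition cfactor (g g' : T -> E -> E -> R) (p : T) : R :=
  xget 0 [set r | forall v w, g' p v w = r * g p v w].

Lemma cfactorE g g' p r : (exists v w, g p v w != 0) -> (forall v w, g' p v w = r * g p v w) ->
  cfactor g g' p = r.
Proof.
move=> [v [w n]] H; rewrite /cfactor; case: xgetP => [r' _ /= H'|/(_ r)/=]; last by case.
by apply: (mulIf n); rewrite -H' -H.
Qed.

(** Uniqueness of the factor makes the local smooth factors agree with [cfactor], so they glue to
    one smooth factor on the overlap. *)
Lemma conformal_local O g O' g' : mopen N O -> mopen N O' -> is_metric22 N O g ->
  (forall p, (O `&` O') p -> exists S f, [/\ mopen N S, S p, smooth_fun N S f &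
     forall q, (S `&` (O `&` O')) q -> f q != 0 /\ forall v w, g' q v w = f q * g q v w]) ->
  conformal N O g O' g'.
Proof.
move=> oO oO' mg H; exists (cfactor g g').
have Ef S f q : (forall q, (S `&` (O `&` O')) q -> f q != 0 /\ forall v w, g' q v w = f q * g q v w) ->
    (S `&` (O `&` O')) q -> cfactor g g' q = f q.
  by move=> Hf Sq; apply: cfactorE; [exact: (metric_nondeg mg Sq.2.1)|exact: (Hf q Sq).2].
split.
  apply: (smooth_fun_intro cN) => p Op; have [S [f [oS Sp sf Hf]]] := H p Op.
  have Np : pts N p by case: oO => + _; apply; exact: Op.1.
  have [aP rP] := patch_atP cN Np; have [d e] := coord_rng rP.
  exists (patch_at N p), (coord (patch_at N p) p); split; [exact: aP|exact: d|exact: e|].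
  have Sy : (S `&` (O `&` O')) (par (patch_at N p) (coord (patch_at N p) p)) by rewrite e.
  apply: sm_ext (smooth_fun_sm oS sf aP d Sy.1).
  apply: filterS (mopen_near (mopenI oS (mopenI oO oO')) aP d Sy) => z [_ Sz].
  by rewrite /= (Ef S f _ Hf Sz).
move=> p Op; have [S [f [oS Sp sf Hf]]] := H p Op.
have Sq : (S `&` (O `&` O')) p by [].
by rewrite (Ef S f p Hf Sq); exact: Hf.
Qed.

Variables (S : set T) (FF : set T -> (T -> E -> E -> R) -> Prop).
Hypotheses (F1 : forall O g, FF O g -> [/\ mopen N O, O `<=` S & is_metric22 N O g])
  (F2 : forall p, S p -> exists O g, FF O g /\ O p)
  (F3 : forall O g O' g', FF O g -> FF O' g' -> conformal N O g O' g').

(** Conformality to every member of the generating family is imposed directly, instead of closing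
    the family up; the maximality clause of [conformal_class] is then immediate. *)
Definition gclass (O : set T) (g : T -> E -> E -> R) :=
  [/\ mopen N O, O `<=` S, is_metric22 N O g & forall O' g', FF O' g' -> conformal N O' g' O g].

(** Near a point both metrics are compared with one member of the family defined there, and the
    factor between them is the quotient of the two factors obtained. *)
Lemma gclass_conformal O g O' g' : gclass O g -> gclass O' g' -> conformal N O g O' g'.
Proof.
move=> [oO OS mg H] [oO' OS' mg' H']; apply: (conformal_local oO oO' mg) => p Op.
have [A [k [Fk Ap]]] := F2 (OS _ Op.1); have [oA _ _] := F1 Fk.
have [f [sf Hf]] := H _ _ Fk; have [f' [sf' Hf']] := H' _ _ Fk.
exists (A `&` (O `&` O')), (fun q => f' q / f q); split.
- exact: mopenI oA (mopenI oO oO').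
- by [].
- apply: (smooth_fun_intro cN) => q [Aq [Oq Oq']].
  have Nq : pts N q by case: oO => + _; apply.
  have [aP rP] := patch_atP cN Nq; have [d e] := coord_rng rP.
  exists (patch_at N q), (coord (patch_at N q) q); split; [exact: aP|exact: d|exact: e|].
  have Sy : (A `&` O) (par (patch_at N q) (coord (patch_at N q) q)) by rewrite e.
  have Sy' : (A `&` O') (par (patch_at N q) (coord (patch_at N q) q)) by rewrite e.
  apply: sm_mul; first exact: (smooth_fun_sm (mopenI oA oO') sf' aP d Sy').
  apply: sm_inv; last exact: (smooth_fun_sm (mopenI oA oO) sf aP d Sy).
  by rewrite /= e; have [] := Hf q (conj Aq Oq).
- move=> q [[Aq [Oq Oq']] _].
  have [n E1] := Hf q (conj Aq Oq); have [n' E2] := Hf' q (conj Aq Oq').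
  split; first by rewrite mulf_neq0// invr_neq0.
  by move=> v w; rewrite E1 E2 mulrA divfK.
Qed.

Lemma gclass_FF O g : FF O g -> gclass O g.
Proof. by move=> Fg; have [? ? ?] := F1 Fg; split=> // O' g' Fg'; exact: F3. Qed.

Lemma gclass_class : conformal_class N S gclass.
Proof.
split.
- by move=> O g [].
- by move=> p /F2 [A [g [Fg Op]]]; exists A, g; split=> //; exact: gclass_FF.
- exact: gclass_conformal.
- by move=> O g oO OS mg H; split=> // O' g' Fg'; apply: H; exact: gclass_FF.
Qed.

(** A class containing the family consists of metrics conformal to it, so it lies in [gclass]; the
    other inclusion is the maximality clause for C. *)
Lemma gclass_unique C : conformal_class N S C -> (forall O g, FF O g -> C O g) ->
  forall O g, C O g <-> gclass O g.
Proof.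
move=> [C1 C2 C3 C4] FC.
have sub O g : C O g -> gclass O g.
  by move=> Cg; have [? ? ?] := C1 _ _ Cg; split=> // O' g' /FC Cg'; exact: C3.
move=> O g; split; first exact: sub.
move=> Gg; have [oO OS mg _] := Gg; apply: C4 => // O' g' Cg'.
by apply: gclass_conformal => //; exact: sub.
Qed.

End Conformal.

(** * Comparison of the metrics of two contact forms *)

Section Overlap.
Context {R : realType} {T : Type}.
Local Notation V := 'rV[R]_3.
Variables (M : premanifold T V) (L1 L2 : T -> set V).
Hypothesis hM : path_geometry M L1 L2.
Let cM := cM hM.
Local Notation SDM := (SD M L1 L2).
Let cS := SD_charted hM.
Local Notation over := (SDstar_over M L1 L2).

Lemma gdata_sub Z P W e (O : set T) x : gdata M Z P W e -> mopen M O -> (par P @` W) x -> O x ->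
  exists W', [/\ gdata M Z P W' e, (par P @` W') x & par P @` W' `<=` O].
Proof.
move=> [aP [oW WP] [ue fe] Ze] oO [y Wy <-] Oy.
have sub : par P @` (W `&` (dom P `&` par P @^-1` O)) `<=` par P @` W.
  by move=> p [z [Wz _] <-]; exists z.
exists (W `&` (dom P `&` par P @^-1` O)); split.
- split; [exact: aP| | |].
  + split; last by move=> z [/WP].
    by apply: openI => //; case: oO => _; apply.
  + split; first by move=> p /sub; exact: ue.
    by move=> i; apply: form1_sub (fe i).
  + by move=> p /sub; exact: Ze.
- by exists y => //; split=> //; split=> //; exact: WP.
- by move=> p [z [_ [_ Oz]] <-].
Qed.

Lemma gdata_kchart U eta p : contact_form M L1 L2 U eta -> forall O, mopen M O -> O p.1 ->
  over U p -> exists P W e k d z,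
  [/\ gdata M (Bset M L1 L2 U eta) P W e, W z.1, par P @` W `<=` O, k * k = 1 & 0 < z.2 /\
   (d = 1 \/ d = -1) /\ par (kchart P W e k (k * d)) z = p].
Proof.
move=> ce O oO Op /(over_kchart hM ce) [P [W [e [k [d [z [gd Wz kk z0 [dE zp]]]]]]]].
have Wp : (par P @` W) p.1 by exists z.1 => //; rewrite -zp.
have [W' [gd' Wp' sub]] := gdata_sub gd oO Wp Op.
exists P, W', e, k, d, z; split=> //.
have [y Wy E] := Wp'; have [aP [_ WP] _ _] := gd; have [_ [_ WP'] _ _] := gd'.
have Ez : par P y = par P z.1 by rewrite E -zp.
have <- : y = z.1.
  by rewrite -(coordK cM aP (WP' _ Wy)) Ez (coordK cM aP (WP _ Wz)).
exact: Wy.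
Qed.

(** Stated for two contact forms with a given ratio on O, so as to serve both the rescaling by f on
    one domain and the overlap of two domains. The chart of an adapted coframe is first shrunk into
    O, where f is smooth and nonzero. *)
Lemma fefferman_ratio U U' eta eta' (f : T -> R) G G' (O : set T) :
  contact_form M L1 L2 U eta -> contact_form M L1 L2 U' eta' ->
  fefferman_metric M L1 L2 U eta G -> fefferman_metric M L1 L2 U' eta' G' ->
  mopen M O -> O `<=` U -> O `<=` U' -> smooth_fun M O f ->
  (forall x, O x -> f x != 0 /\ forall v, eta' x v = f x * eta x v) ->
  forall p v w, over O p -> G' p v w = f p.1 * G p v w.
Proof.
move=> ce ce' fG fG' oO OU OU' sf Hf p v w [sp Op].
have Up : over U p by split=> //; exact: OU.
have [P [W [e [k [d [z [gd Wz WO kk [z0 [dE zp]]]]]]]]] := gdata_kchart ce oO Op Up.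
have dd : d * d = 1 by case: dE => ->; rewrite ?mulrNN mulr1.
have aK := sd_atlas (kd_data hM ce dd gd kk).
pose K := kchart P W e k (k * d).
have dK : dom K z by [].
have WU' : par P @` W `<=` U' by move=> x /WO /OU'.
have sf' : smooth_fun M (par P @` W) f := smooth_fun_sub WO sf.
have f0 x : (par P @` W) x -> f x != 0 by move=> /WO /Hf [].
have ff x : (par P @` W) x -> forall v, eta' x v = f x * eta x v by move=> /WO /Hf [].
have H : forall a b, G' (par K z) (dpatch SDM K z a) (dpatch SDM K z b) =
    f (par P z.1) * G (par K z) (dpatch SDM K z a) (dpatch SDM K z b).
  by move=> a b; exact: (rescale_chart hM ce ce' gd WU' sf' f0 ff a b fG fG' dE Wz kk z0).
have tK u : dpatch SDM K z (tcoord SDM K (par K z) u) = u by exact: (tcoordK cS u aK dK).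
have Ez : par P z.1 = p.1 by rewrite -zp.
have zp' : par K z = p := zp.
exact (transport_ratio (H _ _) (f_equal f Ez) zp' (tK v) (tK w)).
Qed.

Lemma smooth_fun_lift (O : set T) f : mopen M O -> smooth_fun M O f ->
  smooth_fun SDM (over O) (f \o fst).
Proof.
move=> oO sf; apply: (smooth_fun_intro cS) => p [sp Op].
have [P [W [Y1 [Y2 [z [sd Wz zp]]]]]] := sd_cover hM sp.1.
exists (sdpatch P W Y1 Y2), z; split; [exact: (sd_atlas sd)|exact: Wz|exact: zp|].
have Oz : O (par P z.1) by move: Op; rewrite -zp.
exact: (sm_at_fst (k := f \o par P) (smooth_fun_sm oO sf (sd_aP sd) (sd_dom sd Wz) Oz)).
Qed.

Lemma fefferman_conformal U U' eta eta' G G' :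
  contact_form M L1 L2 U eta -> contact_form M L1 L2 U' eta' ->
  fefferman_metric M L1 L2 U eta G -> fefferman_metric M L1 L2 U' eta' G' ->
  conformal SDM (over U) G (over U') G'.
Proof.
move=> ce ce' fG fG'; have [oU _ _ _] := ce; have [oU' _ _ _] := ce'.
have oI := mopenI oU oU'.
have E : over U `&` over U' = over (U `&` U').
  by apply/seteqP; split=> p; [move=> [[? ?] [_ ?]]|move=> [? [? ?]]].
exists (cratio eta eta' \o fst); rewrite E; split.
  exact: smooth_fun_lift oI (cratio_smooth hM ce ce').
move=> p [sp Up]; have [n _] := cratio_spec ce ce' Up; split=> [|v w]; first exact: n.
refine (fefferman_ratio ce ce' fG fG' oI _ _ (cratio_smooth hM ce ce') _ v w _).
- by move=> x [].
- by move=> x [].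
- by move=> x Ux; exact: (cratio_spec ce ce' Ux).
- by split.
Qed.

Lemma SD_open_contact p : SDstar M L1 L2 p -> exists U eta G,
  [/\ contact_form M L1 L2 U eta, fefferman_metric M L1 L2 U eta G & over U p].
Proof.
move=> sp; have Mp : pts M p.1 by case: sp => [[]].
have [_ _ _ _ /(_ _ Mp) [U [eta [Up ce]]]] := hM.
by have [G fG] := feff_exists hM ce; exists U, eta, G.
Qed.

Definition feff_family (O : set (T * set V)) (g : T * set V -> V * R^o -> V * R^o -> R) :=
  exists U eta, [/\ contact_form M L1 L2 U eta, fefferman_metric M L1 L2 U eta g & O = over U].

End Overlap.

(** [SDJ] acts on a ray through decompositions along L1 and L2, so [SDJ \o h] is identified with
    [kmap (-1)] at points of B, and the diffeomorphism property is transferred along this equality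
    on the open set of all of B. *)
Lemma Jh_diffeo {R : realType} {T : Type} (M : premanifold T 'rV[R]_3) (L1 L2 : T -> set 'rV[R]_3)
  (hM : path_geometry M L1 L2) U eta : contact_form M L1 L2 U eta ->
  diffeo (B M L1 L2 U eta) (Bset M L1 L2 U eta) (SD M L1 L2) (SDminus M L1 L2 U eta) (SDJ L1 L2 \o h).
Proof.
move=> ce; have [oB oS im sf [g [sg gK]]] := kmap_diffeo hM ce (@opp_sq1 R).
have cB := B_charted hM ce; have cS := SD_charted hM.
have E q : Bset M L1 L2 U eta q -> kmap (-1) q = (SDJ L1 L2 \o h) q.
  by move=> Bq; symmetry; exact: (kmapN1 hM ce).
split; [exact: oB|exact: oS| | |].
- rewrite /SDminus -im; apply/seteqP; split=> p [q Bq <-]; exists q => //; first exact: E.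
  by symmetry; exact: E.
- apply: (smooth_map_intro cB cS oB) => p Bp.
  have sk := kmap_smooth hM ce (@opp_sq1 R) Bp.
  exact: (smooth_at_ext oB Bp E sk).
- by exists g; split; [exact: sg|move=> p Bp; rewrite -(E p Bp); exact: gK].
Qed.

Theorem theorem3 (R : realType) (T : Type) (M : premanifold T 'rV[R]_3)
    (L1 L2 : T -> set 'rV[R]_3) (hM : path_geometry M L1 L2) :
  [/\ is_manifold (SD M L1 L2),
      mopen (SD M L1 L2) (SDstar M L1 L2),
      (* constructions attached to a contact form on an open subset *)
      (forall (U : set T) (eta : T -> 'rV[R]_3 -> R),
         contact_form M L1 L2 U eta ->
         let BU := B M L1 L2 U eta in
         [/\ (* the reduction B and its local sections *)
             is_reduction M U BU /\
             (forall (W : set T) (e : T -> 'M[R]_3),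
                mopen M W -> W `<=` U -> coframe_on M W e ->
                ((forall x, W x -> pts BU (x, e x)) <->
                 adapted_coframe M L1 L2 eta W e)),
             (* the connection *)
             (exists al, adapted_connection M L1 L2 U eta al) /\
             (forall al al', adapted_connection M L1 L2 U eta al ->
                adapted_connection M L1 L2 U eta al' ->
                forall p v, pts BU p -> al' p v = al p v),
             (* the function K and the metric on B *)
             (forall al, adapted_connection M L1 L2 U eta al ->
                [/\ exists K, curvature_fun M L1 L2 U eta al K,
                    (forall K K', curvature_fun M L1 L2 U eta al K ->
                       curvature_fun M L1 L2 U eta al K' ->
                       forall p, pts BU p -> K' p = K p) &
                    (forall K, curvature_fun M L1 L2 U eta al K ->
                       is_metric22 BU (pts BU) (gB M L1 L2 U eta al K))]),
             (* the decomposition of SD^* and the isomorphisms h, J o h *)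
             [/\ SDstar_over M L1 L2 U =
                   SDplus M L1 L2 U eta `|` SDminus M L1 L2 U eta,
                 SDplus M L1 L2 U eta `&` SDminus M L1 L2 U eta = set0,
                 diffeo BU (pts BU) (SD M L1 L2) (SDplus M L1 L2 U eta) h,
                 diffeo BU (pts BU) (SD M L1 L2) (SDminus M L1 L2 U eta)
                   (SDJ L1 L2 \o h) &
                 (forall s p, s != 0 -> pts BU p ->
                    h (Bact s p) = SDscale L1 L2 s (h p) /\
                    SDJ L1 L2 (h (Bact s p)) =
                      SDscale L1 L2 s (SDJ L1 L2 (h p)))] &
             (* the induced metric on SD^*, and its behaviour under rescaling *)
             [/\ exists G, fefferman_metric M L1 L2 U eta G,
                 (forall G, fefferman_metric M L1 L2 U eta G ->
                    is_metric22 (SD M L1 L2) (SDstar_over M L1 L2 U) G) &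
                 (forall f : T -> R, smooth_fun M U f ->
                    (forall x, U x -> f x != 0) ->
                    contact_form M L1 L2 U (fun x v => f x * eta x v) /\
                    (forall G G', fefferman_metric M L1 L2 U eta G ->
                       fefferman_metric M L1 L2 U (fun x v => f x * eta x v) G' ->
                       forall p v w, SDstar_over M L1 L2 U p ->
                         G' p v w = f p.1 * G p v w))]]) &
      (* the conformal class on SD^* *)
      (exists C, conformal_class (SD M L1 L2) (SDstar M L1 L2) C /\
         (forall U eta G, contact_form M L1 L2 U eta ->
            fefferman_metric M L1 L2 U eta G ->
            C (SDstar_over M L1 L2 U) G) /\
         (forall C', conformal_class (SD M L1 L2) (SDstar M L1 L2) C' ->
            (forall U eta G, contact_form M L1 L2 U eta ->
               fefferman_metric M L1 L2 U eta G ->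
               C' (SDstar_over M L1 L2 U) G) ->
            forall O g, C' O g <-> C O g))].
Proof.
have cM := cM hM; split.
- exact: (SD_manifold hM).
- exact: (SDstar_open hM).
- move=> U eta ce BU; split.
  + split; first exact: (B_reduction hM ce).
    by move=> W e; exact: (B_sections hM).
  + split; first by exists (alB M L1 L2 U eta); exact: (alB_adapted hM ce).
    move=> al al' aal aal' p v Bp.
    by rewrite (connection_alB hM ce aal v Bp) (connection_alB hM ce aal' v Bp).
  + move=> al aal; split.
    * by exists (fun p => dal M L1 L2 U eta p i1 i2); exact: (curvature_exists hM ce aal).
    * move=> K K' cK cK' p Bp.
      by rewrite (curvature_unique hM ce aal cK Bp) (curvature_unique hM ce aal cK' Bp).
    * by move=> K cK; exact: (gB_metric hM ce aal cK).
  + split.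
    * exact: (sign_cover hM ce).
    * exact: (sign_disjoint hM ce).
    * have -> : h = kmap 1 :> (T * 'M[R]_3 -> T * set 'rV[R]_3) by apply/funext => q; exact: kmap1.
      exact: (kmap_diffeo hM ce (@one_sq1 R)).
    * exact: (Jh_diffeo hM ce).
    * by move=> s p s0 Bp; exact: (h_equivariant hM ce).
  + split; first exact: (feff_exists hM ce).
      by move=> G; exact: (feff_metric hM ce).
    move=> f sf f0; have ce' := contact_rescale hM ce sf f0; split; first exact: ce'.
    move=> G G' fG fG' p v w sp; have [oU _ _ _] := ce.
    refine (fefferman_ratio hM ce ce' fG fG' oU (fun x H => H) (fun x H => H) sf _ v w sp).
    by move=> x Ux; split=> //; exact: f0.
- have cS := SD_charted hM.
  (* Contact forms are given only locally, so the class is generated by the metrics of all contact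
     forms on open subsets of M; their domains cover the rays outside the two lines. *)
  pose FF := feff_family M L1 L2.
  have F1 O g : FF O g -> [/\ mopen (SD M L1 L2) O, O `<=` SDstar M L1 L2 & is_metric22 (SD M L1 L2) O g].
    move=> [U [eta [ce fG ->]]]; have [oU _ _ _] := ce; split.
    - exact: (star_over_open hM oU).
    - by move=> p [].
    - exact: (feff_metric hM ce).
  have F2 p : SDstar M L1 L2 p -> exists O g, FF O g /\ O p.
    move=> /(SD_open_contact hM) [U [eta [G [ce fG Up]]]].
    by exists (SDstar_over M L1 L2 U), G; split=> //; exists U, eta.
  have F3 O g O' g' : FF O g -> FF O' g' -> conformal (SD M L1 L2) O g O' g'.
    move=> [U [eta [ce fG ->]]] [U' [eta' [ce' fG' ->]]].
    exact: (fefferman_conformal hM ce ce').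
  exists (gclass (SD M L1 L2) (SDstar M L1 L2) FF); split.
    exact: (gclass_class cS F1 F2 F3).
  split.
    by move=> U eta G ce fG; apply: (gclass_FF F1 F3); exists U, eta.
  move=> C' cC' HC O g; apply: (gclass_unique cS F1 F2 cC') => A k [U [eta [ce fG ->]]].
  exact: (HC _ _ _ ce fG).
Qed.
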